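(* Let $n,m$ be coprime positive integers and $\mathring{\mathfrak g}=\mathfrak{sl}(n|m)$. The groupoid $\mathfrak T_{iso}$ acts on $\mathcal B$ by odd reflections, via a functor $\mathbf B:\mathfrak T_{iso}\to\mathcal S(\mathcal B)$, and there is a commutative diagram: the composite of $\mathbf B$ with the isomorphism $\mathcal S(\mathcal B)\cong\mathcal S([\mathring{\mathcal B}\times\mathbb Z])$ induced by the bijection $\mathcal B\leftrightarrow[\mathring{\mathcal B}\times\mathbb Z]$ (under which the extension of $\mathring{\mathfrak b}(\sigma,k)$ to $\widehat L(\mathring{\mathfrak g})$ corresponds to the class $[\mathring{\mathfrak b}(\sigma),k]$) is equal to the functor $\mathbb B:\mathfrak T_{iso}\to\mathcal S([\mathring{\mathcal B}\times\mathbb Z])$.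
   Context: **Young diagrams.** $\mathbf R$ is a rectangle with $n$ rows, indexed from the top down by $\epsilon_1,\dots,\epsilon_n$, and $m$ columns, indexed from left to right by $\delta_1,\dots,\delta_m$. The box in row $\epsilon_i$ and column $\delta_j$ is $\mathfrak B(\epsilon_i-\delta_j)$. $X$ is the set of partitions $\lambda=(\lambda_1\ge\dots\ge\lambda_n)$ with $m\ge\lambda_1$, $\lambda_n\ge0$, identified with Young diagrams in the bottom left corner of $\mathbf R$ ($\lambda_p$ is the number of leftmost boxes of $\lambda$ in row $\epsilon_{n+1-p}$). $\lambda'_j=|\{p:\lambda_p\ge j\}|$; $\emptyset=(0^n)$. $\Delta_1^+=\{\epsilon_i-\delta_j\}$, $\Delta_{iso}=\Delta_1^+\cup(-\Delta_1^+)$. For $\alpha\in\Delta_1^+$, $X_\alpha$ (resp. $X_{-\alpha}$) is the set of $\lambda\in X$ such that adding a box $\mathfrak B(\alpha)\notin\lambda$ (resp. deleting a box $\mathfrak B(\alpha)\in\lambda$) gives a Young diagram; $t_{\pm\alpha}:X_{\pm\alpha}\to X_{\mp\alpha}$ adds/deletes this box. **Groupoid.** $\mathfrak T_{iso}$ is the groupoid with base $\Delta_{iso}$ and non-identity morphisms $\rho_\alpha:\alpha\to-\alpha$ ($\alpha\in\Delta_{iso}$). For a set $Y$, $\mathcal S(Y)$ is the groupoid whose objects are the subsets of $Y$ and whose morphisms are the bijections between subsets; an action on $Y$ is a functor to $\mathcal S(Y)$. A bijection $\omega:Y\to Z$ induces an isomorphism $\mathcal S(Y)\to\mathcal S(Z)$,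 $g\mapsto\omega g\omega^{-1}$. **Adding and deleting rows and columns.** $X(\mathrm{r.full})=\{\lambda_1=m\}$, $X(\mathrm{r.empty})=\{\lambda_n=0\}$, $X(\mathrm{c.full})=\{\lambda'_1=n\}$, $X(\mathrm{c.empty})=\{\lambda'_m=0\}$. On these sets respectively put $\lambda^{-_r}=(\lambda_2,\dots,\lambda_n,0)$, $\lambda^{+_r}=(m,\lambda_1,\dots,\lambda_{n-1})$, $\lambda^{-_c}=(\lambda_1-1,\dots,\lambda_n-1)$, $\lambda^{+_c}=(\lambda_1+1,\dots,\lambda_n+1)$. **Words, shuffles and Borels.** The word of $\lambda\in X$ is the sequence of $m$ letters $\mathtt r$ and $n$ letters $\mathtt d$ given by the right and down unit steps of the upper border of $\lambda$ from the top left to the bottom right corner of $\mathbf R$. The shuffle $\sigma$ of $\lambda$ is the sequence $(\sigma(1),\dots,\sigma(m+n))$ obtained by replacing, from left to right, the letters $\mathtt d$ by $1,\dots,n$ and the letters $\mathtt r$ by $1',\dots,m'$. Put $\epsilon_{j'}=\delta_j$, $r=m+n-1$. $\mathring{\mathcal B}$ is the set of Borel subalgebras of $\mathring{\mathfrak g}$ whose even part consists of the upper triangular even matrices; $\mathring{\mathfrak b}(\lambda)=\mathring{\mathfrak b}(\sigma)\in\mathring{\mathcal B}$ has ordered simple roots $\epsilon_{\sigma(p)}-\epsilon_{\sigma(p+1)}$, $1\le p\le r$, and $\lambda\mapsto\mathring{\mathfrak b}(\lambda)$ is a bijection $X\to\mathring{\mathcal B}$. $\mathring{\mathcal B}(\alpha)$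 is the set of elements of $\mathring{\mathcal B}$ having $\alpha$ as a simple root, and $r_\alpha:\mathring{\mathcal B}(\alpha)\to\mathring{\mathcal B}(-\alpha)$ is the odd reflection. The odd reflection at an odd isotropic simple root $\beta$ replaces $\beta$ by $-\beta$, a simple root $\gamma\ne\beta$ by $\gamma+\beta$ if that is a root, and fixes the other simple roots. **$[\mathring{\mathcal B}\times\mathbb Z]$ and $\mathbb B$.** $\sim$ is the smallest equivalence relation on $\mathring{\mathcal B}\times\mathbb Z$ with $(\mathring{\mathfrak b}(\lambda),k)\sim(\mathring{\mathfrak b}(\lambda^{-_r}),k+m)$ for $\lambda\in X(\mathrm{r.full})$ and $(\mathring{\mathfrak b}(\lambda),k)\sim(\mathring{\mathfrak b}(\lambda^{-_c}),k+n)$ for $\lambda\in X(\mathrm{c.full})$; $[\mathring{\mathcal B}\times\mathbb Z]$ is the set of classes. $\nu,\eta$ act on roots by $\nu(\epsilon_i)=\epsilon_{i+1}$ (indices mod $n$), $\nu(\delta_j)=\delta_j$, $\eta(\delta_{j+1})=\delta_j$ (indices mod $m$), $\eta(\epsilon_i)=\epsilon_i$. Every integer is $k=in+jm$ with $i,j\in\mathbb Z$, and $\eta^i\nu^j$ depends only on $k$. $\mathbb B(\alpha)$ is the set of classes containing some $(\mathring{\mathfrak b},in+jm)$ with $\mathring{\mathfrak b}\in\mathring{\mathcal B}(\eta^i\nu^j\alpha)$, and $\mathbb B(\rho_\alpha)[\mathring{\mathfrak b},in+jm]=[r_{\eta^i\nu^j\alpha}(\mathring{\mathfrak b}),in+jm]$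 for such pairs. **Affinization.** Over an algebraically closed field $\mathtt k$ of characteristic 0, $\widehat L(\mathring{\mathfrak g})=(\mathtt k[t,t^{-1}]\otimes\mathring{\mathfrak g})\oplus\mathtt kc\oplus\mathtt kd$ with $[t^a\otimes x,t^b\otimes y]=t^{a+b}\otimes[x,y]+a(x,y)\delta_{a,-b}c$ for an invariant bilinear form, $c$ central, and $d$ acting as $t\frac{d}{dt}$ on the loop algebra. $\overline\delta$ is the basic imaginary root ($\overline\delta(d)=1$, zero on $c$ and on diagonal matrices). Roots are written as integer combinations of the $\epsilon_i,\delta_j,\overline\delta$, and Borel subalgebras are described by their sets of simple roots. **The algebras $\mathring{\mathfrak g}(k)$ and Borels $\mathring{\mathfrak b}(\lambda,k)$.** For each $(\lambda,k)\in X\times\mathbb Z$, with $\sigma$ the shuffle of $\lambda$, there is a Borel subalgebra $\mathring{\mathfrak b}(\lambda,k)=\mathring{\mathfrak b}(\sigma,k)$ of a subalgebra $\mathring{\mathfrak g}(k)\cong\mathring{\mathfrak g}$ of $\widehat L(\mathring{\mathfrak g})$, with ordered simple roots $(\beta_1,\dots,\beta_r)$, and extending root $\beta_0=\overline\delta-\sum_{p=1}^r\beta_p$; $\mathring{\mathfrak g}(k)$ is generated by the root spaces of the $\pm\beta_p$, $1\le p\le r$. They are determined by: $\mathring{\mathfrak g}(0)=\mathring{\mathfrak g}$, $\mathring{\mathfrak b}(\lambda,0)=\mathring{\mathfrak b}(\lambda)$; if $\lambda\in X(\mathrm{r.full})$, then $\mathring{\mathfrak b}(\lambda^{-_r},k+m)$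 has list $(\beta_0,\dots,\beta_{r-1})$; if $\lambda\in X(\mathrm{c.empty})$, then $\mathring{\mathfrak b}(\lambda^{+_c},k-n)$ has list $(\beta_0,\dots,\beta_{r-1})$; reversing these, $\mathring{\mathfrak b}(\lambda^{+_r},k-m)$ for $\lambda\in X(\mathrm{r.empty})$ and $\mathring{\mathfrak b}(\lambda^{-_c},k+n)$ for $\lambda\in X(\mathrm{c.full})$ have list $(\beta_2,\dots,\beta_r,\beta_0)$; and for fixed $k$ the Borels $\mathring{\mathfrak b}(\lambda,k)$ for different $\lambda$ are related by odd reflections: if $\lambda\in X_\alpha$ and $t_\alpha$ interchanges letters $p,p+1$ of the word, the list for $(t_\alpha(\lambda),k)$ is obtained by the odd reflection at $\beta_p$. The local name of $\beta_p$ ($1\le p\le r$) is $\epsilon_{\sigma(p)}-\epsilon_{\sigma(p+1)}$. The extension of $\mathring{\mathfrak b}(\lambda,k)$ to $\widehat L(\mathring{\mathfrak g})$ is the Borel subalgebra with simple roots $\{\beta_0,\dots,\beta_r\}$. **$\mathcal B$ and the action $\mathbf B$.** $\mathcal B$ is the set of Borel subalgebras of $\widehat L(\mathring{\mathfrak g})$ that are extensions of the $\mathring{\mathfrak b}(\lambda,k)$, $(\lambda,k)\in X\times\mathbb Z$. The action by odd reflections: $\mathbf B(\alpha)$ is the set of elements of $\mathcal B$ that are extensions of some $\mathring{\mathfrak b}(\lambda,in+jm)$ having a simple root with local name $\eta^i\nu^j\alpha$, and $\mathbf B(\rho_\alpha)$ performs the odd reflection of the Borel subalgebra of $\widehat L(\mathring{\mathfrak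 g})$ at that simple root.
   Formalization: For n = m = 1 the stated odd reflection rule (γ to γ+β if that is a root) would give the imaginary root as a simple root and leave 𝓑; there the formal rule replaces γ by γ+2β, the true odd reflection. For all other coprime n, m the rule is the stated one. *)

(* Defs.v *)
From HB Require Import structures.
From mathcomp Require Import all_boot all_order all_algebra.
From mathcomp Require Import boolp classical_sets functions cardinality fsbigop.

Set Implicit Arguments.
Unset Strict Implicit.
Unset Printing Implicit Defensive.

Import Order.TTheory GRing.Theory Num.Theory.

Local Open Scope classical_set_scope.
Local Open Scope ring_scope.

Record groupoid := Groupoid {
  gobj :> Type;
  ghom : gobj -> gobj -> Type;
  gid : forall a, ghom a a;
  gcomp : forall a b c, ghom b c -> ghom a b -> ghom a c;
  gcompA : forall a b c d (h : ghom c d) (g : ghom b c) (f : ghom a b),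
    gcomp h (gcomp g f) = gcomp (gcomp h g) f;
  gcomp1g : forall a b (f : ghom a b), gcomp (gid b) f = f;
  gcompg1 : forall a b (f : ghom a b), gcomp f (gid a) = f;
  ginvertible : forall a b (f : ghom a b),
    exists g : ghom b a, gcomp g f = gid a /\ gcomp f g = gid b }.

Record gfunctor (C D : groupoid) := GFunctor {
  fobj :> C -> D;
  fhom : forall a b, ghom a b -> ghom (fobj a) (fobj b);
  fhom1 : forall a, fhom (gid a) = gid (fobj a);
  fhomM : forall a b c (g : ghom b c) (f : ghom a b),
    fhom (gcomp g f) = gcomp (fhom g) (fhom f) }.

Program Definition gfunctor_comp (C D E : groupoid)
    (G : gfunctor D E) (F : gfunctor C D) : gfunctor C E :=
  @GFunctor C E (fun a => G (F a)) (fun a b f => fhom G (fhom F f)) _ _.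
Next Obligation. by rewrite !fhom1. Qed.
Next Obligation. by rewrite !fhomM. Qed.

Record bijection (Y Z : Type) := Bijection {
  bfun :> Y -> Z;
  binv : Z -> Y;
  bfunK : cancel bfun binv;
  binvK : cancel binv bfun }.

Section SymmetricGroupoid.
Context {Y : Type}.

Definition sbij (A B : set Y) : Type := {f : A -> B | bijective f}.

Lemma sbij_eq (A B : set Y) (f g : sbij A B) :
  (forall x, sval f x = sval g x) -> f = g.
Proof.
case: f g => [f fP] [g gP] /= fg; have {}fg : f = g by apply: funext.
by rewrite -fg in gP *; congr exist; apply: Prop_irrelevance.
Qed.

Definition sbij_id (A : set Y) : sbij A A :=
  exist _ id (Bijective (fun _ => erefl) (fun _ => erefl)).

Definition sbij_comp (A B C : set Y) (g : sbij B C) (f : sbij A B) :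
  sbij A C := exist _ (sval g \o sval f) (bij_comp (svalP g) (svalP f)).

Lemma sbij_invertible (A B : set Y) (f : sbij A B) :
  exists g : sbij B A,
    sbij_comp g f = sbij_id A /\ sbij_comp f g = sbij_id B.
Proof.
case: f => f fP; case: (fP) => g fK gK.
by exists (exist _ g (Bijective gK fK)); split; apply: sbij_eq => x /=.
Qed.

End SymmetricGroupoid.

Program Definition Sym (Y : Type) : groupoid :=
  @Groupoid (set Y) sbij sbij_id sbij_comp _ _ _ (@sbij_invertible Y).
Next Obligation. exact: sbij_eq. Qed.
Next Obligation. exact: sbij_eq. Qed.
Next Obligation. exact: sbij_eq. Qed.

(** The functor [Sym Y -> Sym Z] given by [g |-> w g w^-1]; the image of
    [A] under [w] is written as the preimage of [A] under [w^-1]. *)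
Section Conjugation.
Context {Y Z : Type} (w : bijection Y Z).

Definition conj_obj (A : set Y) : set Z := binv w @^-1` A.

Lemma conj_in (A : set Y) (y : A) : w (sval y) \in conj_obj A.
Proof. by case: y => y yA /=; rewrite inE /conj_obj /= bfunK; apply: set_mem. Qed.

Lemma conj_out (A : set Y) (z : conj_obj A) : binv w (sval z) \in A.
Proof. by case: z => z /= /set_mem; rewrite /conj_obj /= => /mem_set. Qed.

Definition conj_fun (A B : set Y) (g : A -> B) :
    conj_obj A -> conj_obj B :=
  fun z => exist _ (w (sval (g (exist _ (binv w (sval z)) (conj_out z)))))
             (conj_in _).

Lemma conj_funK (A B : set Y) (f : A -> B) (g : B -> A) :
  cancel f g -> cancel (conj_fun f) (conj_fun g).
Proof.
move=> fK z; apply: val_inj => /=.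
have -> : exist (fun y => y \in B) (binv w (w (sval (f
    (exist (fun y => y \in A) (binv w (sval z)) (conj_out z))))))
    (conj_out (conj_fun f z))
    = f (exist _ (binv w (sval z)) (conj_out z)).
  by apply: val_inj; rewrite /= bfunK.
by rewrite fK /= binvK.
Qed.

Lemma conj_fun_bij (A B : set Y) (g : A -> B) :
  bijective g -> bijective (conj_fun g).
Proof. by case=> h gK hK; exists (conj_fun h); apply: conj_funK. Qed.

Definition conj_hom (A B : set Y) (g : sbij A B) :
    sbij (conj_obj A) (conj_obj B) :=
  exist _ (conj_fun (sval g)) (conj_fun_bij (svalP g)).

Program Definition Sym_conj : gfunctor (Sym Y) (Sym Z) :=
  @GFunctor (Sym Y) (Sym Z) conj_obj conj_hom _ _.
Next Obligation.
by apply: sbij_eq => z; apply: val_inj; rewrite /= binvK.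
Qed.
Next Obligation.
apply: sbij_eq => z; apply: val_inj => /=.
by congr (w (sval (sval g _))); apply: val_inj; rewrite /= bfunK.
Qed.

End Conjugation.

(** [(i, j, true)] stands for [eps_i - delta_j] and [(i, j, false)] for its
    negative; rows and columns are numbered from 0 throughout. *)
Definition isoroot (n m : nat) : Type := ('I_n * 'I_m * bool)%type.

Definition negr (n m : nat) (a : isoroot n m) : isoroot n m :=
  (a.1, ~~ a.2).

(** There is exactly one morphism from [a] to [b] when [b] is [a] or
    [negr a], and none otherwise. *)
Definition Thom (n m : nat) (a b : isoroot n m) : Prop :=
  (b == a) || (b == negr a).

Lemma negrK (n m : nat) : involutive (@negr n m).
Proof. by case=> a b; rewrite /negr /= negbK. Qed.

Lemma Thom_id (n m : nat) (a : isoroot n m) : Thom a a.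
Proof. by rewrite /Thom eqxx. Qed.

Lemma Thom_comp (n m : nat) (a b c : isoroot n m) :
  Thom b c -> Thom a b -> Thom a c.
Proof.
move=> /orP[] /eqP-> /orP[] /eqP->; rewrite /Thom ?negrK ?eqxx ?orbT //.
Qed.

Lemma Thom_inv (n m : nat) (a b : isoroot n m) : Thom a b -> Thom b a.
Proof. by move=> /orP[] /eqP->; rewrite /Thom ?negrK ?eqxx ?orbT. Qed.

Lemma Thom_invertible (n m : nat) (a b : isoroot n m) (f : Thom a b) :
  exists g : Thom b a,
    Thom_comp g f = Thom_id a /\ Thom_comp f g = Thom_id b.
Proof. by exists (Thom_inv f); split; apply: Prop_irrelevance. Qed.

Definition Tiso (n m : nat) : groupoid :=
  @Groupoid (isoroot n m) (@Thom n m) (@Thom_id n m) (@Thom_comp n m)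
    (fun _ _ _ _ _ _ _ => Prop_irrelevance _ _)
    (fun _ _ _ => Prop_irrelevance _ _)
    (fun _ _ _ => Prop_irrelevance _ _)
    (@Thom_invertible n m).

Lemma rho_subproof (n m : nat) (a : isoroot n m) : Thom a (negr a).
Proof. by rewrite /Thom eqxx orbT. Qed.

Definition rho (n m : nat) (a : Tiso n m) : ghom a (negr a : Tiso n m) :=
  rho_subproof a.

Section Affinization.
Context {K : closedFieldType} {n m : nat}.

(** Indices [i < n] are even and indices [n <= i] are odd. *)
Definition par (i : 'I_(n + m)) : bool := (n <= i)%N.

Definition evenmx (x : 'M[K]_(n + m)) : 'M[K]_(n + m) :=
  \matrix_(i, j) (x i j *+ (par i == par j)).

Definition oddmx (x : 'M[K]_(n + m)) : 'M[K]_(n + m) :=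
  \matrix_(i, j) (x i j *+ (par i != par j)).

Definition str (x : 'M[K]_(n + m)) : K :=
  \sum_i (if par i then - x i i else x i i).

(** The bilinear extension of [xy - (-1)^(|x||y|) yx]. *)
Definition sbracket (x y : 'M[K]_(n + m)) : 'M[K]_(n + m) :=
  x *m y - (evenmx y *m evenmx x + evenmx y *m oddmx x + oddmx y *m evenmx x
            - oddmx y *m oddmx x).

(** [(x, a, b)] stands for the sum of the [t^s (x) x s], of [a c] and of
    [b d].  This ambient space also contains infinite sums and matrices of
    nonzero supertrace; [Lhat] cuts out the affinization of [sl(n|m)]. *)
Definition Lamb : lmodType K := ((int -> 'M[K]_(n + m)) * K^o * K^o)%type.

Definition loop (x : Lamb) : int -> 'M[K]_(n + m) := x.1.1.
Definition ccoef (x : Lamb) : K := x.1.2.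
Definition dcoef (x : Lamb) : K := x.2.

Definition Lhat : set Lamb :=
  [set x | finite_set [set s | loop x s != 0] /\ forall s, str (loop x s) = 0].

(** The invariant form is [(x, y) = str (xy)]. *)
Definition bracket (x y : Lamb) : Lamb :=
  ((fun s : int =>
      \sum_(a \in [set: int]) sbracket (loop x a) (loop y (s - a))
      + (dcoef x * s%:~R) *: loop y s - (dcoef y * s%:~R) *: loop x s),
   \sum_(a \in [set: int]) (a%:~R * str (loop x a *m loop y (- a))),
   0).

Definition Lie_subalgebra (A : set Lamb) : Prop :=
  [/\ A `<=` Lhat, A 0,
      (forall (a : K) x y, A x -> A y -> A (a *: x + y)) &
      (forall x y, A x -> A y -> A (bracket x y))].

Definition fin_elt (y : 'M[K]_(n + m)) : Lamb :=
  ((fun s : int => if s == 0 then y else 0), 0, 0).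

Definition d_elt : Lamb := (0, 0, 1).

Definition gfin : set Lamb := [set x | exists2 y, str y = 0 & x = fin_elt y].

Definition cartan_aff : set Lamb :=
  [set x | Lhat x /\ forall s i j, loop x s i j != 0 -> s = 0 /\ i = j].

Definition cartan_fin : set Lamb := cartan_aff `&` gfin.

(** [(v, a)] stands for the sum of the [v_i e_i] plus [a] times the basic
    imaginary root, where [e_i] is [eps_i] for [i < n] and [e_(n + j)] is
    [delta_j]. *)
Definition rootlat : zmodType := ('rV[int]_(n + m) * int)%type.

Definition basis_root (i : nat) : rootlat :=
  (\row_(j < n + m) ((j == i :> nat)%:R : int), 0).

Definition eps (i : nat) : rootlat := basis_root i.
Definition dlt (j : nat) : rootlat := basis_root (n + j).
Definition imag : rootlat := (0, 1).

(** Weights are taken for all diagonal matrices of [gl(n|m)], so that they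
    are elements of the free lattice [rootlat].  On the lattice of the
    differences of the [e_i], restriction to supertraceless diagonal
    matrices loses information only for [n = m]. *)
Definition root_space (g : rootlat) : set Lamb :=
  [set x | [/\ Lhat x,
    (forall h : 'rV[K]_(n + m),
       bracket (fin_elt (diag_mx h)) x =
       (\sum_i (g.1 0 i)%:~R * h 0 i) *: x) &
    bracket d_elt x = (g.2)%:~R *: x]].

Definition is_root (g : rootlat) : Prop :=
  g != 0 /\ exists2 x, root_space g x & x != 0.

(** [H] is [cartan_fin] or [cartan_aff]. *)
Definition borel (H : set Lamb) (S : set rootlat) : set Lamb :=
  smallest Lie_subalgebra (H `|` \bigcup_(g in S) root_space g).

Definition lin_indep (s : seq rootlat) : Prop :=
  forall c : rootlat -> int,
    \sum_(b <- s) b *~ c b = 0 -> forall b, b \in s -> c b = 0.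

Definition has_simple_roots (H : set Lamb) (b : set Lamb) (s : seq rootlat) :
    Prop :=
  [/\ uniq s, lin_indep s, (forall g, g \in s -> is_root g) &
      b = borel H [set` s]].

(** Two distinct simple roots [b], [g] of which [b] is odd isotropic can
    have [g + b + b] as a root only for [n = m = 1], where [g + b] is the
    basic imaginary root: there the two nodes of the affine diagram are
    adjacent on both sides, and reflecting [g] yields [g + b + b]. *)
Definition reflect_root (b g : rootlat) : rootlat :=
  if g == b then - b
  else if `[< is_root (g + b + b) >] then g + b + b
  else if `[< is_root (g + b) >] then g + b
  else g.

Definition odd_reflection (H : set Lamb) (b : rootlat) (B B' : set Lamb) :
    Prop :=
  exists s, [/\ has_simple_roots H B s, b \in s &
                B' = borel H [set` map (reflect_root b) s]].

(** A partition is the sequence [lambda_1, .., lambda_n]. *)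
Definition is_partition (l : seq nat) : bool :=
  [&& size l == n, sorted geq l & all (leq^~ m) l].

Definition conjp (l : seq nat) (j : nat) : nat := count (leq j) l.

Definition r_full (l : seq nat) : bool := nth 0%N l 0 == m.
Definition r_empty (l : seq nat) : bool := nth 0%N l n.-1 == 0%N.
Definition c_full (l : seq nat) : bool := conjp l 1 == n.
Definition c_empty (l : seq nat) : bool := conjp l m == 0%N.

Definition minus_r (l : seq nat) : seq nat := rcons (behead l) 0%N.
Definition plus_r (l : seq nat) : seq nat := m :: take n.-1 l.
Definition minus_c (l : seq nat) : seq nat := map predn l.
Definition plus_c (l : seq nat) : seq nat := map succn l.

Definition in_diagram (l : seq nat) (i : 'I_n) (j : 'I_m) : bool :=
  (j < nth 0%N l (n.-1 - i))%N.

Definition adds_box (i : 'I_n) (j : 'I_m) (l l' : seq nat) : Prop :=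
  [/\ is_partition l, is_partition l', ~~ in_diagram l i j &
      forall i' j', in_diagram l' i' j' =
        in_diagram l i' j' || ((i' == i) && (j' == j))].

(** The graph of [t_a]. *)
Definition t_rel (a : isoroot n m) (l l' : seq nat) : Prop :=
  if a.2 then adds_box a.1.1 a.1.2 l l' else adds_box a.1.1 a.1.2 l' l.

(** [true] is a down step and [false] a right step. *)
Definition word (l : seq nat) : seq bool :=
  flatten (pairmap (fun a b => rcons (nseq (b - a) false) true) 0%N (rev l))
  ++ nseq (m - nth 0%N l 0) false.

Fixpoint shuffle_of (a b : nat) (w : seq bool) : seq nat :=
  match w with
  | [::] => [::]
  | true :: w' => a :: shuffle_of a.+1 b w'
  | false :: w' => n + b :: shuffle_of a b.+1 w'
  end.

(** Entry [i < n] stands for [eps_i] and entry [n + j] for [delta_j]. *)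
Definition shuffle (l : seq nat) : seq nat := shuffle_of 0 0 (word l).

Definition rk : nat := (n + m).-1.

Definition fin_simple (l : seq nat) : seq rootlat :=
  mkseq (fun p => basis_root (nth 0%N (shuffle l) p)
                  - basis_root (nth 0%N (shuffle l) p.+1)) rk.

Definition swaps (p : nat) (w w' : seq bool) : Prop :=
  [/\ nth false w p != nth false w p.+1,
      nth false w' p = nth false w p.+1,
      nth false w' p.+1 = nth false w p &
      forall q, q != p -> q != p.+1 -> nth false w' q = nth false w q].

Definition borel_fin (l : seq nat) : set Lamb :=
  borel cartan_fin [set` fin_simple l].

(** The Borel subalgebra given by a regular integral functional [f]. *)
Definition borel_functional (f : 'I_(n + m) -> int) : set Lamb :=
  borel cartan_fin
    [set g | [/\ is_root g, g.2 = 0 & 0 < \sum_i g.1 0 i * f i]].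

Definition even_elts : set Lamb :=
  [set x | forall s i j, loop x s i j != 0 -> par i = par j].

Definition upper_elts : set Lamb :=
  [set x | forall s i j, loop x s i j != 0 -> (i <= j)%N].

Definition Borels_fin : set (set Lamb) :=
  [set b | (exists2 f, injective f & b = borel_functional f) /\
           b `&` even_elts = gfin `&` even_elts `&` upper_elts].

Definition Borels_fin_at (g : rootlat) : set (set Lamb) :=
  [set b | Borels_fin b /\
           exists2 s, has_simple_roots cartan_fin b s & g \in s].

Inductive pair_equiv : set Lamb * int -> set Lamb * int -> Prop :=
| pe_row l k : is_partition l -> r_full l ->
    pair_equiv (borel_fin l, k) (borel_fin (minus_r l), k + m%:Z)
| pe_col l k : is_partition l -> c_full l ->
    pair_equiv (borel_fin l, k) (borel_fin (minus_c l), k + n%:Z)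
| pe_refl p : pair_equiv p p
| pe_sym p q : pair_equiv p q -> pair_equiv q p
| pe_trans p q s : pair_equiv p q -> pair_equiv q s -> pair_equiv p s.

Definition pair_class (b : set Lamb) (k : int) : set (set Lamb * int) :=
  [set q | pair_equiv (b, k) q].

Definition pair_classes : set (set (set Lamb * int)) :=
  [set C | exists b k, Borels_fin b /\ C = pair_class b k].

Definition cyc (p a : nat) (j : int) : nat :=
  absz (modz (a%:Z + j) p%:Z).

(** [twist i j a] is [eta^i nu^j a]: [nu] raises the index of [eps] and
    [eta] lowers that of [delta]. *)
Definition twist (i j : int) (a : isoroot n m) : rootlat :=
  let g := eps (cyc n a.1.1 j) - dlt (cyc m a.1.2 (- i)) in
  if a.2 then g else - g.

Definition BB_obj (a : isoroot n m) : set pair_classes :=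
  [set C | exists b i j, Borels_fin_at (twist i j a) b /\
             sval C (b, i * n%:Z + j * m%:Z)].

Definition is_BB (F : gfunctor (Tiso n m) (Sym pair_classes)) : Prop :=
  (forall a : isoroot n m, F a = BB_obj a) /\
  forall (a : isoroot n m) (C : (F a : set pair_classes)) b b' i j,
    Borels_fin_at (twist i j a) b ->
    sval (sval C) (b, i * n%:Z + j * m%:Z) ->
    odd_reflection cartan_fin (twist i j a) b b' ->
    sval (sval (sval (fhom F (rho (a : Tiso n m))) C)) =
      pair_class b' (i * n%:Z + j * m%:Z).

Definition ext_root (s : seq rootlat) : rootlat := imag - \sum_(b <- s) b.

(** [aff_simple l k s]: the Borel subalgebra of [(l, k)] has ordered simple
    roots [s].  The list [beta_1, .., beta_r] is numbered from 0, so that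
    [nth 0 s p] is exchanged together with the letters [p] and [p + 1]. *)
Inductive aff_simple : seq nat -> int -> seq rootlat -> Prop :=
| as_fin l : is_partition l -> aff_simple l 0 (fin_simple l)
| as_minus_r l k s : is_partition l -> r_full l -> aff_simple l k s ->
    aff_simple (minus_r l) (k + m%:Z) (belast (ext_root s) s)
| as_plus_c l k s : is_partition l -> c_empty l -> aff_simple l k s ->
    aff_simple (plus_c l) (k - n%:Z) (belast (ext_root s) s)
| as_plus_r l k s : is_partition l -> r_empty l -> aff_simple l k s ->
    aff_simple (plus_r l) (k - m%:Z) (rcons (behead s) (ext_root s))
| as_minus_c l k s : is_partition l -> c_full l -> aff_simple l k s ->
    aff_simple (minus_c l) (k + n%:Z) (rcons (behead s) (ext_root s))
| as_odd l l' k s a p : t_rel a l l' -> (p < rk)%N ->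
    swaps p (word l) (word l') -> aff_simple l k s ->
    aff_simple l' k (map (reflect_root (nth 0 s p)) s).

Definition extension (s : seq rootlat) : set Lamb :=
  borel cartan_aff [set` ext_root s :: s].

Definition Borels_aff : set (set Lamb) :=
  [set b | exists l k s, [/\ is_partition l, aff_simple l k s & b = extension s]].

(** The simple root [nth 0 s p] of [b] has local name [g]. *)
Definition local_name (b : set Lamb) (l : seq nat) (k : int) (s : seq rootlat)
    (p : nat) (g : rootlat) : Prop :=
  [/\ is_partition l, aff_simple l k s, b = extension s, (p < rk)%N &
      nth 0 (fin_simple l) p = g].

Definition B_obj (a : isoroot n m) : set Borels_aff :=
  [set b | exists l i j s p,
    local_name (sval b) l (i * n%:Z + j * m%:Z) s p (twist i j a)].

Definition is_B (F : gfunctor (Tiso n m) (Sym Borels_aff)) : Prop :=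
  (forall a : isoroot n m, F a = B_obj a) /\
  forall (a : isoroot n m) (b : (F a : set Borels_aff)) l i j s p,
    local_name (sval (sval b)) l (i * n%:Z + j * m%:Z) s p (twist i j a) ->
    odd_reflection cartan_aff (nth 0 s p) (sval (sval b))
      (sval (sval (sval (fhom F (rho (a : Tiso n m))) b))).

Definition matches (w : bijection Borels_aff pair_classes) : Prop :=
  forall (b : Borels_aff) l k s, is_partition l -> aff_simple l k s ->
    sval b = extension s -> sval (w b) = pair_class (borel_fin l) k.

End Affinization.

Arguments Lamb : clear implicits.
Arguments Borels_aff : clear implicits.
Arguments pair_classes : clear implicits.
Arguments rootlat : clear implicits.
Arguments is_partition : clear implicits.
Arguments aff_simple : clear implicits.

(* Main.v *)
(** Extend the letters periodically by [eps_(z + n) = eps_z - imag] and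
    [delta_(z + m) = delta_z - imag]. If the rows of the word of [lambda] are
    numbered from [a] and its columns from [b], the differences of consecutive
    letters are the simple roots of the Borel subalgebra of [(lambda, k)], where
    [k = b n - a m], and closing up the period adds the extending root. Deleting
    or adding a full row or column moves one letter across the period, so it
    rotates the extended list of simple roots, and an odd reflection swaps two
    adjacent letters. An extended Borel subalgebra determines its set of simple
    roots by a height argument, hence the bi-infinite sequence of letters up to
    rotation and multiples of [imag]: this is exactly the class of
    [(lambda, k)]. Finally, a simple root of the Borel subalgebra of
    [(lambda, i n + j m)] has local name [eta^i nu^j alpha] iff it is congruent
    to [alpha] modulo [imag], so that both actions perform the odd reflection at
    the unique such simple root, and swap the same two letters. *)

Require Import Defs.
From mathcomp Require Import all_boot all_order all_algebra.
From mathcomp Require Import boolp classical_sets functions cardinality fsbigop.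
From mathcomp Require Import zify ring.

Set Implicit Arguments.
Unset Strict Implicit.
Unset Printing Implicit Defensive.

Import Order.TTheory GRing.Theory Num.Theory.
Local Open Scope ring_scope.

(** * Words of partitions *)

(** [aff_simple] is generated by moves that reach a pair by many routes, so the rules do not show
    that a pair has exactly one list. The numbering [(a, b)] serves as an invariant of derivations,
    and coprimality enters twice: Bezout coefficients give every integer a numbering, and
    divisibility shows that two numberings of the same integer differ by a multiple of [(n, m)],
    which differences of letters do not see. In the same way an element of [Borels_aff] has many
    presentations by a word and integers [i], [j]; hence the reflection is set up as a relation on
    presentations and only afterwards shown to be single-valued. Upper bounds for Borel subalgebras
    come from one device, subspaces cut out by a condition on matrix positions and degrees that is
    closed under composition. Characteristic 0 serves to read integral weights off scalars of
    [K]. *)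

Section Words.

(** The first letter of the target is moved to the front past one neighbour at a time, behind a
    prefix [u] already in place. This is what connects all words at a fixed [k] by odd
    reflections. *)
Lemma perm_eq_adjacent_ind (T : eqType) (P : seq T -> Prop) :
  (forall u x y v, P (u ++ x :: y :: v) -> P (u ++ y :: x :: v)) ->
  forall s t, perm_eq s t -> P s -> P t.
Proof.
move=> Pswap; suff main u s t : perm_eq s t -> P (u ++ s) -> P (u ++ t).
  by move=> s t; apply: (main [::]).
elim: t u s => [|x t IH] u s; first by move/perm_nilP->.
move=> st; have : x \in s by rewrite (perm_mem st) mem_head.
move=> xs; case: (path.splitPr xs) st => s1 s2 {s xs} st.
have {}st : perm_eq (s1 ++ s2) t by move: st; rewrite perm_catC /= perm_cons perm_catC.
move=> Ps; rewrite -cat_rcons; apply: IH st _; rewrite cat_rcons.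
elim/last_ind: s1 s2 Ps => [//|s1 y IHs] s2.
rewrite !cat_rcons catA => /Pswap; rewrite -catA; apply: IHs.
Qed.

Lemma perm_swap_adjacent (T : eqType) u (x y : T) v :
  perm_eq (u ++ x :: y :: v) (u ++ y :: x :: v).
Proof. by rewrite perm_cat2l (perm_catCA [:: x] [:: y] v). Qed.

Fixpoint rows (c : nat) (w : seq bool) : seq nat :=
  match w with
  | [::] => [::]
  | true :: w' => c :: rows c w'
  | false :: w' => rows c.+1 w'
  end.

(** [rows 0 w] lists the row lengths of the diagram from the top row down,
    whereas a partition starts with its bottom row. *)
Definition parts (w : seq bool) : seq nat := rev (rows 0 w).

(** The offset [c] is there for induction; [word] is the case [c = 0]. *)
Definition steps (m c : nat) (u : seq nat) : seq bool :=
  flatten (pairmap (fun a b => rcons (nseq (b - a) false) true) c u)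
  ++ nseq (m - last c u) false.

Lemma size_rows c w : size (rows c w) = count id w.
Proof. by elim: w c => [|[] w IH] c //=; rewrite IH. Qed.

Lemma rows_cat c w1 w2 : rows c (w1 ++ w2) = rows c w1 ++ rows (c + count negb w1) w2.
Proof.
elim: w1 c => [|[] w1 IH] c /=; rewrite ?addn0 //.
  by rewrite add0n IH.
by rewrite IH addSnnS.
Qed.

Lemma rowsS c w : rows c.+1 w = map succn (rows c w).
Proof. by elim: w c => [|[] w IH] c //=; rewrite IH. Qed.

Lemma path_rows c w : path leq c (rows c w).
Proof.
elim: w c => [|[] w IH] c //=; first by rewrite leqnn IH.
by have := IH c.+1; case: (rows c.+1 w) => //= x s /andP[/ltnW -> ->].
Qed.

Lemma rows_nseq c k w : rows c (nseq k false ++ w) = rows (c + k) w.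
Proof. by elim: k c => [|k IH] c /=; rewrite ?addn0 // IH addSnnS. Qed.

Lemma steps_cons m c x u :
  steps m c (x :: u) = nseq (x - c) false ++ true :: steps m x u.
Proof. by rewrite /steps /= -catA cat_rcons. Qed.

Lemma mem_rows_bound c w x : x \in rows c w -> (c <= x <= c + count negb w)%N.
Proof.
elim: w c => [|[] w IH] c //=.
  by rewrite inE add0n => /predU1P[->|/IH//]; rewrite leqnn leq_addr.
by move/IH; lia.
Qed.

Lemma rows_steps m c u : path leq c u -> rows c (steps m c u) = u.
Proof.
elim: u c => [|x u IH] c; first by rewrite -[steps _ _ _]cats0 rows_nseq.
by move=> /andP[cx /IH e]; rewrite steps_cons rows_nseq subnKC //= e.
Qed.

Lemma steps_rows c w : steps (c + count negb w) c (rows c w) = w.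
Proof.
elim: w c => [|[] w IH] c /=; first by rewrite addn0 /steps /= subnn.
  by rewrite steps_cons subnn /= IH.
rewrite -[in RHS](IH c.+1) add1n addSnnS; have := path_rows c.+1 w.
case: (rows c.+1 w) => [_|x s /= /andP[cx _]].
  by rewrite /steps /= addKn addnS subSS addKn.
by rewrite !steps_cons -(subnSK cx).
Qed.

Lemma count_steps m c u : path leq c u -> (last c u <= m)%N ->
  count id (steps m c u) = size u /\ (c + count negb (steps m c u))%N = m.
Proof.
elim: u c => [|x u IH] c.
  by rewrite /steps /= !count_nseq mul0n mul1n => _ /subnKC.
move=> /andP[cx xu]; rewrite [last _ _]/= => um; have [e1 e2] := IH _ xu um.
by rewrite steps_cons !count_cat !count_nseq /= e1; lia.
Qed.

Section Partitions.
Variables n m : nat.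

Definition is_word (w : seq bool) : bool :=
  (count id w == n) && (count negb w == m).

Lemma size_word w : is_word w -> size w = (n + m)%N.
Proof. by case/andP=> /eqP <- /eqP <-; rewrite count_predC. Qed.

Lemma is_word_perm w w' : perm_eq w w' -> is_word w = is_word w'.
Proof. by move=> /permP p; rewrite /is_word !p. Qed.

Lemma sorted_geq_rev (l : seq nat) : sorted geq l = path leq 0%N (rev l).
Proof. by rewrite -[l in LHS]revK rev_sorted; case: (rev l). Qed.

Lemma is_partition_parts w : is_word w -> is_partition n m (parts w).
Proof.
case/andP=> /eqP wn /eqP wm; rewrite /is_partition /parts size_rev size_rows wn eqxx.
rewrite sorted_geq_rev revK path_rows all_rev /=.
by apply/allP => x /mem_rows_bound /andP[_]; rewrite wm.
Qed.

Lemma last_nth0 (l : seq nat) : last 0%N (rev l) = nth 0%N l 0.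
Proof. by case: l => // x l; rewrite rev_cons last_rcons. Qed.

Lemma word_steps l : @word m l = steps m 0 (rev l).
Proof. by rewrite /word /steps last_nth0. Qed.

Lemma word_parts w : is_word w -> @word m (parts w) = w.
Proof.
by case/andP=> _ /eqP wm; rewrite word_steps revK -[m]add0n -wm steps_rows.
Qed.

Lemma partition_word l : is_partition n m l ->
  is_word (@word m l) /\ parts (@word m l) = l.
Proof.
case/and3P=> /eqP ln; rewrite sorted_geq_rev => lp lm.
rewrite /parts word_steps rows_steps // revK; split=> //.
have [|e wm] := @count_steps m _ _ lp.
  by rewrite last_nth0; case: l lm {ln lp} => //= x l /andP[].
by move: wm e; rewrite /is_word size_rev ln add0n => -> ->; rewrite !eqxx.
Qed.

Lemma partsP l : is_partition n m l -> exists2 w, is_word w & l = parts w.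
Proof. by move=> /partition_word[ww <-]; exists (@word m l). Qed.

(** A full bottom row is a final down step; deleting it makes room for an empty top row, which is an
    initial down step. All four operations on rows and columns are such rotations of the word by one
    letter. *)
Lemma minus_r_parts w : minus_r (parts (rcons w true)) = parts (true :: w).
Proof.
by rewrite /parts /= -cats1 rows_cat /= cats1 rev_rcons /minus_r /= rev_cons.
Qed.

Lemma r_full_parts w : is_word (rcons w true) -> @r_full m (parts (rcons w true)).
Proof.
case/andP=> _; rewrite /r_full -last_nth0 revK -cats1 rows_cat count_cat /= !addn0.
by rewrite last_cat.
Qed.

Lemma plus_c_parts w : plus_c (parts (rcons w false)) = parts (false :: w).
Proof. by rewrite /parts /plus_c -cats1 rows_cat /= cats0 rowsS map_rev. Qed.

Lemma plus_r_parts w : is_word (true :: w) -> @plus_r n m (parts (true :: w)) = parts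
  (rcons w true).
Proof.
case/andP=> /eqP /= wn /eqP wm; rewrite /parts /plus_r -cats1 rows_cat /= cats1.
rewrite rev_rcons rev_cons -wm !add0n; congr cons; rewrite -cats1 take_cat size_rev.
by rewrite size_rows -wn add1n /= ltnn subnn take0 cats0.
Qed.

Lemma r_empty_parts w : is_word (true :: w) -> @r_empty n (parts (true :: w)).
Proof.
case/andP=> /eqP wn _; rewrite /r_empty /parts nth_rev size_rows wn.
  by rewrite prednK ?subnn // -wn.
by rewrite ltn_predL -wn.
Qed.

Lemma minus_c_parts w : minus_c (parts (false :: w)) = parts (rcons w false).
Proof.
rewrite /parts /minus_c -cats1 rows_cat /= cats0 rowsS map_rev -map_comp.
by rewrite map_id_in.
Qed.

Lemma c_full_parts w : is_word (false :: w) -> @c_full n (parts (false :: w)).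
Proof.
case/andP=> /eqP /= wn _; rewrite /c_full /conjp /parts count_rev /= rowsS count_map.
by rewrite (@eq_count _ _ predT) // count_predT size_rows -wn.
Qed.

Lemma c_empty_parts w : is_word (rcons w false) -> @c_empty m (parts (rcons w false)).
Proof.
case/andP => _; rewrite -cats1 count_cat /= addn1 => /eqP wm.
rewrite /c_empty /conjp -leqn0 leqNgt -has_count /parts has_rev rows_cat cats0.
by apply/hasP => -[x /mem_rows_bound]; lia.
Qed.

Lemma r_fullP l : (0 < n)%N -> is_partition n m l -> @r_full m l ->
  exists2 w, is_word (rcons w true) & l = parts (rcons w true).
Proof.
move=> n0 /partsP[w ww ->] /eqP rf; have : m \in parts w.
  rewrite -{1}rf mem_nth // size_rev size_rows.
  by case/andP: ww => /eqP->.
case/lastP: w ww {rf} => [|w []] ww //; first by exists w.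
(* A final right step would leave the last column empty, against the row of length [m]. *)
by move=> mw; have := c_empty_parts ww; rewrite /c_empty /conjp -leqn0 leqNgt -has_count
  => /hasP[]; exists m.
Qed.

Lemma r_emptyP l : (0 < n)%N -> is_partition n m l -> @r_empty n l ->
  exists2 w, is_word (true :: w) & l = parts (true :: w).
Proof.
move=> n0 /partsP[w ww ->] /eqP re; have : 0%N \in parts w.
  rewrite -{1}re mem_nth // size_rev size_rows.
  by case/andP: ww => /eqP->; rewrite ltn_predL.
case: w ww {re} => [|[] w] ww //; first by exists w.
by rewrite /parts mem_rev => /= /mem_rows_bound.
Qed.

Lemma c_fullP l : (0 < m)%N -> is_partition n m l -> @c_full n l ->
  exists2 w, is_word (false :: w) & l = parts (false :: w).
Proof.
move=> m0 /partsP[[|[] w] ww ->]; first by case/andP: ww => _ /eqP /= m00;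
  rewrite -m00 in m0.
  case/andP: ww => /eqP <- _; rewrite /c_full /conjp -(size_rows 0) -size_rev
    -all_count.
  by rewrite /parts /= rev_cons all_rcons.
by exists w.
Qed.

Lemma c_emptyP l : (0 < n)%N -> is_partition n m l -> @c_empty m l ->
  exists2 w, is_word (rcons w false) & l = parts (rcons w false).
Proof.
move=> n0 /partsP[w ww ->]; case/lastP: w ww => [|w []] ww.
- by move: ww; rewrite /is_word /= => /andP[/eqP n00]; rewrite -n00 in n0.
- rewrite /c_empty /conjp -leqn0 leqNgt -has_count; case/negP; apply/hasP; exists m =>
  //.
  rewrite -{1}(eqP (r_full_parts ww)); apply: mem_nth.
  by rewrite size_rev size_rows; case/andP: ww => /eqP->.
by exists w.
Qed.

(** The two borders enclose a single unit square, whose row and column are the numbers of down and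
    right steps made before it. *)
Lemma adds_box_parts u v (i : 'I_n) (j : 'I_m) :
  is_word (u ++ true :: false :: v) ->
  i = count id u :> nat -> j = count negb u :> nat ->
  adds_box i j (parts (u ++ true :: false :: v)) (parts (u ++ false :: true :: v)).
Proof.
move=> ww iu ju.
have ww' : is_word (u ++ false :: true :: v).
  by rewrite -(is_word_perm (perm_swap_adjacent u true false v)).
have inE w (i' : 'I_n) (j' : 'I_m) : is_word w ->
    in_diagram (parts w) i' j' = (j' < nth 0 (rows 0 w) i')%N.
  case/andP=> /eqP wn _; rewrite /in_diagram /parts nth_rev size_rows wn.
    by congr (_ < nth _ _ _)%N; have := ltn_ord i'; lia.
  by have := ltn_ord i'; lia.
split; try exact: is_partition_parts.
  rewrite inE // rows_cat nth_cat size_rows iu ltnn subnn /= ju; lia.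
move=> i' j'; rewrite !inE // !rows_cat !nth_cat size_rows /= !add0n.
rewrite -!val_eqE /= iu ju.
case: (ltngtP i' (count id u)) => //= iu'; rewrite ?orbF //; last first.
  by rewrite iu' subnn /=; lia.
by rewrite -(subnSK iu') /=.
Qed.

End Partitions.
End Words.

(** * Graded subalgebras and root spaces *)

Section Loop.
Context {K : closedFieldType} {n m : nat}.
Local Notation N := (n + m)%N.
Implicit Types (x y : Lamb K n m) (A B : 'M[K]_N).
Local Open Scope classical_set_scope.

Lemma sum_neq0 (V : zmodType) (I : Type) (r : seq I) (F : I -> V) :
  \sum_(i <- r) F i != 0 -> exists i, F i != 0.
Proof.
move=> nz; apply: contrapT => noF; move/eqP: nz; apply; apply: big1 => i _.
by apply: contrapT => /eqP Fi; apply: noF; exists i.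
Qed.

(** The entry [(i, k)] is odd exactly when the parities of [i] and [k] differ, so the four products
    of even and odd parts merge into one sign. *)
Lemma sbracketE A B i j :
  sbracket A B i j = \sum_k (A i k * B k j
    - (-1) ^+ ((par i != par k) && (par k != par j)) * (B i k * A k j)).
Proof.
rewrite /sbracket !mxE -!sumrN -!big_split /= -!sumrN -!big_split /=.
apply: eq_bigr => k _; rewrite !mxE.
by case: eqP => _; case: eqP => _ /=;
  rewrite ?mulr1n ?mulr0n ?mulr0 ?mul0r ?expr0 ?expr1; ring.
Qed.

Lemma sbracket_support A B i j : sbracket A B i j != 0 ->
  exists k, (A i k != 0 /\ B k j != 0) \/ (B i k != 0 /\ A k j != 0).
Proof.
rewrite sbracketE => /sum_neq0[k]; have [->|Aik] := eqVneq (A i k) 0.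
  rewrite mul0r add0r oppr_eq0 mulf_eq0 mulf_eq0 !negb_or => /and3P[_ ? ?].
  by exists k; right.
have [->|Bkj] := eqVneq (B k j) 0; last by exists k; left.
rewrite mulr0 add0r oppr_eq0 mulf_eq0 mulf_eq0 !negb_or => /and3P[_ ? ?].
by exists k; right.
Qed.

Lemma str_is_linear (a : K) A B : str (a *: A + B) = a * str A + str B.
Proof.
rewrite /str mulr_sumr -big_split /=; apply: eq_bigr => i _.
by rewrite !mxE; case: par; rewrite // mulrN opprD.
Qed.

Lemma str0 : str (0 : 'M[K]_N) = 0.
Proof. by rewrite /str big1 // => i _; rewrite mxE oppr0 if_same. Qed.

Lemma strZ (a : K) A : str (a *: A) = a * str A.
Proof. by rewrite -[a *: A]addr0 str_is_linear str0 addr0. Qed.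

Lemma strD A B : str (A + B) = str A + str B.
Proof. by rewrite -[A]scale1r str_is_linear scale1r mul1r. Qed.

Lemma strN A : str (- A) = - str A.
Proof. by rewrite -scaleN1r strZ mulN1r. Qed.

Lemma str_sum (I : Type) (r : seq I) (F : I -> 'M[K]_N) :
  str (\sum_(i <- r) F i) = \sum_(i <- r) str (F i).
Proof. by apply: (big_morph str strD str0). Qed.

Lemma str_sbracket A B : str (sbracket A B) = 0.
Proof.
(* The sign of the supertrace at [i] times the sign of the superbracket is the sign at [k], so the
   two double sums cancel after exchanging the indices. *)
pose sg (i : 'I_N) : K := (-1) ^+ par i.
have -> : str (sbracket A B) =
    \sum_i \sum_k (sg i * (A i k * B k i) - sg k * (B i k * A k i)).
  apply: eq_bigr => i _; rewrite -[LHS]/(if par i then _ else _) sbracketE /sg.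
  case pi: (par i); rewrite ?expr1 ?expr0; last first.
    apply: eq_bigr => k _.
    by case: (par k); rewrite ?expr1 ?expr0; ring.
  rewrite -sumrN; apply: eq_bigr => k _.
  by case: (par k); rewrite ?expr1 ?expr0; ring.
under eq_bigr => i _ do rewrite sumrB.
rewrite sumrB exchange_big /=; apply/eqP; rewrite subr_eq0; apply/eqP.
by apply: eq_bigr => i _; apply: eq_bigr => k _; rewrite (mulrC (A k i)).
Qed.

Lemma loopP (a : K) x y s : loop (a *: x + y) s = a *: loop x s + loop y s.
Proof. by case: x y => [[x ? ?] [[y ? ?]]]. Qed.

Lemma loop0 s : loop (0 : Lamb K n m) s = 0.
Proof. by []. Qed.

Lemma loop_bracket x y s : loop (bracket x y) s =
  \sum_(a \in [set: int]) sbracket (loop x a) (loop y (s - a))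
  + (dcoef x * s%:~R) *: loop y s - (dcoef y * s%:~R) *: loop x s.
Proof. by []. Qed.

Lemma bracket_support x y s i j : loop (bracket x y) s i j != 0 ->
  [\/ exists a k, loop x a i k != 0 /\ loop y (s - a) k j != 0,
      exists a k, loop y (s - a) i k != 0 /\ loop x a k j != 0,
      loop x s i j != 0 | loop y s i j != 0].
Proof.
have [xs|xs] := eqVneq (loop x s i j) 0; last by move=> _; apply: Or43.
have [ys|ys] := eqVneq (loop y s i j) 0; last by move=> _; apply: Or44.
rewrite loop_bracket !mxE xs ys !mulr0 subr0 addr0 summxE.
move=> /sum_neq0[a /sbracket_support[k [?|?]]].
  by apply: Or41; exists a, k.
by apply: Or42; exists a, k.
Qed.

Lemma Lhat_subalgebra : Lie_subalgebra (@Lhat K n m).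
Proof.
split=> // [|a x y [fx sx] [fy sy]|x y [fx sx] [fy sy]].
- split=> [|s]; last by rewrite loop0 str0.
  by apply: (@sub_finite_set _ _ set0) => // s /=; rewrite loop0 eqxx.
- split=> [|s]; last by rewrite loopP str_is_linear sx sy mulr0 addr0.
  apply: (@sub_finite_set _ _ ([set s | loop x s != 0] `|` [set s | loop y s != 0])).
    move=> s /=; rewrite loopP; have [->|] := eqVneq (loop x s) 0.
      by rewrite scaler0 add0r; right.
    by left.
  by rewrite finite_setU.
- split=> [|s]; last first.
    by rewrite /loop /bracket /= strD strN strD !strZ sx sy !mulr0 addr0
      subr0 str_sum big1 // => a _; rewrite str_sbracket.
  (* The products live in sums of degrees of [x] and [y]; the [d] terms only produce degrees of [x]
     or of [y]. *)
  apply: (@sub_finite_set _ _ ([set s | loop x s != 0] `|`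
     [set s | loop y s != 0] `|` ((fun p => p.1 + p.2) @`
       ([set s | loop x s != 0] `*` [set s | loop y s != 0])))); last first.
    rewrite !finite_setU; split=> //; apply: finite_image.
    by apply: finite_setX.
  have nz (M : 'M[K]_N) i j : M i j != 0 -> M != 0.
    by apply: contraNneq => ->; rewrite mxE.
  move=> s /= bs; have [i [j]] : exists i j, loop (bracket x y) s i j != 0.
    apply: contrapT => no; move/eqP: bs; apply; apply/matrixP => i j.
    by rewrite [RHS]mxE; apply: contrapT => /eqP ij; apply: no; exists i, j.
  case/bracket_support => [[a [k [xa ya]]]|[a [k [ya xa]]]|/nz|/nz].
  + by right; exists (a, s - a); rewrite ?subrKC //=; split=> /=; apply: nz;
    eassumption.
  + by right; exists (a, s - a); rewrite ?subrKC //=; split=> /=; apply: nz;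
    eassumption.
  + by left; left.
  + by left; right.
Qed.

(** The condition concerns the loop part only; the coefficients of [c] and [d] are left free. A
    Borel subalgebra is bounded from above by finding a [P] that holds at [(i, i, 0)] and at the
    generating roots and composes like matrix units. *)
Definition graded (P : 'I_N -> 'I_N -> int -> Prop) : set (Lamb K n m) :=
  [set x | Lhat x /\ forall s i j, loop x s i j != 0 -> P i j s].

Lemma graded_subalgebra (P : 'I_N -> 'I_N -> int -> Prop) :
  (forall i k j a b, P i k a -> P k j b -> P i j (a + b)) ->
  Lie_subalgebra (graded P).
Proof.
case: Lhat_subalgebra => _ L0 Ll Lb Padd; split=> [x []//||a x y [Lx Px] [Ly Py]|].
- by split=> // s i j; rewrite loop0 mxE eqxx.
- split=> [|s i j]; first exact: Ll.
  rewrite loopP !mxE; have [->|xs] := eqVneq (loop x s i j) 0; last by move=> _;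
    apply: Px.
  by rewrite mulr0 add0r => /Py.
- move=> x y [Lx Px] [Ly Py]; split=> [|s i j]; first exact: Lb.
  case/bracket_support => [[a [k [xa ya]]]|[a [k [ya xa]]]|/Px|/Py] //.
    by rewrite -(subrKC a s); apply: Padd (Px _ _ _ xa) (Py _ _ _ ya).
  by rewrite -(subrK a s); apply: Padd (Py _ _ _ ya) (Px _ _ _ xa).
Qed.

Lemma fsum_at0 (V : zmodType) (F : int -> V) :
  (forall a, a != 0 -> F a = 0) -> \sum_(a \in [set: int]) F a = F 0.
Proof.
move=> F0; rewrite -(fsbig_widen [set 0] setT) ?fsbig_set1 //.
by move=> a [_ /= a0]; apply: F0; apply/eqP.
Qed.

Lemma sbracket0l A : sbracket 0 A = 0.
Proof.
by apply/matrixP=> i j; rewrite sbracketE mxE big1 // => k _;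
  rewrite !mxE mul0r !mulr0 subrr.
Qed.

Lemma sbracket0r A : sbracket A 0 = 0.
Proof.
by apply/matrixP=> i j; rewrite sbracketE mxE big1 // => k _;
  rewrite !mxE mul0r !mulr0 subrr.
Qed.

Lemma loop_fin A s : loop (fin_elt A) s = if s == 0 then A else 0.
Proof. by []. Qed.

Lemma bracket_fin_loop A x s :
  loop (bracket (fin_elt A) x) s = sbracket A (loop x s) - (dcoef x * s%:~R) *: (if s
    == 0 then A else 0).
Proof.
rewrite loop_bracket fsum_at0 ?subr0 => [|a /negPf a0]; last first.
  by rewrite loop_fin a0 sbracket0l.
by rewrite mul0r scale0r addr0.
Qed.

Lemma bracket_fin A B : bracket (fin_elt A) (fin_elt B) = fin_elt (sbracket A B).
Proof.
congr (_, _, _); last first.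
  by rewrite fsum_at0 ?mul0r // => a /negPf a0; rewrite loop_fin a0 mul0mx str0 mulr0.
apply: funext => s; rewrite -[LHS]/(loop (bracket (fin_elt A) (fin_elt B)) s).
rewrite bracket_fin_loop loop_fin /dcoef /= mul0r scale0r subr0.
case: eqP => // _; apply/matrixP=> i j; rewrite sbracketE mxE big1 // => k _.
by rewrite !mxE mul0r !mulr0 subrr.
Qed.

Lemma fin_eltP (a : K) A B : fin_elt (a *: A + B) = a *: fin_elt A + fin_elt B.
Proof.
congr (_, _, _); rewrite /= ?scaler0 ?addr0 //.
apply: funext => s; rewrite -[RHS]/(a *: (if s == 0 then A else 0) + (if s == 0 then B
  else 0)).
by case: eqP => // _; rewrite scaler0 addr0.
Qed.

Lemma fin_elt0 : fin_elt (0 : 'M[K]_N) = 0.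
Proof. by congr (_, _, _); apply: funext => s; rewrite if_same. Qed.

Lemma Lhat_fin A : Lhat (fin_elt A) <-> str A = 0.
Proof.
split=> [[_ /(_ 0)]|A0]; first by rewrite loop_fin eqxx.
split=> [|s]; last by rewrite loop_fin; case: eqP => // _; rewrite str0.
apply: (@sub_finite_set _ _ [set 0]) => // s.
by apply: contra_neqP => /eqP /negPf s0; rewrite loop_fin s0.
Qed.

Lemma gfin_subalgebra : Lie_subalgebra (@gfin K n m).
Proof.
split=> [x [A A0 ->]||a x y [A A0 ->] [B B0 ->]|x y [A A0 ->] [B B0 ->]].
- exact/Lhat_fin.
- by exists 0; rewrite ?str0 ?fin_elt0.
- by exists (a *: A + B); rewrite ?fin_eltP // str_is_linear A0 B0 mulr0 addr0.
- by exists (sbracket A B); rewrite ?bracket_fin ?str_sbracket.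
Qed.

Lemma Lie_subalgebraI (U V : set (Lamb K n m)) :
  Lie_subalgebra U -> Lie_subalgebra V -> Lie_subalgebra (U `&` V).
Proof.
move=> [U1 U2 U3 U4] [V1 V2 V3 V4]; split=> //.
- by move=> x [] /U1.
- by move=> a x y [? ?] [? ?]; split; [apply: U3|apply: V3].
- by move=> x y [? ?] [? ?]; split; [apply: U4|apply: V4].
Qed.

Lemma borel_sub (H : set (Lamb K n m)) S (U : set (Lamb K n m)) :
  Lie_subalgebra U -> H `<=` U -> (forall g, S g -> root_space g `<=` U) ->
  borel H S `<=` U.
Proof.
move=> LU HU SU; apply: smallest_sub => // x [/HU//|[g Sg]]; exact: SU.
Qed.

Lemma root_space_borel (H : set (Lamb K n m)) S g : S g -> root_space g `<=` borel H S.
Proof. by move=> Sg x gx; apply: sub_gen_smallest; right; exists g. Qed.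

(** The root of [E_ij] times the [t]-th power of the loop variable. *)
Definition rt (i j : 'I_N) (t : int) : rootlat n m :=
  (delta_mx 0 i - delta_mx 0 j, t).

Lemma rt1E i j t k : (rt i j t).1 0 k = (k == i)%:R - (k == j)%:R.
Proof. by rewrite !mxE eqxx. Qed.

Hypothesis charK : [pchar K] =i pred0.

(** If a positive integer vanishes in [K], so does its least prime divisor, which would be the
    characteristic, or the smaller cofactor, to which induction applies. *)
Lemma intr_inj_char0 : injective (intr : int -> K).
Proof.
have nz k : (k.+1)%:R != 0 :> K.
  apply/negP => k0; have : pdiv (k.+1) \in [pchar K] -> False by rewrite charK.
  elim/ltn_ind: k k0 => k IH k0 noc.
  have p0 : ((pdiv k.+1)%:R == 0 :> K) || ((k.+1 %/ pdiv k.+1)%:R == 0 :> K).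
    by rewrite -mulf_eq0 -natrM mulnC divnK ?pdiv_dvd.
  case: (posnP k) => [k00|k_gt0].
    by move: k0; rewrite k00 mulr1n oner_eq0.
  have pp : prime (pdiv k.+1) by rewrite pdiv_prime.
  case/orP: p0 => p0; first by apply: noc; rewrite inE pp.
  have : (0 < k.+1 %/ pdiv k.+1)%N by rewrite divn_gt0 ?pdiv_gt0 // pdiv_leq.
  case d : (k.+1 %/ pdiv k.+1)%N p0 => [//|k'] p0 _; apply: (IH k') => //.
    by rewrite -ltnS -d ltn_Pdiv // prime_gt1.
  by rewrite charK.
move=> a b /eqP; rewrite -subr_eq0 -rmorphB /= => ab0; apply/eqP; rewrite -subr_eq0.
case: (a - b) ab0 => [[|k]|k] //=; first by rewrite (negPf (nz k)).
by rewrite NegzE mulrNz oppr_eq0 (negPf (nz k)).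
Qed.

Lemma sbracket_diag (h : 'rV[K]_N) A i j :
  sbracket (diag_mx h) A i j = (h 0 i - h 0 j) * A i j.
Proof.
rewrite sbracketE big_split /= sumrN mulrBl; congr (_ - _).
  rewrite (bigD1 i) //= big1 ?addr0 => [|k /negPf ki]; last first.
    by rewrite mxE eq_sym ki mulr0n mul0r.
  by rewrite mxE eqxx mulr1n.
rewrite (bigD1 j) //= big1 ?addr0 => [|k /negPf ki]; last first.
  by rewrite [diag_mx _ _ _]mxE ki mulr0n !mulr0.
by rewrite !mxE !eqxx andbF mulr1n mul1r mulrC.
Qed.

Lemma bracket_diag_loop h x s i j :
  loop (bracket (fin_elt (diag_mx h)) x) s i j = (h 0 i - h 0 j) * loop x s i j.
Proof.
rewrite bracket_fin_loop -sbracket_diag; case: (s =P 0) => [->|_].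
  by rewrite mulr0 scale0r subr0.
by rewrite scaler0 subr0.
Qed.

(** Diagonal matrices and [d] multiply the entry [(i, j)] in degree [s] by known scalars. One
    nonzero entry thus fixes all integers in [g], since integers embed in [K]. *)
Lemma weight_unique x g s i j : root_space g x -> loop x s i j != 0 -> g = rt i j s.
Proof.
case: g => v a [_ hx dx] nz.
have ha (h : 'rV[K]_N) : h 0 i - h 0 j = \sum_k (v 0 k)%:~R * h 0 k.
  have := congr1 (fun y => loop y s i j) (hx h).
  rewrite bracket_diag_loop -[(_ *: x)]addr0 loopP loop0 addr0 mxE; exact: mulIf.
have -> : a = s.
  have := congr1 (fun y => loop y s i j) dx.
  rewrite -[(_ *: x)]addr0 loopP loop0 addr0 /bracket /loop /=.
  rewrite fsum_at0 => [|b _]; last by rewrite sbracket0l.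
  rewrite sbracket0l add0r scaler0 subr0 !mxE mul1r => /(mulIf nz).
  by move/intr_inj_char0.
congr (_, _); apply/rowP => k; have := ha (delta_mx 0 k).
rewrite (bigD1 k) //= big1 => [|l /negPf lk]; last by rewrite mxE lk andbF mulr0.
rewrite addr0 !mxE !eqxx /= mulr1 (eq_sym i) (eq_sym j) => e.
by apply: intr_inj_char0; rewrite -e rmorphB /= !rmorph_nat.
Qed.

Definition tE (i j : 'I_N) (t : int) : Lamb K n m :=
  ((fun s : int => if s == t then delta_mx i j else 0), 0, 0).

Lemma tE_loop i j t : loop (tE i j t) t i j != 0.
Proof. by rewrite /loop /= eqxx mxE !eqxx oner_eq0. Qed.

Lemma tE_Lhat i j t : i != j -> Lhat (tE i j t).
Proof.
move=> /negPf ij; split=> [|s].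
  apply: (@sub_finite_set _ _ [set t]) => // s; rewrite /loop /=.
  by case: (s =P t) => //; rewrite eqxx.
rewrite /loop /=; case: eqP => _; last exact: str0.
rewrite /str big1 // => k _; rewrite mxE.
by case: (eqVneq k i) => [->|]; rewrite /= ?ij oppr0 if_same.
Qed.

Lemma tE_root_space i j t : i != j -> root_space (rt i j t) (tE i j t).
Proof.
move=> ij; split; first exact: tE_Lhat.
  move=> h; rewrite (_ : \sum_k _ = h 0 i - h 0 j); last first.
    under eq_bigr => k _ do rewrite rt1E rmorphB /= mulrBl.
    rewrite sumrB; congr (_ - _).
      rewrite (bigD1 i) //= big1 ?addr0 => [|k /negPf ki]; last by rewrite ki mul0r.
      by rewrite eqxx mul1r.
    rewrite (bigD1 j) //= big1 ?addr0 => [|k /negPf ki]; last by rewrite ki mul0r.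
    by rewrite eqxx mul1r.
  congr (_, _, _); rewrite /= ?scaler0 //; last first.
    rewrite fsum_at0 ?mul0r ?scaler0 // => a /negPf a0; rewrite loop_fin a0 mul0mx.
    by rewrite str0 mulr0.
  apply: funext => s; rewrite -[LHS]/(loop (bracket (fin_elt (diag_mx h)) (tE i j t))
    s).
  rewrite -[RHS]/((h 0 i - h 0 j) *: loop (tE i j t) s); apply/matrixP => k l.
  rewrite bracket_diag_loop /loop /= [RHS]mxE; case: (s == t); rewrite mxE ?mulr0 //.
  by case: eqP => [->|]; case: eqP => [->|]; rewrite ?mulr0.
congr (_, _, _); rewrite /= ?scaler0 //; last first.
  by rewrite fsbig1 // => a _; rewrite /loop /= mul0mx str0 mulr0.
apply: funext => s; rewrite fsbig1 => [|a _]; last by rewrite sbracket0l.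
rewrite add0r /dcoef /= mul0r scale0r subr0 mul1r.
rewrite -[RHS]/(t%:~R *: loop (tE i j t) s) /loop /=.
by case: eqP => [->|] //; rewrite !scaler0.
Qed.

Lemma rt_neq0 i j t : i != j -> rt i j t != 0.
Proof.
move=> /negPf ij; apply/eqP => /(congr1 (fun g : rootlat n m => g.1 0 i)).
by rewrite rt1E eqxx ij mxE.
Qed.

Lemma is_root_rt i j t : i != j -> is_root (K := K) (rt i j t).
Proof.
move=> ij; split; first exact: rt_neq0.
exists (tE i j t); first exact: tE_root_space.
by apply/eqP => E; have := tE_loop i j t; rewrite E loop0 mxE eqxx.
Qed.

(** An element without loop part is a combination of [c] and [d]; it is killed by diagonal matrices
    and by [d], hence has weight 0. *)
Lemma root_space_loop g x : root_space g x -> g != 0 -> x != 0 ->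
  exists s i j, loop x s i j != 0.
Proof.
case: g => v a [_ hx dx] g0 x0; apply: contrapT => no.
have lx s : loop x s = 0.
  apply/matrixP => i j; rewrite mxE; apply: contrapT => /eqP nz; apply: no.
  by exists s, i, j.
have brh h : bracket (fin_elt h) x = 0.
  congr (_, _, _); last first.
    by rewrite fsbig1 // => b _; rewrite lx mulmx0 str0 mulr0.
  apply: funext => s; rewrite -[LHS]/(loop (bracket (fin_elt h) x) s).
  rewrite bracket_fin_loop lx sbracket0r sub0r; case: eqP => [->|_].
    by rewrite mulr0 scale0r oppr0.
  by rewrite scaler0 oppr0.
have brd : bracket (d_elt : Lamb K n m) x = 0.
  congr (_, _, _); last first.
    by rewrite fsbig1 // => b _; rewrite lx mulmx0 str0 mulr0.
  apply: funext => s; rewrite fsbig1 => [|b _]; last by rewrite sbracket0l.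
  by rewrite lx !scaler0 add0r subr0.
have scale0 (c : int) : 0 = c%:~R *: x -> c = 0.
  move/esym/eqP; rewrite scaler_eq0 (negPf x0) orbF => /eqP c0.
  exact: intr_inj_char0.
case/eqP: g0; congr (_, _); last by apply: scale0; rewrite -dx brd.
apply/rowP => k; rewrite mxE; apply: scale0; have := hx (delta_mx 0 k).
rewrite brh (bigD1 k) //= big1 => [|l /negPf lk]; last by rewrite mxE lk andbF mulr0.
by rewrite addr0 mxE !eqxx mulr1.
Qed.

Lemma is_root_rtP g : is_root (K := K) g -> exists i j t, g = rt i j t.
Proof.
case=> g0 [x gx x0]; have [s [i [j nz]]] := root_space_loop gx g0 x0.
by exists i, j, s; apply: weight_unique gx nz.
Qed.


End Loop.

(** * Lists of simple roots as differences of letters *)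

Section Config.
Context {K : closedFieldType} {n m : nat}.
Local Notation N := (n + m)%N.
Hypothesis charK : [pchar K] =i pred0.
Hypothesis N_gt1 : (1 < N)%N.
Implicit Types (c : nat -> 'I_N * int) (f : 'I_N -> int).
Local Open Scope classical_set_scope.

(** A sequence [c] of [N] letters [c q = (i, t)], standing for the weights
    [e_i - t imag], is continued periodically by [c (q + N) = c q - imag];
    [beta c q] is the difference of the letters [q] and [q + 1]. The roots
    [beta c 0, .., beta c (N - 2)] form the list [simple c], and
    [beta c (N - 1)] is its extending root. *)
Definition nxt (q : nat) : nat := if (q.+1 < N)%N then q.+1 else 0%N.

(** The last summand is the wrap-around: after the final letter comes letter 0 minus [imag], whose
    second component is one larger. *)
Definition wt c (q : nat) : int := (c (nxt q)).2 - (c q).2 + (q.+1 == N)%:R.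

Definition beta c (q : nat) : rootlat n m := rt (c q).1 (c (nxt q)).1 (wt c q).

Definition good c : Prop := forall p q, (p < N)%N -> (q < N)%N ->
  (c p).1 = (c q).1 -> p = q.

Definition simple c : seq (rootlat n m) := mkseq (beta c) N.-1.

Definition simples c : set (rootlat n m) := [set g | exists2 q,
  (q < N)%N & g = beta c q].

Lemma nxt_lt q : (nxt q < N)%N.
Proof. by rewrite /nxt; case: ifP => // _; lia. Qed.

Lemma nxt_neq q : nxt q != q.
Proof. by rewrite /nxt; case: ifP => // ?; lia. Qed.

Lemma nxt_inj p q : (p < N)%N -> (q < N)%N -> nxt p = nxt q -> p = q.
Proof. by rewrite /nxt; case: ifP => ?; case: ifP => ?; lia. Qed.

Definition lett c (q : nat) : rootlat n m := (delta_mx 0 (c q).1, - (c q).2).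

Lemma rootlat_eq (g h : rootlat n m) : g.1 = h.1 -> g.2 = h.2 -> g = h.
Proof. by case: g h => a b [a' b'] /= -> ->. Qed.

Lemma beta_lett c q : (q.+1 < N)%N -> beta c q = lett c q - lett c q.+1.
Proof.
move=> qN; rewrite /beta /wt /nxt qN; apply: rootlat_eq => //=.
by rewrite (ltn_eqF qN) addr0 opprK addrC.
Qed.

Lemma beta_last c : beta c N.-1 = lett c N.-1 - lett c 0 + imag.
Proof.
rewrite /beta /wt /nxt prednK ?ltnn; last by lia.
by apply: rootlat_eq; rewrite /= ?addr0 ?eqxx // opprK addrC addrA (addrC (1%:R)) addrC
  addrA; ring.
Qed.

Lemma big_simple c (F : rootlat n m -> rootlat n m) :
  \sum_(b <- simple c) F b = \sum_(0 <= q < N.-1) F (beta c q).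
Proof. by rewrite big_map /index_iota subn0. Qed.

Lemma sum_simple c : \sum_(b <- simple c) b = lett c 0 - lett c N.-1.
Proof.
rewrite big_simple big_nat.
rewrite (eq_bigr (fun q => - (lett c q.+1 - lett c q))) => [|q qN]; last first.
  by rewrite opprB beta_lett //; lia.
by rewrite -big_nat sumrN telescope_sumr // opprB.
Qed.

Lemma ext_root_simple c : ext_root (simple c) = beta c N.-1.
Proof. by rewrite /ext_root sum_simple beta_last opprB addrC. Qed.

Lemma sum_beta c : \sum_(q < N) beta c q = imag.
Proof.
have -> : N = N.-1.+1 by lia.
rewrite big_ord_recr /= -(big_mkord predT (beta c)) beta_last.
have := sum_simple c; rewrite big_simple => ->.
by rewrite addrA subrKA subrr add0r.
Qed.

Lemma mem_simples c : [set` ext_root (simple c) :: simple c] = simples c.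
Proof.
apply/seteqP; split=> g /=; rewrite inE ext_root_simple.
  move=> /predU1P[->|/mapP[q]]; first by exists N.-1 => //; lia.
  by rewrite mem_iota => qN ->; exists q => //; lia.
case=> q qN ->; have [->|qN1] := eqVneq q N.-1; first by rewrite eqxx.
by apply/orP; right; apply: map_f; rewrite mem_iota; lia.
Qed.

Lemma extension_simple c : extension (simple c) = borel (@cartan_aff K n m) (simples c).
Proof. by rewrite /extension mem_simples. Qed.

Definition pos c (i : 'I_N) : nat := index i (mkseq (fun q => (c q).1) N).

Section Good.
Context (c : nat -> 'I_N * int).
Hypothesis gc : good c.

Lemma uniq_letters : uniq (mkseq (fun q => (c q).1) N).
Proof.
rewrite map_inj_in_uniq ?iota_uniq // => p q; rewrite !mem_iota => pN qN.
by apply: gc; lia.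
Qed.

(** Pigeonhole: [N] distinct letters exhaust the [N] indices, so every index occurs. *)
Lemma pos_lt i : (pos c i < N)%N.
Proof.
rewrite -[X in (_ < X)%N](size_mkseq (fun q => (c q).1) N) index_mem.
have /uniq_min_size := uniq_letters; case/(_ (enum 'I_N)).
- by move=> j _; rewrite mem_enum.
- by rewrite size_mkseq size_enum_ord.
- by move=> _ ->; rewrite mem_enum.
Qed.

Lemma posK i : (c (pos c i)).1 = i.
Proof.
have := pos_lt i; rewrite -[X in (_ < X)%N](size_mkseq (fun q => (c q).1) N) index_mem.
by move/(nth_index i); rewrite nth_mkseq // pos_lt.
Qed.

Lemma posE q : (q < N)%N -> pos c (c q).1 = q.
Proof. by move=> qN; apply: gc; rewrite ?pos_lt // posK. Qed.

Lemma pos_inj : injective (pos c).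
Proof. by move=> i j ij; rewrite -(posK i) ij posK. Qed.

Lemma start_neq_end q : (q < N)%N -> (c q).1 != (c (nxt q)).1.
Proof.
move=> qN; apply/eqP => /gc; rewrite nxt_lt => /(_ qN isT) qn.
by have := nxt_neq q; rewrite -qn eqxx.
Qed.

(** The coefficient 1 sits at the starting letter. Simple roots are therefore distinct even modulo
    [imag], which makes the root with a prescribed local name unique. *)
Lemma beta_inj p q : (p < N)%N -> (q < N)%N -> (beta c p).1 = (beta c q).1 -> p = q.
Proof.
move=> pN qN e; have := congr1 (fun v : 'rV[int]_N => v 0 (c p).1) e.
rewrite !rt1E eqxx (negPf (start_neq_end pN)).
by case: eqP => [/gc-> //|_]; case: eqP.
Qed.

End Good.

(** Takes the value [f i] on [e_i] and [N] on [imag]. *)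
Definition ht f (g : rootlat n m) : int := \sum_i g.1 0 i * f i + g.2 * N%:Z.

Lemma htD f g h : ht f (g + h) = ht f g + ht f h.
Proof.
rewrite /ht /= mulrDl addrACA -big_split /=; congr (_ + _).
by apply: eq_bigr => i _; rewrite !mxE mulrDl.
Qed.

Lemma ht0 f : ht f 0 = 0.
Proof. by rewrite /ht /= mul0r addr0 big1 // => i _; rewrite mxE mul0r. Qed.

Lemma ht_sum f (I : Type) (r : seq I) (F : I -> rootlat n m) :
  ht f (\sum_(i <- r) F i) = \sum_(i <- r) ht f (F i).
Proof. by apply: (big_morph _ (htD f) (ht0 f)). Qed.

Lemma ht_mulz f g (x : int) : ht f (g *~ x) = ht f g * x.
Proof.
have hn (k : nat) : ht f (g *+ k) = ht f g * k%:Z.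
  elim: k => [|k IH]; first by rewrite mulr0n ht0 mulr0.
  by rewrite mulrS htD IH intS mulrDr mulr1.
case: x => k; first by rewrite -pmulrn hn.
rewrite NegzE mulrNz mulrN -hn -pmulrn; apply/eqP; rewrite -addr_eq0 -htD.
by rewrite addNr ht0.
Qed.

Lemma sum_eq1 (k : nat) (F : 'I_k -> int) :
  (forall q, 1 <= F q) -> \sum_q F q = k%:R -> forall q, F q = 1.
Proof.
move=> F1 sF q; have : \sum_q (F q - 1) = 0.
  by rewrite sumrB sF sumr_const card_ord subrr.
move/psumr_eq0P => F0; apply/eqP; rewrite -subr_eq0 F0 // => i _.
by rewrite subr_ge0.
Qed.

Lemma ht_imag f : ht f imag = N%:R.
Proof.
rewrite /ht big1 => [|i _]; last by rewrite mxE mul0r.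
by rewrite -[(imag : rootlat n m).2]/(1 : int) add0r mul1r natz.
Qed.

Lemma ht_rt f i j t : ht f (rt i j t) = f i - f j + t * N%:Z.
Proof.
rewrite /ht; congr (_ + _); under eq_bigr => k _ do rewrite rt1E mulrBl.
rewrite sumrB; congr (_ - _).
  rewrite (bigD1 i) //= big1 ?addr0 => [|k /negPf ki]; last by rewrite ki mul0r.
  by rewrite eqxx mul1r.
rewrite (bigD1 j) //= big1 ?addr0 => [|k /negPf ki]; last by rewrite ki mul0r.
by rewrite eqxx mul1r.
Qed.

(** Chosen so that every [beta c q] gets height 1. *)
Definition posf c (i : 'I_N) : int := (c (pos c i)).2 * N%:Z - (pos c i)%:Z.

Lemma ht_beta c q : good c -> (q < N)%N -> ht (posf c) (beta c q) = 1.
Proof.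
move=> gc qN; rewrite ht_rt /posf /wt !posE ?nxt_lt //.
have -> : (nxt q)%:Z = q%:Z + 1 - (q.+1 == N)%:R * N%:Z.
  rewrite /nxt; case: (ltngtP q.+1 N) => [qn|qn|<-]; rewrite ?mul0r ?mul1r; lia.
ring.
Qed.

(** Two positions differ by less than [N], so height 1 leaves only consecutive positions, or the
    last position followed by the first one with one extra [imag]. *)
Lemma simple_of_ht1 c i j t : good c -> ht (posf c) (rt i j t) = 1 ->
  rt i j t = beta c (pos c i).
Proof.
move=> gc; rewrite ht_rt /posf; have pi := pos_lt gc i; have pj := pos_lt gc j.
set p := pos c i in pi *; set q := pos c j in pj * => e.
have {}e : q%:Z - p%:Z - 1 = ((c q).2 - (c p).2 - t) * N%:Z.
  by rewrite !mulrBl -e; ring.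
have ip : i = (c p).1 by rewrite posK.
have jq : j = (c q).1 by rewrite posK.
rewrite ip jq /beta /wt.
have [x0|x1] : (c q).2 - (c p).2 - t = 0 \/ (c q).2 - (c p).2 - t = -1.
- by move: e; move: (_ - t) => x e; nia.
- have qp : q = p.+1 by rewrite x0 in e; lia.
  have -> : nxt p = q by rewrite /nxt -qp pj.
  congr rt; have -> : (p.+1 == N) = false by lia.
  by rewrite addr0; lia.
- have qp : q = 0%N /\ p.+1 = N by rewrite x1 in e; lia.
  have -> : nxt p = q by rewrite /nxt qp.2 ltnn qp.1.
  by congr rt; rewrite qp.2 eqxx /=; lia.
Qed.

Lemma ht_neq0 c i j t : good c -> i != j -> ht (posf c) (rt i j t) != 0.
Proof.
move=> gc ij; apply/eqP; rewrite ht_rt /posf.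
have pi := pos_lt gc i; have pj := pos_lt gc j.
have pij : pos c i != pos c j by apply: contra_neq ij; apply: pos_inj.
set p := pos c i in pi pij *; set q := pos c j in pj pij * => e.
have {}e : q%:Z - p%:Z = ((c q).2 - (c p).2 - t) * N%:Z.
  by apply/eqP; rewrite -subr_eq0 -e; apply/eqP; ring.
move: e; move: (_ - t) => x e; have [x0|x0] := eqVneq x 0.
  by rewrite x0 mul0r in e; lia.
by nia.
Qed.

Lemma cartan_aff_graded (P : 'I_N -> 'I_N -> int -> Prop) :
  (forall i, P i i 0) -> @cartan_aff K n m `<=` graded P.
Proof. by move=> P0 x [Lx xd]; split=> // s i j /xd[-> ->]. Qed.

Lemma root_space_graded (P : 'I_N -> 'I_N -> int -> Prop) g :
  (forall i j s, g = rt i j s -> P i j s) -> @root_space K n m g `<=` graded P.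
Proof.
move=> Pg x gx; have [Lx _ _] := gx; split=> // s i j nz; apply: Pg.
exact (weight_unique charK gx nz).
Qed.

(** Heights add under brackets, vanish on the Cartan part and equal 1 on the generating roots. *)
Lemma extension_ht c i j t (x : Lamb K n m) : good c -> extension (simple c) x ->
  loop x t i j != 0 -> 0 <= ht (posf c) (rt i j t) :> int.
Proof.
move=> gc; rewrite extension_simple => bx nz.
pose P i j t := 0 <= ht (posf c) (rt i j t) :> int.
suff /(_ x bx)[_] : borel (@cartan_aff K n m) (simples c) `<=` graded P by apply.
apply: borel_sub.
- apply: graded_subalgebra => i' k j' a b; rewrite /P !ht_rt => h1 h2.
  by have := addr_ge0 h1 h2; congr (_ <= _); ring.
- by apply: cartan_aff_graded => k; rewrite /P ht_rt subrr mul0r.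
- move=> _ [q qN ->]; apply: root_space_graded => i' j' s e.
  by rewrite /P -e ht_beta.
Qed.

(** A simple root of the first Borel subalgebra has height at least 1 for the
    second one; there are [N] of them and their sum [imag] has height [N], so
    all these heights are 1. *)
Lemma extension_simples_sub c c' : good c -> good c' ->
  extension (K := K) (simple c) = extension (simple c') -> simples c `<=` simples c'.
Proof.
move=> gc gc' e.
have hq (q : 'I_N) : 1 <= ht (posf c') (beta c q) :> int.
  have ne := start_neq_end gc (ltn_ord q); 
  have : extension (simple c) (tE (K := K) (c q).1 (c (nxt q)).1 (wt c q)).
    rewrite extension_simple; apply: (@root_space_borel _ _ _ _ _ (beta c q)).
      by exists q.
    exact: tE_root_space.
  rewrite e => /(extension_ht gc')/(_ (tE_loop _ _ _)).
  have := ht_neq0 (wt c q) gc' ne; rewrite -/(beta c q); lia.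
have := sum_beta c => /(congr1 (ht (posf c'))); rewrite ht_sum.
rewrite ht_imag => /(sum_eq1 hq) h1 _ [q qN ->].
exists (pos c' (c q).1); first exact: pos_lt.
exact: (simple_of_ht1 gc' (h1 (Ordinal qN))).
Qed.

Lemma extension_simples c c' : good c -> good c' ->
  extension (K := K) (simple c) = extension (simple c') -> simples c = simples c'.
Proof. 
move=> gc gc' e; apply/seteqP; split; first exact: extension_simples_sub gc gc' e.
exact: extension_simples_sub gc' gc (esym e). Qed.

Lemma beta_is_root c q : good c -> (q < N)%N -> is_root (K := K) (beta c q).
Proof. by move=> gc qN; apply/is_root_rt/start_neq_end. Qed.

(** Each letter ends one simple root and starts the next one, so its coefficient forces neighbouring
    values of [x] to agree. A constant relation is a multiple of the sum [imag], whose height is not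
    0. *)
Lemma beta_free c (x : nat -> int) : good c ->
  \sum_(q < N) beta c q *~ x q = 0 -> forall q, (q < N)%N -> x q = 0.
Proof.
move=> gc s0; have rec q : (q < N)%N -> x (nxt q) = x q.
  move=> qN; have := congr1 (fun g : rootlat n m => g.1 0 (c (nxt q)).1) s0.
  pose cf (g : rootlat n m) : int := g.1 0 (c (nxt q)).1.
  have cfD : {morph cf : g h / g + h} by move=> g h; rewrite /cf mxE.
  have cf0 : cf 0 = 0 by rewrite /cf mxE.
  rewrite -/(cf _) (big_morph cf cfD cf0) -/(cf _) cf0 => e.
  have cfz g y : cf (g *~ y) = cf g * y.
    have cfn k : cf (g *+ k) = cf g * k%:Z.
      elim: k => [|k IH]; first by rewrite mulr0n cf0 mulr0.
      by rewrite mulrS cfD IH intS mulrDr mulr1.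
    case: y => k; first by rewrite -pmulrn cfn.
    rewrite NegzE mulrNz mulrN -cfn -pmulrn; apply/eqP; rewrite -addr_eq0 -cfD.
    by rewrite addNr cf0.
  apply/eqP; rewrite -subr_eq0 -e; apply/eqP.
  rewrite (bigD1 (Ordinal (nxt_lt q))) //= (bigD1 (Ordinal qN)) /=; last first.
    by rewrite -val_eqE /= eq_sym nxt_neq.
  rewrite !cfz /cf !rt1E eqxx (negPf (start_neq_end gc (nxt_lt q))).
  rewrite [_ == (c q).1]eq_sym (negPf (start_neq_end gc qN)).
  rewrite -[true%:R]/(1 : int) -[false%:R]/(0 : int).
  rewrite big1 ?addr0 => [|p /andP[p1 p2]]; first by ring.
  rewrite -[LHS]/(cf (beta c p *~ x p)) cfz /cf !rt1E.
  case: eqP => [/gc|_]; first by rewrite nxt_lt => /(_ isT (ltn_ord p)) ep; move: p1;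
    rewrite -val_eqE /= ep eqxx.
  case: eqP => [/gc|_]; last by rewrite mul0r.
  rewrite !nxt_lt => /(_ isT isT)/(nxt_inj qN (ltn_ord p)) ep.
  by move: p2; rewrite -val_eqE /= ep eqxx.
have const q : (q < N)%N -> x q = x 0.
  elim: q => // q IH qN; rewrite -(IH (ltnW qN)) -(rec q (ltnW qN)) /nxt qN //.
move=> q qN; rewrite const //.
have := congr1 (ht (posf c)) s0; rewrite ht_sum ht0.
rewrite (eq_bigr (fun=> x 0)) => [|p _]; last by rewrite ht_mulz ht_beta // mul1r const.
by rewrite sumr_const card_ord => /eqP; rewrite mulrn_eq0; case: (N) N_gt1 =>
  // k _ /eqP.
Qed.

Lemma uniq_full c : good c -> uniq (ext_root (simple c) :: simple c).
Proof.
move=> gc; rewrite ext_root_simple cons_uniq; apply/andP; split.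
  apply/mapP => -[q]; rewrite mem_iota => qN /(congr1 (fun g : rootlat n m => g.1)).
  by move/(beta_inj gc); lia.
rewrite /simple /mkseq map_inj_in_uniq ?iota_uniq // => p q; rewrite !mem_iota =>
  pN qN e.
by apply: (beta_inj gc) => //; rewrite ?e //; lia.
Qed.

Lemma lin_indep_full c : good c -> lin_indep (ext_root (simple c) :: simple c).
Proof.
move=> gc x; rewrite big_cons ext_root_simple addrC (big_simple c (fun g =>
  g *~ x g)) big_mkord => s0.
have {}s0 : \sum_(q < N) beta c q *~ x (beta c q) = 0.
  rewrite -[RHS]s0; have -> : N = N.-1.+1 by lia.
  by rewrite big_ord_recr /=.
have x0 := beta_free (x := fun q => x (beta c q)) gc s0.
move=> g; rewrite inE => /predU1P[->|/mapP[q]]; first by apply: x0; lia.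
by rewrite mem_iota => qN ->; apply: x0; lia.
Qed.

Lemma extension_has_simple_roots c : good c ->
  has_simple_roots (@cartan_aff K n m) (extension (simple c)) (ext_root (simple c) ::
    simple c).
Proof.
move=> gc; split=> //; [exact: uniq_full|exact: lin_indep_full|].
move=> g gs; have : simples c g by rewrite -mem_simples.
by case=> q qN ->; apply: beta_is_root.
Qed.

Lemma coordD (g h : rootlat n m) i : (g + h).1 0 i = g.1 0 i + h.1 0 i.
Proof. by rewrite mxE. Qed.

Lemma rt_not_root (g : rootlat n m) i : `|g.1 0 i| > 1 -> ~ is_root (K := K) g.
Proof.
by move=> gi /(is_root_rtP charK)[a [b [t e]]]; move: gi; rewrite e rt1E; case: eqP;
  case: eqP.
Qed.

Lemma rt_not_root2 (g : rootlat n m) i j : i != j -> g.1 0 i = 1 -> g.1 0 j = 1 -> ~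
  is_root (K := K) g.
Proof.
move=> ij gi gj /(is_root_rtP charK)[a [b [t e]]]; move: gi gj; rewrite e !rt1E.
case: (i =P a) => [ia|_]; last by case: eqP.
case: (j =P a) => [ja|_]; last by move=> _; case: (j == b).
by rewrite ia ja eqxx in ij.
Qed.

(** The hypotheses hold for two distinct simple roots, since a letter starts only one of them and
    ends only one. For such roots both ends can meet only if [N = 2], the case in which
    [reflect_root] adds twice. *)
Lemma reflect_root_rt (a b i j : 'I_N) (u t : int) : a != b -> i != a -> j != b -> i !=
  j ->
  reflect_root (K := K) (rt a b u) (rt i j t) =
  rt (if i == b then a else i) (if j == a then b else j)
     (t + u * (i == b)%:R + u * (j == a)%:R).
Proof.
move=> /negPf ab /negPf ia /negPf jb /negPf ij; rewrite /reflect_root.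
case: eqP => [/(congr1 (fun g : rootlat n m => g.1 0 a))|_].
  by rewrite !rt1E eqxx ab eq_sym ia; case: eqP.
(* The root plus twice the reflecting root has coefficient 2 at [a] unless [j = a], and -2 at [b]
   unless [i = b]; so it can be a root only if both ends meet. *)
have rtDD v : rt i j t + rt a b u + rt a b u = v -> v.1 0 a = (a == i)%:R - (a == j)%:R
  + 2 /\ v.1 0 b = (b == i)%:R - (b == j)%:R - 2.
  by move=> <-; rewrite !coordD !rt1E !eqxx (eq_sym b a) ab;
    rewrite -[true%:R]/(1 : int) -[false%:R]/(0 : int); split; ring.
have [v1 v2] := rtDD _ erefl; move: v1 v2; rewrite (eq_sym a i) ia (eq_sym b j) jb.
rewrite (eq_sym b) (eq_sym a) !subr0.
case: (i =P b) => [ib|/eqP/negPf ib]; case: (j =P a) => [ja|/eqP/negPf ja] v1 v2.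
- have e : rt i j t + rt a b u + rt a b u = rt a b (t + u * 1 + u * 1).
    by rewrite ib ja; apply: rootlat_eq => /=; [rewrite addrACA; apply/rowP => k;
      rewrite !mxE; ring|ring].
  by rewrite e asboolT //; apply: is_root_rt; rewrite ab.
- rewrite asboolF; last by apply: (@rt_not_root _ a); rewrite v1.
  have e : rt i j t + rt a b u = rt a j (t + u * 1 + u * 0).
    by rewrite ib; apply: rootlat_eq => /=; [apply/rowP => k; rewrite !mxE; ring|ring].
  by rewrite e asboolT //; apply: is_root_rt; rewrite eq_sym ja.
- rewrite asboolF; last by apply: (@rt_not_root _ b); rewrite v2.
  have e : rt i j t + rt a b u = rt i b (t + u * 0 + u * 1).
    by rewrite ja; apply: rootlat_eq => /=; [apply/rowP => k; rewrite !mxE; ring|ring].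
  by rewrite e asboolT //; apply: is_root_rt; rewrite ib.
- rewrite asboolF; last by apply: (@rt_not_root _ a); rewrite v1.
  rewrite asboolF ?mulr0 ?addr0 //; apply: (@rt_not_root2 _ a i);
    rewrite 1?eq_sym ?ia //.
    by rewrite coordD !rt1E !eqxx (eq_sym a i) ia (eq_sym a j) ja ab.
  by rewrite coordD !rt1E !eqxx ij ia ib.
Qed.

Definition swp (p q : nat) : nat := if q == p then p.+1 else if q == p.+1 then p else q.

(** The bound on [p] keeps the exchanged letters inside one period, so no multiple of [imag] is
    introduced. The root [q = N.-1] is included, so the extending root is reflected into the new
    extending root. *)
Lemma reflect_beta c p q : good c -> (p.+1 < N)%N -> (q < N)%N ->
  reflect_root (K := K) (beta c p) (beta c q) = beta (c \o swp p) q.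
Proof.
move=> gc pN qN; have [->|qp] := eqVneq q p.
  rewrite /reflect_root eqxx /beta /wt /nxt pN /= /swp !eqxx (gtn_eqF (ltnSn p))
    (ltn_eqF pN).
  by apply: rootlat_eq; rewrite /= ?opprB // !addr0 opprB.
have nN := nxt_lt q; have np : nxt p = p.+1 by rewrite /nxt pN.
have inj (r s : nat) : (r < N)%N -> (s < N)%N -> ((c r).1 == (c s).1) = (r == s).
  by move=> rN sN; apply/eqP/eqP => [/gc->|->].
have nqp : (nxt q == p.+1) = false.
  by apply/eqP; rewrite -np => /(nxt_inj qN (ltnW pN)) e; rewrite e eqxx in qp.
rewrite [beta c p]/beta [beta c q]/beta reflect_root_rt ?start_neq_end ?(ltnW pN) //;
  rewrite ?np ?inj ?(ltnW pN) ?nqp ?qp //.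
rewrite /beta /wt /= /swp nqp (negPf qp) np (ltn_eqF pN) addr0.
congr rt; [by case: ifP|by case: ifP|].
by case: (nxt q =P p) => [->|_]; case: (q =P p.+1) => [->|_] /=; ring.
Qed.

End Config.

(** * Borel subalgebras of the finite part *)

Section FiniteBorels.
Context {K : closedFieldType} {n m : nat}.
Local Notation N := (n + m)%N.
Hypothesis charK : [pchar K] =i pred0.
Hypothesis N_gt1 : (1 < N)%N.
Implicit Types (c : nat -> 'I_N * int) (f : 'I_N -> int) (x : Lamb K n m).
Local Open Scope classical_set_scope.

Lemma rt_inj (i j i' j' : 'I_N) (t t' : int) : i != j -> rt i j t = rt i' j' t' ->
  [/\ i = i', j = j' & t = t'].
Proof.
move=> /negPf ij e; have co k := congr1 (fun g : rootlat n m => g.1 0 k) e.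
split; last exact: (congr1 (fun g : rootlat n m => g.2) e).
  by have := co i; rewrite !rt1E eqxx ij; case: (i =P i') => // _; case: (i == j').
have := co j; rewrite !rt1E eqxx (eq_sym j) ij; case: (j =P j') => // _.
by case: (j == i').
Qed.

(** An intersection of subalgebras is closed under the operations; that it lies in [Lhat] holds
    because [Lhat] itself is a subalgebra containing the generators. *)
Lemma borel_subalgebra (H : set (Lamb K n m)) S : H `<=` Lhat -> Lie_subalgebra (borel
  H S).
Proof.
move=> HL; have LL := @Lhat_subalgebra K n m.
have bL : borel H S `<=` Lhat by apply: borel_sub => // g _ x [].
split=> //.
- by move=> U [[]].
- move=> a x y bx bY U [LU HU]; have [_ _ Ul _] := LU.
  by apply: Ul; [apply: bx|apply: bY].
- move=> x y bx bY U [LU HU]; have [_ _ _ Ub] := LU.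
  by apply: Ub; [apply: bx|apply: bY].
Qed.

Lemma cartan_fin_Lhat : @cartan_fin K n m `<=` Lhat.
Proof. by move=> x [[]]. Qed.

(** The diagonal unit at [i] acts by 1, so [x] is a bracket with an element of degree 0: this
    removes the components along [c] and [d], and [weight_unique] removes all other entries. *)
Lemma root_space_line (i j : 'I_N) t x : i != j -> root_space (rt i j t) x ->
  x = loop x t i j *: tE i j t.
Proof.
move=> ij gx; have [_ hx _] := gx.
have ht1 : \sum_k ((rt i j t).1 0 k)%:~R * (delta_mx 0 i : 'rV[K]_N) 0 k = 1.
  rewrite (bigD1 i) //= big1 => [|k /negPf ki]; last by rewrite [delta_mx _ _ _ _]mxE
    ki andbF mulr0.
  by rewrite addr0 !mxE !eqxx (negPf ij) subr0 mulr1.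
have := hx (delta_mx 0 i); rewrite ht1 scale1r => bx.
have dx : dcoef x = 0 by rewrite -bx.
have cx : ccoef x = 0.
  by rewrite -bx /ccoef /= fsum_at0 ?mul0r // => a /negPf a0;
    rewrite loop_fin a0 mul0mx str0 mulr0.
have lx : loop x = fun s => loop x t i j *: (if s == t then delta_mx i j else 0).
  apply: funext => s; apply/matrixP => k l.
  have [nz|z] := eqVneq (loop x s k l) 0.
    rewrite nz mxE; case: eqP => [st|_]; rewrite mxE ?mulr0 //.
    by case: eqP => [ki|_]; case: eqP => [lj|_]; rewrite ?mulr0 // -st -ki -lj nz mul0r.
  have [-> -> ->] := rt_inj ij (weight_unique charK gx z).
  by rewrite eqxx !mxE !eqxx mulr1.
case: x dx cx lx {gx hx ht1 bx} => [[lx cx] dx] /= d0 c0 l0.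
rewrite /dcoef /ccoef /loop /= in d0 c0 l0; rewrite d0 c0.
by congr (_, _, _); rewrite /= ?scaler0 // [LHS]l0.
Qed.

Lemma tE_fin (i j : 'I_N) : tE i j 0 = fin_elt (delta_mx i j) :> Lamb K n m.
Proof. by []. Qed.

Lemma sbracket_delta (i k j : 'I_N) : i != j ->
  sbracket (delta_mx i k) (delta_mx k j) = delta_mx i j :> 'M[K]_N.
Proof.
move=> /negPf ij; apply/matrixP => a b; rewrite sbracketE.
have z l : delta_mx k j a l * delta_mx i k l b = 0 :> K.
  by rewrite !mxE; case: (l =P j) => [->|_]; rewrite ?(eq_sym j) ?ij ?andbF ?mulr0
    ?mul0r.
rewrite (bigD1 k) //= big1 => [|l /negPf lk].
  rewrite z mulr0 subr0 addr0 !mxE !eqxx andbT /=.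
  by case: eqP; rewrite ?mul1r ?mul0r.
by rewrite z mulr0 subr0 !mxE lk andbF mul0r.
Qed.

Lemma bracket_tE (i k j : 'I_N) : i != j ->
  bracket (tE i k 0) (tE k j 0) = tE i j 0 :> Lamb K n m.
Proof. by move=> ij; rewrite !tE_fin bracket_fin sbracket_delta. Qed.

Definition flat c : Prop := forall q, (q < N)%N -> (c q).2 = 0.

(** Larger on earlier letters, so that every simple root of a flat configuration takes the value
    1. *)
Definition negpos c (i : 'I_N) : int := - (pos c i)%:Z.

Lemma negpos_inj c : good c -> injective (negpos c).
Proof. by move=> gc i j /oppr_inj [] /(pos_inj N_gt1 gc). Qed.

Lemma simple_flat c q : good c -> flat c -> (q.+1 < N)%N ->
  beta c q = rt (c q).1 (c q.+1).1 0.
Proof.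
move=> gc fc qN; rewrite /beta /wt /nxt qN !fc //; last exact: ltnW.
by rewrite (ltn_eqF qN).
Qed.

Lemma mem_simple c g : reflect (exists2 q, (q.+1 < N)%N & g = beta c q) (g \in simple
  c).
Proof.
apply: (iffP mapP) => -[q]; first by rewrite mem_iota => ? ->; exists q => //; lia.
by move=> ? ->; exists q => //; rewrite mem_iota; lia.
Qed.

(** Together with [Tri_functional] this identifies the Borel subalgebra of [f] with the
    supertraceless matrices that are triangular for the order of the indices by decreasing [f]. *)
Lemma functional_Tri f x : borel_functional f x -> gfin x /\
  forall s i j, loop x s i j != 0 -> s = 0 /\ f j <= f i.
Proof.
pose P i j (s : int) := s = 0 /\ f j <= f i.
have : borel_functional f `<=` @gfin K n m `&` graded P; last first.
  by move=> H /H[gx [_ Px]].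
have H1 : Lie_subalgebra (graded (K := K) P).
  apply: graded_subalgebra => i k j a b [-> ki] [-> jk]; split=> //.
  exact: le_trans jk ki.
apply: borel_sub.
- by apply: Lie_subalgebraI => //; exact: gfin_subalgebra.
- move=> y [ya yg]; split=> //; move: y ya {yg}; apply: cartan_aff_graded => i.
  by split.
- move=> g [rg g2 gf] y gy.
  have [i [j [t eg]]] := is_root_rtP charK rg.
  have t0 : t = 0 by rewrite -g2 eg.
  rewrite eg t0 in gy gf rg.
  have fij : f j < f i.
    have := ht_rt f i j 0; rewrite /ht /= mul0r !addr0 => e.
    by rewrite -subr_gt0 -e.
  have ij : i != j by apply: contraTneq fij => ->; rewrite ltxx.
  split; last first.
    move: y gy; apply: root_space_graded => // i' j' s.
    by move/(rt_inj ij) => [<- <- <-]; split=> //; exact: ltW.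
  rewrite (root_space_line ij gy) tE_fin; exists (loop y 0 i j *: delta_mx i j).
    have := @tE_Lhat K n m i j 0 ij; rewrite tE_fin Lhat_fin strZ => ->.
    by rewrite mulr0.
  by rewrite -[in RHS](addr0 (_ *: _)) fin_eltP fin_elt0 addr0.
Qed.

Lemma functional_tE f (i j : 'I_N) : f j < f i -> borel_functional f (tE (K := K) i j
  0).
Proof.
move=> fij; have ij : i != j by apply: contraTneq fij => ->; rewrite ltxx.
apply: (@root_space_borel _ _ _ _ _ (rt i j 0)); last exact: tE_root_space.
split=> //; first exact: is_root_rt.
by have := ht_rt f i j 0; rewrite /ht /= mul0r !addr0 => ->; rewrite subr_gt0.
Qed.

Lemma subalgebra_sum (U : set (Lamb K n m)) (I : Type) (r : seq I) (P : pred I) (a : I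
  -> K) (F : I -> Lamb K n m) :
  Lie_subalgebra U -> (forall i, P i -> U (F i)) -> U (\sum_(i <- r | P i) a i *: F i).
Proof.
move=> [_ U0 Ul _] UF; elim: r => [|i r IH]; first by rewrite big_nil.
by rewrite big_cons; case: ifP => // Pi; apply: Ul => //; apply: UF.
Qed.

Lemma Tri_functional f (A : 'M[K]_N) : injective f -> str A = 0 ->
  (forall i j, A i j != 0 -> f j <= f i) -> borel_functional f (fin_elt A).
Proof.
move=> fi A0 Af; have LB : Lie_subalgebra (@borel_functional K n m f).
  exact: borel_subalgebra cartan_fin_Lhat.
have [_ _ Bl _] := LB.
(* The diagonal part has the supertrace of [A], so it lies in the Cartan subalgebra; what remains is
   a combination of matrix units, each a root vector. *)
pose D := diag_mx (\row_i A i i).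
have strD0 : str D = 0.
  by rewrite -A0; apply: eq_bigr => i _; rewrite !mxE eqxx mulr1n.
have -> : fin_elt A = 1 *: fin_elt D + \sum_(p : 'I_N * 'I_N | (A p.1 p.2 != 0) && (p.1
  != p.2))
    A p.1 p.2 *: tE p.1 p.2 0.
  pose phi (B : 'M[K]_N) : Lamb K n m := fin_elt B.
  have phiD : {morph phi : B C / B + C}.
    by move=> B C; rewrite -[B]scale1r /phi fin_eltP !scale1r.
  have phiZ a B : a *: phi B = phi (a *: B).
    by rewrite /phi -[in RHS](addr0 (_ *: _)) fin_eltP fin_elt0 addr0.
  rewrite scale1r; under eq_bigr => p _ do rewrite tE_fin -/(phi _) phiZ.
  rewrite -(big_morph phi phiD (fin_elt0)) -/(phi D) -phiD; congr fin_elt.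
  apply/matrixP => i j; rewrite mxE summxE /D mxE mxE.
  have [<-|ij] := eqVneq i j.
    rewrite mulr1n big1 ?addr0 // => -[k l] /= /andP[_ kl]; rewrite !mxE.
    case: eqP => [->|_]; case: eqP => [e|_]; rewrite ?mulr0 //.
    by rewrite e eqxx in kl.
  rewrite mulr0n add0r; have [Aij|Aij] := eqVneq (A i j) 0.
    rewrite Aij big1 // => -[k l] /= /andP[Akl _]; rewrite !mxE.
    by case: eqP => [ik|_]; case: eqP => [jl|_]; rewrite ?mulr0 //;
      rewrite -ik -jl Aij eqxx in Akl.
  rewrite (bigD1 (i, j)) /= ?Aij ?ij // !mxE !eqxx mulr1 big1 ?addr0 // =>
    -[k l] /= /andP[_].
  rewrite xpair_eqE !mxE (eq_sym i) (eq_sym j) => /negPf ->; exact: mulr0.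
apply: Bl.
  apply: sub_gen_smallest; left; split; last by exists D.
  split; first exact/Lhat_fin.
  move=> s i j; rewrite loop_fin; case: (s =P 0) => [->|_]; last by rewrite mxE eqxx.
  by rewrite mxE; have [->|_] := eqVneq i j; rewrite ?mulr0n ?eqxx.
apply: subalgebra_sum => // -[i j] /= /andP[Aij ij]; apply: functional_tE.
by rewrite lt_neqAle Af // andbT (inj_eq fi) eq_sym.
Qed.

(** Matrix units turn the condition on the even part into monotonicity of [f] within each parity.
    Nothing links the two parities, which leaves exactly the freedom of a shuffle. *)
Lemma even_part f : injective f ->
  (borel_functional f `&` @even_elts K n m = @gfin K n m `&` @even_elts K n m `&`
    @upper_elts K n m
  <-> forall i j : 'I_N, par i = par j -> (i < j)%N -> f j < f i).
Proof.
move=> fi; split=> [e i j pij ij|mono].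
  have nij : i != j by apply: contraTneq ij => ->; rewrite ltnn.
  have : (borel_functional f `&` @even_elts K n m) (tE i j 0).
    have loopE s k l : loop (tE i j 0 : Lamb K n m) s k l != 0 -> k = i /\ l = j.
      rewrite /loop /=; case: (s =P 0) => _; rewrite mxE ?eqxx //.
      by case: (k =P i) => [->|_]; case: (l =P j) => [->|_]; rewrite ?eqxx.
    rewrite e; split; [split|]; last 2 first.
    - by move=> s k l /loopE[-> ->].
    - by move=> s k l /loopE[-> ->]; exact: ltnW.
    exists (delta_mx i j); last exact: tE_fin.
    by have := @tE_Lhat K n m i j 0 nij; rewrite tE_fin Lhat_fin.
  case=> /functional_Tri[_ /(_ _ _ _ (tE_loop _ _ _))[_ fij]] _.
  by rewrite lt_neqAle fij andbT (inj_eq fi) eq_sym.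
apply/seteqP; split=> x.
  move=> [/functional_Tri[gx Tx] ex]; split=> // s i j nz.
  have [_ fij] := Tx _ _ _ nz; have pij := ex _ _ _ nz.
  by rewrite leqNgt; apply/negP => /(mono _ _ (esym pij)); rewrite ltNge fij.
move=> [[[A A0 ->] ex] ux]; split=> //; apply: Tri_functional => // i j Aij.
have nz : loop (fin_elt A) 0 i j != 0 by rewrite loop_fin eqxx.
have := ux _ _ _ nz; rewrite leq_eqVlt => /predU1P[/val_inj->//|ij].
by apply/ltW/mono => //; exact: ex nz.
Qed.

Definition borelc c : set (Lamb K n m) := borel (@cartan_fin K n m) [set` simple c].

(** Such a matrix unit is an iterated bracket of simple root vectors along the letters from [i] to
    [j]; the induction splits off the first step. *)
Lemma borelc_tE c (i j : 'I_N) : good c -> flat c -> (pos c i < pos c j)%N ->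
  borelc c (tE i j 0).
Proof.
move=> gc fc; have LB : Lie_subalgebra (borelc c) := borel_subalgebra _ cartan_fin_Lhat.
have [_ _ _ Bb] := LB.
have [k] := ubnP (pos c j - pos c i)%N; elim: k i => // k IH i kij ij.
have pj := pos_lt N_gt1 gc j.
have piN : ((pos c i).+1 < N)%N by apply: leq_ltn_trans ij pj.
pose l := (c (pos c i).+1).1; have pl : pos c l = (pos c i).+1 by rewrite posE.
have il : borelc c (tE i l 0).
  apply: (@root_space_borel _ _ _ _ _ (rt i l 0)).
    by apply/mem_simple; exists (pos c i); rewrite // simple_flat // posK.
  apply: tE_root_space; apply/eqP => e; move: pl; rewrite -e; lia.
have [lj|lj] := eqVneq l j; first by rewrite -lj.
rewrite -(@bracket_tE i l j); last by apply: contraTneq ij => ->; rewrite ltnn.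
apply: Bb => //; apply: IH; rewrite pl; first by lia.
by rewrite ltn_neqAle ij andbT -pl; apply: contra_neq lj => /(pos_inj N_gt1 gc).
Qed.

Lemma borelc_functional c : good c -> flat c -> borelc c = borel_functional (negpos c).
Proof.
move=> gc fc; have LB : Lie_subalgebra (borelc c) := borel_subalgebra _ cartan_fin_Lhat.
have LF : Lie_subalgebra (@borel_functional K n m (negpos c)) := borel_subalgebra _
  cartan_fin_Lhat.
apply/seteqP; split; apply: borel_sub => //; try by move=> x Hx;
  apply: sub_gen_smallest; left.
  move=> g /mem_simple[q qN ->]; apply: root_space_borel; split.
  - by apply: beta_is_root => //; exact: ltnW.
  - by rewrite simple_flat.
  - rewrite simple_flat //; have := ht_rt (negpos c) (c q).1 (c q.+1).1 0.
    rewrite /ht /= mul0r !addr0 => ->; rewrite /negpos !posE //; last exact: ltnW.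
    lia.
move=> g [rg g2 gf] x gx; have [i [j [t eg]]] := is_root_rtP charK rg.
have t0 : t = 0 by rewrite -g2 eg.
rewrite eg t0 in gx gf.
have pij : (pos c i < pos c j)%N.
  have := ht_rt (negpos c) i j 0; rewrite /ht /= mul0r !addr0 => e.
  by move: gf; rewrite /= e /negpos; lia.
have ij : i != j by apply: contraTneq pij => ->; rewrite ltnn.
rewrite (root_space_line ij gx); have [_ B0 Bl _] := LB.
by rewrite -[X in borelc c X]addr0; apply: Bl => //; apply: borelc_tE.
Qed.

Lemma borelc_has_simple_roots c : good c ->
  has_simple_roots (@cartan_fin K n m) (borelc c) (simple c).
Proof.
move=> gc; have := uniq_full N_gt1 gc; rewrite cons_uniq => /andP[_ us]; split=> //.
  move=> x; rewrite (big_simple c (fun g => g *~ x g)) big_mkord => s0.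
  have s1 : \sum_(q < N) beta c q *~ (if (q.+1 < N)%N then x (beta c q) else 0) = 0.
    rewrite -[RHS]s0; have -> : N = N.-1.+1 by lia.
    rewrite big_ord_recr /= ltnn mulr0z addr0; apply: eq_bigr => q _.
    by have -> : (q.+1 < N.-1.+1)%N by have := ltn_ord q; lia.
  move=> g /mem_simple[q qN ->].
  have := beta_free N_gt1 (x := fun q => if (q.+1 < N)%N then x (beta c q) else 0) gc
    s1.
  by move=> /(_ q (ltnW qN)); rewrite qN.
by move=> g /mem_simple[q qN ->]; apply: beta_is_root => //; exact: ltnW.
Qed.

(** Each indecomposable root [beta c q] is a sum of elements of [s], all of
    height at least 1, hence lies in [s]; and [s], being independent, contains
    no further sum of these roots. *)
Lemma borelc_simple_roots_unique c s : good c -> flat c ->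
  has_simple_roots (@cartan_fin K n m) (borelc c) s -> s =i simple c.
Proof.
move=> gc fc [us ls rs bs].
have sroot g : g \in s -> exists i j : 'I_N, (pos c i < pos c j)%N /\ g = rt i j 0.
  move=> gs; have [g0 [x gx x0]] := rs g gs.
  have [t [i [j nz]]] := root_space_loop charK gx g0 x0.
  have [_ Tx] : gfin x /\ forall s i j, loop x s i j != 0 -> s = 0 /\ negpos c j <=
    negpos c i.
    apply: functional_Tri; rewrite -borelc_functional // bs.
    exact: root_space_borel gs _ gx.
  have [t0 ji] := Tx _ _ _ nz; have e := weight_unique charK gx nz.
  exists i, j; split; last by rewrite e t0.
  rewrite ltn_neqAle; have -> : (pos c i <= pos c j)%N by move: ji; rewrite /negpos;
    lia.
  rewrite andbT; apply: contra_neq g0 => /(pos_inj N_gt1 gc) ij.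
  by rewrite e t0 ij; apply: rootlat_eq; rewrite /= ?subrr.
have sub g : g \in simple c -> g \in s.
  move=> /mem_simple[q qN ->]; rewrite simple_flat //.
  set i := (c q).1; set j := (c q.+1).1.
  have pi : pos c i = q by rewrite posE // ltnW.
  have pj : pos c j = q.+1 by rewrite posE.
  (* Entries of elements of the Borel subalgebra occur only at sums of elements of [s], the empty
     sum accounting for the Cartan part. *)
  pose P i j t := exists2 u : seq (rootlat n m), {subset u <= s} & rt i j t = \sum_(g
    <- u) g.
  have : borelc c `<=` graded P.
    rewrite bs; apply: borel_sub.
    - apply: graded_subalgebra => a b d ta tb [u us' eu] [v vs ev].
      exists (u ++ v); first by move=> h; rewrite mem_cat => /orP[/us'|/vs].
      rewrite big_cat /= -eu -ev; apply: rootlat_eq => //=.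
      by rewrite addrA subrK.
    - move=> x [xa _]; move: x xa; apply: cartan_aff_graded => a; exists [::] => //.
      by rewrite big_nil; apply: rootlat_eq; rewrite /= ?subrr.
    - move=> h hs; apply: root_space_graded => // a b t e; exists [:: h].
        by move=> h'; rewrite inE => /eqP->.
      by rewrite big_seq1.
  move=> /(_ _ (borelc_tE (i := i) (j := j) gc fc _)); rewrite pi pj ltnSn.
  case/(_ isT) => _ /(_ _ _ _ (tE_loop _ _ _))[u us' eu].
  have hu : forall h, h \in u -> 1 <= ht (negpos c) h.
    by move=> h /us'/sroot[a [b [ab ->]]]; rewrite ht_rt /negpos; lia.
  have : ht (negpos c) (rt i j 0) = 1 by rewrite ht_rt /negpos pi pj; lia.
  rewrite eu ht_sum; case: u us' hu eu => [|h [|h' u]] us' hu eu.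
  - by rewrite big_nil.
  - by move=> _; rewrite big_seq1; apply: us'; rewrite mem_head.
  - rewrite !big_cons big_seq_cond => e.
    have h1 := hu h (mem_head _ _); have h2 : 1 <= ht (negpos c) h'.
      by apply: hu; rewrite !inE eqxx orbT.
    have : 0 <= \sum_(g <- u | (g \in u) && true) ht (negpos c) g.
      apply: sumr_ge0 => g1 /andP[gu _]; apply: le_trans (hu g1 _) => //.
      by rewrite !inE gu !orbT.
    move: e h1 h2; move: (ht _ h) (ht _ h') (\sum_(g1 <- u | _) _) => a b d.
    by move=> e h1 h2 d0; exfalso; lia.
move=> g; apply/idP/idP; last exact: sub.
move=> gs; have [i [j [ij eg]]] := sroot g gs.
pose u := [seq beta c q | q <- iota (pos c i) (pos c j - pos c i)].
have pj := pos_lt N_gt1 gc j.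
have usub h : h \in u -> h \in simple c.
  move=> /mapP[q]; rewrite mem_iota => qq ->; apply/mem_simple; exists q => //; lia.
have uu : uniq u.
  rewrite map_inj_in_uniq ?iota_uniq // => p q; rewrite !mem_iota => pp qq e.
  by apply: (beta_inj N_gt1 gc); rewrite ?e //; lia.
have su : \sum_(h <- u) h = g.
  rewrite big_map -/(index_iota _ _) big_nat (eq_bigr (fun q =>
    - (lett c q.+1 - lett c q))) => [|q qq].
    rewrite -big_nat sumrN telescope_sumr ?opprB; last exact: ltnW.
    rewrite eg; apply: rootlat_eq; rewrite /= ?posK // !fc ?pos_lt //.
  by rewrite opprB beta_lett //; lia.
(* [g] is the sum over [u], a linear relation on [s] whose coefficient at [g] is 1 unless [g]
   belongs to [u]. *)
pose y h : int := (h == g)%:R - (h \in u)%:R.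
have : \sum_(h <- s) h *~ y h = 0.
  under eq_bigr => h _ do rewrite /y mulrzBr.
  rewrite sumrB (bigD1_seq g) //= eqxx big1 => [|h /negPf->]; last by rewrite mulr0z.
  rewrite (bigID (mem u)) /= [X in _ - (_ + X)]big1 => [|h /negPf->];
    last by rewrite mulr0z.
  rewrite -big_filter (eq_big_seq id) => [|h]; last by rewrite mem_filter => /andP[->].
  rewrite (perm_big u) /= ?su ?addr0 ?subrr //.
  apply: uniq_perm => //; first exact: filter_uniq.
  by move=> h; rewrite mem_filter; case: (boolP (h \in u)) => //= /usub/sub.
move=> /ls/(_ g gs); rewrite /y eqxx; case: (boolP (g \in u)) => // /usub.
by [].
Qed.

Lemma simple_letters c c' : good c -> flat c -> good c' -> flat c' -> simple c =i
  simple c' ->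
  forall q, (q < N)%N -> (c q).1 = (c' q).1.
Proof.
move=> gc fc gc' fc' e; have step q : (q.+1 < N)%N -> pos c' (c q.+1).1 = (pos c' (c
  q).1).+1.
  move=> qN; have : beta c q \in simple c by apply/mem_simple; exists q.
  rewrite e => /mem_simple[p pN]; rewrite !simple_flat //.
  have ne : (c q).1 != (c q.+1).1 by apply/eqP => /gc; lia.
  by move=> /(rt_inj ne)[-> -> _]; rewrite !posE // ltnW.
have st q : (q < N)%N -> pos c' (c q).1 = (pos c' (c 0%N).1 + q)%N.
  by elim: q => [|q IH] qN; rewrite ?addn0 // step // IH ?addnS // ltnW.
(* The [N] letters of [c] occupy consecutive positions of [c'], so the first of them must be at
   position 0. *)
have p0 : pos c' (c 0%N).1 = 0%N.
  have := st N.-1; have := pos_lt N_gt1 gc' (c N.-1).1; lia.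
by move=> q qN; rewrite -[RHS](posK N_gt1 gc') posE // -{2}[q]add0n -p0 -st // posK.
Qed.

End FiniteBorels.

(** * Letters of a word *)

Lemma addn_gt1 n m : (0 < n)%N -> (0 < m)%N -> (1 < n + m)%N.
Proof. by lia. Qed.

Section Letters.
Context {n m : nat}.
Local Notation N := (n + m)%N.
Lemma modz_lt (p : nat) (z : int) : (0 < p)%N -> (absz (modz z p%:Z) < p)%N.
Proof. by move=> p0; have := @ltz_pmod z p%:Z; have := @modz_ge0 z p%:Z; lia. Qed.

Definition period (x : bool) : nat := if x then n else m.

Definition before (w : seq bool) (q : nat) : nat :=
  count (pred1 (nth false w q)) (take q w).

Lemma shuffle_ofE w a b q : (q < size w)%N -> nth 0%N (@shuffle_of n a b w) q =
  if nth false w q then (a + before w q)%N else (n + (b + before w q))%N.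
Proof.
rewrite /before; elim: w a b q => // x w IH a b [|q] qw /=.
  by case: (x); rewrite /= addn0.
by case: (x); rewrite /= IH //; case: (nth false w q) => /=; lia.
Qed.

Section Before.
Context (w : seq bool).
Hypothesis ww : is_word n m w.

Lemma before_lt q : (q < N)%N -> (before w q < period (nth false w q))%N.
Proof.
rewrite -(size_word ww) => qw.
rewrite /before; set x := nth false w q.
have -> : period x = count_mem x w.
  case/andP: (ww) => /eqP wn /eqP wm; case: (x).
    by rewrite /= -[LHS]wn; apply: eq_count => -[].
  by rewrite /= -[LHS]wm; apply: eq_count => -[].
rewrite -[w in X in (_ < X)%N](cat_take_drop q) (drop_nth false qw) count_cat.
by rewrite -/x /= eqxx; lia.
Qed.

Lemma before_inj p q : (p < N)%N -> (q < N)%N -> nth false w p = nth false w q ->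
  before w p = before w q -> p = q.
Proof.
rewrite -(size_word ww).
wlog pq : p q / (p < q)%N => [H pw qw e be|pw qw e].
  by case: (ltngtP p q) => // pq; [apply: H|apply/esym/H].
rewrite /before e -(cat_take_drop p (take q w)) count_cat take_takel; last exact: ltnW.
rewrite (drop_nth false); last by rewrite size_take qw.
by rewrite nth_take // e /= eqxx; lia.
Qed.

End Before.

Hypotheses (n_gt0 : (0 < n)%N) (m_gt0 : (0 < m)%N).
Local Notation nxt := (@nxt n m).
Local Open Scope classical_set_scope.

Let N_gt1 : (1 < N)%N := addn_gt1 n_gt0 m_gt0.

(** [letter true z] is [eps_z] and [letter false z] is [delta_z], extended to
   all integers [z] by [eps_(z + n) = eps_z - imag] and
   [delta_(z + m) = delta_z - imag]; [(i, t)] encodes [e_i - t imag]. *)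
Definition letter (x : bool) (z : int) : 'I_N * int :=
  if x then (lshift m (Ordinal (modz_lt z n_gt0)), divz z n%:Z)
  else (rshift n (Ordinal (modz_lt z m_gt0)), divz z m%:Z).

Lemma letter_type x y z z' : (letter x z).1 = (letter y z').1 -> x = y.
Proof. by have := modz_lt z n_gt0; have := modz_lt z' n_gt0;
  case: x; case: y => //= ? ? /(congr1 val) /=; lia. Qed.

Lemma letter_mod x z z' : (letter x z).1 = (letter x z').1 ->
  modz z (period x) = modz z' (period x).
Proof.
have := @modz_ge0 z (period x); have := @modz_ge0 z' (period x).
by case: x => /= h1 h2 /(congr1 val) /=; lia.
Qed.

Lemma letter_inj x y z z' : letter x z = letter y z' -> x = y /\ z = z'.
Proof.
move=> e; have xy := letter_type (congr1 fst e); subst y; split=> //.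
rewrite (divz_eq z (period x)) (divz_eq z' (period x)) (letter_mod (congr1 fst e)).
by have := congr1 snd e; case: x {e} => /= ->.
Qed.

Lemma letter_shift x z (k : int) :
  letter x (z + k * (period x)%:Z) = ((letter x z).1, (letter x z).2 + k).
Proof.
have n0 : n%:Z != 0 by lia.
have m0 : m%:Z != 0 by lia.
case: x; rewrite /letter /period addrC divzMDl // [k + _]addrC; congr (_, _).
  by congr (lshift _ _); apply: val_inj; rewrite /= modzMDl.
by congr (rshift _ _); apply: val_inj; rewrite /= modzMDl.
Qed.

Fixpoint letters (a b : int) (w : seq bool) : seq ('I_N * int) :=
  if w is x :: w' then
    letter x (if x then a else b) :: letters (a + (x : nat)%:Z) (b + (~~ x : nat)%:Z) w'
  else [::].

(** The letters of the word [w] when its rows are numbered from [a] and its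
    columns from [b]. *)
Definition cfg (w : seq bool) (a b : int) (q : nat) : 'I_N * int :=
  nth (letter true 0) (letters a b w) q.

Lemma letters_cat a b u v : letters a b (u ++ v) =
  letters a b u ++ letters (a + (count id u)%:Z) (b + (count negb u)%:Z) v.
Proof.
elim: u a b => [|x u IH] a b /=; first by rewrite !addr0.
by rewrite IH !PoszD !addrA.
Qed.

Lemma size_letters a b w : size (letters a b w) = size w.
Proof. by elim: w a b => //= x w IH a b; rewrite IH. Qed.

Lemma cfgE w a b q : (q < size w)%N ->
  cfg w a b q = letter (nth false w q)
    ((if nth false w q then a else b) + (before w q)%:Z).
Proof.
rewrite /cfg /before; elim: w a b q => // x w IH a b [|q] qw /=.
  by rewrite addr0.
rewrite IH // PoszD addrA; congr letter; congr (_ + _).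
by case: (nth false w q); case: (x).
Qed.

Section Word.
Context (w : seq bool).
Hypothesis ww : is_word n m w.

(** Letters of one kind carry consecutive integers, as many as their period, so their residues are
    distinct. *)
Lemma good_cfg a b : good (cfg w a b).
Proof.
move=> p q pN qN; have pw : (p < size w)%N by rewrite (size_word ww).
have qw : (q < size w)%N by rewrite (size_word ww).
rewrite !cfgE // => e; have xe := letter_type e.
apply: (before_inj ww) => //; move: e; rewrite -xe => /letter_mod /eqP.
have := before_lt ww pN; have := before_lt ww qN; rewrite -xe.
by move=> h1 h2; rewrite eqz_modDl !modz_nat !modn_small // => /eqP[].
Qed.

Lemma flat_cfg : flat (cfg w 0 0).
Proof.
move=> q qN; rewrite cfgE ?(size_word ww) // if_same add0r.
by have := before_lt ww qN; case: (nth false w q) => /= ?; rewrite divz_nat divn_small.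
Qed.

Lemma cfg_shift a b k q : (q < N)%N ->
  cfg w (a + k * n%:Z) (b + k * m%:Z) q = ((cfg w a b q).1, (cfg w a b q).2 + k).
Proof.
move=> qN; rewrite !cfgE ?(size_word ww) // -letter_shift.
by case: (nth false w q); rewrite /= addrAC.
Qed.

End Word.

Lemma basis_root_ord (i : 'I_N) : basis_root i = (delta_mx 0 i, 0) :> rootlat n m.
Proof. by apply: rootlat_eq => //=; apply/rowP => j; rewrite !mxE. Qed.

Lemma fin_simple_parts w : is_word n m w ->
  fin_simple (parts w) = simple (cfg w 0 0) :> seq (rootlat n m).
Proof.
move=> ww; have be q : (q < N)%N ->
    basis_root (nth 0%N (@shuffle n m (parts w)) q) = lett (cfg w 0 0) q.
  move=> qN; rewrite /lett flat_cfg // oppr0 -basis_root_ord /shuffle (word_parts ww).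
  congr basis_root; rewrite shuffle_ofE ?(size_word ww) // cfgE ?(size_word ww) //.
  rewrite if_same !add0n add0r.
  have := before_lt ww qN; by case: (nth false w q) => /= ?;
    rewrite modz_nat modn_small.
apply: (@eq_from_nth _ 0) => [|p]; rewrite !size_mkseq // => pr.
rewrite !nth_mkseq // beta_lett; last by move: pr; rewrite /rk; lia.
by rewrite !be //; move: pr; rewrite /rk; lia.
Qed.

Implicit Types c : nat -> 'I_N * int.

Lemma eq_beta c c' : (forall q, (q < N)%N -> c q = c' q) ->
  forall q, (q < N)%N -> beta c q = beta c' q.
Proof. by move=> e q qN; rewrite /beta /wt !e ?nxt_lt. Qed.

Lemma eq_simple c c' : (forall q, (q < N)%N -> beta c q = beta c' q) -> simple c =
  simple c'.
Proof.
move=> e; apply/eq_in_map => q; rewrite mem_iota => qq; apply: e; lia.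
Qed.

Lemma beta_shift c c' k : (forall q, (q < N)%N -> c' q = ((c q).1, (c q).2 + k)) ->
  forall q, (q < N)%N -> beta c' q = beta c q.
Proof.
move=> e q qN; rewrite /beta /wt !e ?nxt_lt //=; congr rt; ring.
Qed.

(** The two letters are of different kinds and advance different counters, so exchanging them
    renumbers nothing. *)
Lemma swap_cfg u x y v a b : x != y -> size (u ++ x :: y :: v) = N -> forall q,
  (q < N)%N ->
  cfg (u ++ y :: x :: v) a b q = (cfg (u ++ x :: y :: v) a b \o swp (size u)) q.
Proof.
move=> xy sN q qN; rewrite /cfg /= !letters_cat !nth_cat !size_letters /swp.
case: (ltngtP q (size u)) => [qu|uq|->].
- by rewrite (ltn_eqF (leqW qu)) qu.
- have [->|q1] := eqVneq q (size u).+1.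
    by rewrite ltnn subnn subSnn /=; case: (x) (y) xy => -[] // _; rewrite /= ?addr0.
  have [k ->] : exists k, q = (size u + k.+2)%N by exists (q - size u - 2)%N; lia.
  rewrite ltnNge leq_addr addKn /=; congr nth.
  by congr letters; case: (x) (y) xy => -[] // _; rewrite /= ?addr0.
- by rewrite ltnNge leqnSn /= subnn subSnn /=; case: (x) (y) xy => -[] // _;
  rewrite /= ?addr0.
Qed.

(** The periodic continuation of [c] read one letter later. *)
Definition rotc c (q : nat) : 'I_N * int :=
  if (q.+1 < N)%N then c q.+1 else ((c 0%N).1, (c 0%N).2 + 1).

Lemma beta_rotc c q : (q < N)%N -> beta (rotc c) q = beta c (nxt q).
Proof.
move=> qN; rewrite /beta /wt /rotc /nxt.
case: (ltngtP q.+1 N) => qN1; [|by lia|].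
  case: (ltngtP q.+2 N) => q2; [|by lia|].
    by congr rt; ring.
  by congr rt; rewrite -[true%:R]/(1 : int) -[false%:R]/(0 : int) /=; ring.
have -> : (1%N == N) = false by lia.
by rewrite N_gt1; congr rt; rewrite -[true%:R]/(1 : int) -[false%:R]/(0 : int) /=; ring.
Qed.

(** The letter moved to the end receives its old number plus one full period, and by [letter_shift]
    this is the old letter minus [imag]. *)
Lemma rot_cfg x w a b q : is_word n m (x :: w) -> (q < N)%N ->
  cfg (rcons w x) (a + (x : nat)%:Z) (b + (~~ x : nat)%:Z) q = rotc (cfg (x :: w) a b)
    q.
Proof.
move=> ww qN; have sw : (size w).+1 = N := size_word ww.
rewrite /rotc /cfg -cats1 letters_cat nth_cat size_letters /=.
case: (ltngtP q.+1 N) => qN1; [|by lia|]; first by have -> : (q < size w)%N by lia.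
have -> : q = size w by lia.
rewrite ltnn subnn /= -[RHS]letter_shift; congr letter.
case/andP: ww => /eqP /= wn /eqP /= wm.
by case: x wn wm => /= wn wm; rewrite ?addr0; lia.
Qed.

Lemma simples_rotc c : simples (rotc c) = simples c.
Proof.
apply/seteqP; split=> g [q qN ->].
  by exists (nxt q); [exact: nxt_lt|rewrite beta_rotc].
have [q0|q0] := posnP q.
  exists N.-1; rewrite ?beta_rotc; try lia.
  by rewrite q0 /nxt prednK ?ltnn //; lia.
exists q.-1; rewrite ?beta_rotc; try lia.
by rewrite /nxt prednK // qN.
Qed.

(** The list operations of [aff_simple] are the two directions of a rotation: this one reads the
    period one letter later, [simple_of_rotc] undoes it. *)
Lemma simple_rotc c : simple (rotc c) = rcons (behead (simple c)) (ext_root (simple c)).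
Proof.
rewrite ext_root_simple //; apply: (@eq_from_nth _ 0) => [|q].
  by rewrite size_rcons size_behead !size_mkseq; lia.
rewrite size_mkseq => qN; rewrite nth_mkseq // beta_rotc; last by lia.
rewrite nth_rcons size_behead size_mkseq nth_behead /nxt.
case: (ltngtP q N.-2) => qq; [|by lia|].
  by rewrite nth_mkseq; [have -> : (q.+1 < N)%N by lia|lia].
have -> : (q.+1 < N)%N by lia.
by congr beta; lia.
Qed.

Lemma simple_of_rotc c : simple c = belast (ext_root (simple (rotc c))) (simple (rotc
  c)).
Proof.
rewrite ext_root_simple //; apply: (@eq_from_nth _ 0) => [|q].
  by rewrite size_belast !size_mkseq.
rewrite size_mkseq => qN; rewrite nth_mkseq //.
have -> (e : rootlat n m) s : (q < size s)%N -> nth 0 (belast e s) q = nth 0 (e :: s) q.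
  by move=> qs; rewrite lastI nth_rcons size_belast qs.
  case: q qN => [|q] qN /=; rewrite ?nth_mkseq ?beta_rotc; try lia.
    by rewrite /nxt prednK ?ltnn //; lia.
  by rewrite /nxt; have -> : (q.+1 < N)%N by lia.
by rewrite size_mkseq.
Qed.

(** A letter starts exactly one simple root, whose other end is the next letter, including its
    multiple of [imag]. Equality at 0 removes the ambiguity of rotation and shift. *)
Lemma simples_letters c c' : good c -> good c' -> simples c = simples c' -> c 0%N = c'
  0%N ->
  forall q, (q < N)%N -> c q = c' q.
Proof.
move=> gc gc' e e0; elim=> // q IH qN; have qN' := ltnW qN.
have : simples c (beta c q) by exists q.
rewrite e => -[p pN]; have nq : nxt q = q.+1 by rewrite /nxt qN.
move/(rt_inj (start_neq_end N_gt1 gc qN')) => []; rewrite IH // => /gc' pq.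
rewrite -pq // /wt nq IH // => e1 /(addIr _) /(addIr _) e2.
by case: (c q.+1) (c' q.+1) e1 e2 => a b [a' b'] /= -> ->.
Qed.

End Letters.

Arguments good_cfg {n m} n_gt0 m_gt0 {w} ww a b.
Arguments flat_cfg {n m} n_gt0 m_gt0 {w} ww.

(** * The lists of simple roots of the affine Borel subalgebras *)

Section AffSimple.
Context {K : closedFieldType} {n m : nat}.
Local Notation N := (n + m)%N.
Hypothesis charK : [pchar K] =i pred0.
Hypotheses (n_gt0 : (0 < n)%N) (m_gt0 : (0 < m)%N).
Local Open Scope classical_set_scope.
Local Notation letter := (letter n_gt0 m_gt0).
Local Notation cfg := (cfg n_gt0 m_gt0).
Local Notation aff_simple := (aff_simple K n m).

Let N_gt1 : (1 < N)%N := addn_gt1 n_gt0 m_gt0.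

(** The integer [k] for which the Borel subalgebra of [(lambda, k)] has the
    letters of the word of [lambda] numbered from [a] and [b]. It determines
    [(a, b)] up to multiples of [(n, m)], which change the letters by multiples
    of [imag] only. *)
Definition level (a b : int) : int := b * n%:Z - a * m%:Z.

Lemma is_word_rcons x w : is_word n m (rcons w x) = is_word n m (x :: w).
Proof. by apply: is_word_perm; rewrite perm_rcons. Qed.

Lemma simple_rot x w a b : is_word n m (x :: w) ->
  simple (cfg (rcons w x) (a + (x : nat)%:Z) (b + (~~ x : nat)%:Z)) =
  simple (rotc (cfg (x :: w) a b)).
Proof.
move=> ww; apply: eq_simple => //; apply: eq_beta => // q qN.
by rewrite (rot_cfg n_gt0 m_gt0).
Qed.

Lemma swaps_split p w w' : (p.+1 < size w)%N -> size w' = size w -> swaps p w w' ->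
  exists u x y v, [/\ w = u ++ x :: y :: v, w' = u ++ y :: x :: v, x != y & size u = p].
Proof.
move=> pw sw [xy e1 e2 e3].
exists (take p w), (nth false w p), (nth false w p.+1), (drop p.+2 w); split=> //.
- by rewrite -!drop_nth ?cat_take_drop // ltnW.
- apply: (@eq_from_nth _ false) => [|q qw'].
    by rewrite sw size_cat /= size_take size_drop (ltnW pw); lia.
  rewrite nth_cat size_take (ltnW pw).
  case: (ltngtP q p) => [qp|pq|->]; last by rewrite subnn.
    by rewrite nth_take // e3 ?(ltn_eqF qp) // (ltn_eqF (leqW qp)).
  have [->|q1] := eqVneq q p.+1; first by rewrite subSnn.
  rewrite e3 // ?(gtn_eqF pq) //.
  have [k ->] : exists k, q = (p + k.+2)%N by exists (q - p - 2)%N; lia.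
  by rewrite addKn /= nth_drop; congr nth; lia.
- by rewrite size_take (ltnW pw).
Qed.

Lemma reflect_simple u x y v a b : is_word n m (u ++ x :: y :: v) -> x != y ->
  let c := cfg (u ++ x :: y :: v) a b in let c' := cfg (u ++ y :: x :: v) a b in
  forall q, (q < N)%N -> reflect_root (K := K) (beta c (size u)) (beta c q) = beta c' q.
Proof.
move=> ww xy c c' q qN; have sw := size_word ww.
rewrite (reflect_beta charK) //; last 2 first.
- exact: good_cfg.
- by rewrite -sw size_cat /=; lia.
by apply: eq_beta => // q' qN'; rewrite -(swap_cfg n_gt0 m_gt0).
Qed.

Lemma map_reflect_simple u x y v a b : is_word n m (u ++ x :: y :: v) -> x != y ->
  map (reflect_root (K := K) (beta (cfg (u ++ x :: y :: v) a b) (size u)))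
     (simple (cfg (u ++ x :: y :: v) a b)) =
  simple (cfg (u ++ y :: x :: v) a b).
Proof.
move=> ww xy; rewrite -map_comp; apply/eq_in_map => q; rewrite mem_iota => qN /=.
by apply: (reflect_simple a b ww xy); lia.
Qed.

(** Induction on the derivation: a row or column move changes one counter by 1, hence the level by
    [m] or [n], while an odd reflection keeps both counters. *)
Lemma aff_simple_sound l k s : aff_simple l k s -> is_partition n m l /\
  exists a b, k = level a b /\ s = simple (cfg (@word m l) a b).
Proof.
elim=> {l k s}.
- move=> l lp; split=> //; exists 0, 0; split; first by rewrite /level !mul0r.
  by have [ww {1}<-] := partition_word lp; rewrite fin_simple_parts.
- move=> l k s lp rf _ [_ [a [b [-> ->]]]].
  have [w ww ->] := r_fullP n_gt0 lp rf; have ww' := ww; rewrite is_word_rcons in ww'.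
  rewrite minus_r_parts; split; first exact: is_partition_parts.
  exists (a - 1), b; split; first by rewrite /level; ring.
  rewrite (word_parts ww) (word_parts ww').
  by have := simple_rot (a - 1) b ww'; rewrite subrK addr0 => ->;
    rewrite -simple_of_rotc.
- move=> l k s lp rf _ [_ [a [b [-> ->]]]].
  have [w ww ->] := c_emptyP n_gt0 lp rf; have ww' := ww; rewrite is_word_rcons in ww'.
  rewrite plus_c_parts; split; first exact: is_partition_parts.
  exists a, (b - 1); split; first by rewrite /level; ring.
  rewrite (word_parts ww) (word_parts ww').
  by have := simple_rot a (b - 1) ww'; rewrite subrK addr0 => ->;
    rewrite -simple_of_rotc.
- move=> l k s lp rf _ [_ [a [b [-> ->]]]].
  have [w ww ->] := r_emptyP n_gt0 lp rf; have ww' := ww; rewrite -is_word_rcons in ww'.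
  rewrite plus_r_parts //; split; first exact: is_partition_parts.
  exists (a + 1), b; split; first by rewrite /level; ring.
  rewrite (word_parts ww) (word_parts ww').
  by have := simple_rot a b ww; rewrite addr0 simple_rotc // => ->.
- move=> l k s lp rf _ [_ [a [b [-> ->]]]].
  have [w ww ->] := c_fullP m_gt0 lp rf; have ww' := ww; rewrite -is_word_rcons in ww'.
  rewrite minus_c_parts; split; first exact: is_partition_parts.
  exists a, (b + 1); split; first by rewrite /level; ring.
  rewrite (word_parts ww) (word_parts ww').
  by have := simple_rot a b ww; rewrite addr0 simple_rotc // => ->.
- move=> l l' k s g p tl pr sw _ [lp [a [b [-> ->]]]].
  have lp' : is_partition n m l' by move: tl; rewrite /t_rel; case: ifP => _ [].
  split=> //; exists a, b; split=> //.
  have [ww _] := partition_word lp; have [ww' _] := partition_word lp'.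
  have pN : (p.+1 < N)%N by move: pr; rewrite /rk; lia.
  have := swaps_split _ _ sw; rewrite (size_word ww) (size_word ww').
  case=> // u [x [y [v [e e' xy up]]]]; rewrite e in ww *; rewrite e' -up in pN *.
  rewrite nth_mkseq; last by lia.
  exact: map_reflect_simple.
Qed.

Lemma swap_t_rel u x y v : is_word n m (u ++ x :: y :: v) -> x != y ->
  exists a : isoroot n m, t_rel a (parts (u ++ x :: y :: v)) (parts (u ++ y :: x :: v)).
Proof.
move=> ww xy; have ww' := ww; rewrite (is_word_perm _ _ (perm_swap_adjacent u x y v))
  in ww'.
have [ui uj] : (count id u < n)%N /\ (count negb u < m)%N.
  case/andP: ww => /eqP <- /eqP <-; rewrite !count_cat /=.
  by case: (x) (y) xy => -[] //=; lia.
case: (x) (y) xy ww ww' => -[] // _ ww ww'.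
  exists (Ordinal ui, Ordinal uj, true); exact: adds_box_parts.
exists (Ordinal ui, Ordinal uj, false); exact: adds_box_parts.
Qed.

Lemma swaps_parts u x y v : x != y ->
  swaps (size u) (u ++ x :: y :: v) (u ++ y :: x :: v).
Proof.
have nth0 z z' : nth false (u ++ z :: z' :: v) (size u) = z.
  by rewrite nth_cat ltnn subnn.
have nth1 z z' : nth false (u ++ z :: z' :: v) (size u).+1 = z'.
  by rewrite nth_cat ltnNge leqnSn subSnn.
move=> xy; split; rewrite ?nth0 ?nth1 //.
move=> q q0 q1; rewrite !nth_cat; case: (ltngtP q (size u)) => // [qu|qu].
  have [k ->] : exists k, q = (size u + k.+2)%N by exists (q - size u - 2)%N; lia.
  by rewrite addKn.
by rewrite qu eqxx in q0.
Qed.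

Lemma aff_simple_swap u x y v k s : is_word n m (u ++ x :: y :: v) -> x != y ->
  aff_simple (parts (u ++ x :: y :: v)) k s ->
  aff_simple (parts (u ++ y :: x :: v)) k (map (reflect_root (K := K) (nth 0 s (size
    u))) s).
Proof.
move=> ww xy; have [a ta] := swap_t_rel ww xy.
have ww' := ww; rewrite (is_word_perm _ _ (perm_swap_adjacent u x y v)) in ww'.
apply: as_odd ta _ _.
  by have := size_word ww; rewrite /rk size_cat /=; lia.
by rewrite (word_parts ww) (word_parts ww'); apply: swaps_parts.
Qed.

Lemma is_word_perm_eq w w' : is_word n m w -> is_word n m w' -> perm_eq w w'.
Proof.
move=> /andP[/eqP w1 /eqP w2] /andP[/eqP w3 /eqP w4]; apply/permP => a.
have cE (s : seq bool) : count a s = (a true * count id s + a false * count negb s)%N.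
  by elim: s => [|[] s IH] /=; rewrite ?muln0 ?IH //; lia.
by rewrite !cE w1 w2 w3 w4.
Qed.

Definition has_aff k w : Prop := exists s, aff_simple (parts w) k s.

(** At fixed [k] odd reflections realise every exchange of two distinct adjacent letters. *)
Lemma has_aff_all k w w' : is_word n m w -> has_aff k w -> is_word n m w' -> has_aff k
  w'.
Proof.
move=> ww aw ww'; suff [] : is_word n m w' /\ has_aff k w' by [].
apply: (perm_eq_adjacent_ind (P := fun w => is_word n m w /\ has_aff k w)) (conj ww aw).
  move=> u x y v [wu [s su]]; have [exy|xy] := eqVneq x y; first by subst y; split;
    [|exists s].
  rewrite -(is_word_perm _ _ (perm_swap_adjacent u x y v)); split=> //.
  by eexists; apply: aff_simple_swap su.
exact: is_word_perm_eq.
Qed.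

(** Each move needs a particular first or last letter. Both letters occur in every word, so by
    [has_aff_all] one may pass to a word to which the move applies. *)
Lemma has_aff_step k : (forall w, is_word n m w -> has_aff k w) ->
  forall w, is_word n m w ->
  [/\ has_aff (k + m%:Z) w, has_aff (k - m%:Z) w, has_aff (k + n%:Z) w & has_aff (k -
    n%:Z) w].
Proof.
move=> ak w ww.
have ex x : x \in w -> exists2 w1, is_word n m (x :: w1) & is_word n m (rcons w1 x).
  move=> xw; exists (rem x w); last rewrite is_word_rcons;
  by rewrite -(is_word_perm _ _ (perm_to_rem xw)).
have cw : true \in w /\ false \in w.
  case/andP: (ww) => /eqP wn /eqP wm; split.
    by apply: contraT => tw; move: n_gt0; rewrite -wn -has_count =>
      /hasP[[]] // /(negP tw).
  by apply: contraT => tw; move: m_gt0; rewrite -wm -has_count =>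
    /hasP[[]] // /(negP tw).
have [w1 wt wt'] := ex true cw.1; have [w2 wf wf'] := ex false cw.2.
split.
- apply: has_aff_all wt _ ww; have [s st] := ak _ wt'.
  rewrite /has_aff -minus_r_parts; eexists; apply: as_minus_r st;
    first exact: is_partition_parts.
  exact: r_full_parts wt'.
- apply: has_aff_all wt' _ ww; have [s st] := ak _ wt.
  rewrite /has_aff -(plus_r_parts wt); eexists; apply: as_plus_r st;
    first exact: is_partition_parts.
  exact: r_empty_parts wt.
- apply: has_aff_all wf' _ ww; have [s st] := ak _ wf.
  rewrite /has_aff -minus_c_parts; eexists; apply: as_minus_c st;
    first exact: is_partition_parts.
  exact: c_full_parts wf.
- apply: has_aff_all wf _ ww; have [s st] := ak _ wf'.
  rewrite /has_aff -plus_c_parts; eexists; apply: as_plus_c st;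
    first exact: is_partition_parts.
  exact: c_empty_parts wf'.
Qed.

Lemma int_closed (P : int -> Prop) (d : int) : (forall k, P k -> P (k + d)) ->
  (forall k, P k -> P (k - d)) -> forall k i, P k -> P (k + i * d).
Proof.
move=> Pp Pm k; have nat_closed e (j : nat) : (forall k,
  P k -> P (k + e)) -> P k -> P (k + j%:Z * e).
  move=> Pe Pk; elim: j => [|j IH]; first by rewrite mul0r addr0.
  by rewrite intS mulrDl mul1r addrCA addrC; apply: Pe.
case=> j Pk; first exact: nat_closed.
by rewrite NegzE mulNr -mulrN; apply: nat_closed.
Qed.

Hypothesis coprime_nm : coprime n m.

(** Bezout coefficients of [n] and [m], multiplied by [k]. *)
Lemma level_surj k : exists a b, k = level a b.
Proof.
have : coprimez n m by rewrite coprimezE.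
case/coprimezP => -[u v] /= uv; exists (- v * k), (u * k).
by rewrite /level -[LHS]mul1r -uv; ring.
Qed.

Lemma level_inj a b a' b' : level a b = level a' b' ->
  exists k, a' = a + k * n%:Z /\ b' = b + k * m%:Z.
Proof.
rewrite /level => e; have e1 : (b' - b) * n%:Z = (a' - a) * m%:Z.
  apply/eqP; rewrite -subr_eq0.
  have -> : (b' - b) * n%:Z - (a' - a) * m%:Z = (b' * n%:Z - a' * m%:Z) - (b * n%:Z - a
    * m%:Z).
    by ring.
  by rewrite e subrr.
have cop : coprimez n m by rewrite coprimezE.
have : (n %| (a' - a) * m)%Z by rewrite -e1 dvdz_mull.
rewrite Gauss_dvdzl // => /dvdzP[k ek]; exists k; split; first by rewrite -ek; ring.
have : (b' - b) * n%:Z = (k * m%:Z) * n%:Z by rewrite e1 ek; ring.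
by move/mulIf => /(_ _)/(canRL (subrK b)) ->; [ring|lia].
Qed.

Lemma simple_level w a b a' b' : is_word n m w -> level a b = level a' b' ->
  simple (cfg w a b) = simple (cfg w a' b').
Proof.
move=> ww /level_inj[k [-> ->]]; apply: eq_simple => // q qN; symmetry.
by apply: (@beta_shift _ _ n_gt0 m_gt0 _ _ k) qN => q' qN'; rewrite cfg_shift.
Qed.

Lemma aff_simple_eq l k s a b : aff_simple l k s -> k = level a b ->
  s = simple (cfg (@word m l) a b).
Proof.
case/aff_simple_sound => lp [a' [b' [-> ->]]] e; apply: simple_level => //.
by have [] := partition_word lp.
Qed.

Lemma aff_simple_unique l k s s' : aff_simple l k s -> aff_simple l k s' -> s = s'.
Proof.
move=> a1 a2; have [_ [a [b [e ->]]]] := aff_simple_sound a1.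
by rewrite (aff_simple_eq a2 e).
Qed.

Lemma aff_simple_exists l k : is_partition n m l -> exists s, aff_simple l k s.
Proof.
case/partsP => w ww ->; have [a [b ->]] := level_surj k.
pose P k := forall w, is_word n m w -> has_aff k w.
suff : P (level a b) by apply.
rewrite /level -[b * _]add0r -mulNr; apply: (int_closed (P := P)).
- by move=> k' /has_aff_step H w' /H[].
- by move=> k' /has_aff_step H w' /H[].
apply: (int_closed (P := P)).
- by move=> k' /has_aff_step H w' /H[].
- by move=> k' /has_aff_step H w' /H[].
by move=> w' ww'; eexists; apply: as_fin; apply: is_partition_parts.
Qed.

End AffSimple.

(** * The equivalence of pairs *)

Section Pairs.
Context {K : closedFieldType} {n m : nat}.
Local Notation N := (n + m)%N.
Hypothesis charK : [pchar K] =i pred0.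
Hypotheses (n_gt0 : (0 < n)%N) (m_gt0 : (0 < m)%N).
Local Open Scope classical_set_scope.
Local Notation letter := (letter n_gt0 m_gt0).
Local Notation cfg := (cfg n_gt0 m_gt0).
Local Notation aff_simple := (aff_simple K n m).
Local Notation borel_fin := (@borel_fin K n m).
Local Notation pair_equiv := (@pair_equiv K n m).
Local Notation level := (@level n m).

Let N_gt1 : (1 < N)%N := addn_gt1 n_gt0 m_gt0.

Lemma cfg_surj w a b i : is_word n m w -> exists2 q, (q < N)%N & (cfg w a b q).1 = i.
Proof.
move=> ww; have gc := good_cfg n_gt0 m_gt0 ww a b.
by exists (pos (cfg w a b) i); [exact: pos_lt|exact: posK].
Qed.

Lemma pair_equiv_rot x w a b : is_word n m (x :: w) ->
  pair_equiv (borel_fin (parts (x :: w)), level a b)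
    (borel_fin (parts (rcons w x)), level (a + (x : nat)%:Z) (b + (~~ x : nat)%:Z)).
Proof.
move=> ww; have ww' := ww; rewrite -is_word_rcons in ww'.
case: x ww ww' => ww ww'; rewrite /= addr0.
  (* Deleting a full row moves the last letter to the front, against the direction of this
     rotation. *)
  apply: pe_sym; rewrite -minus_r_parts.
  have -> : level a b = level (a + 1) b + m%:Z.
    by rewrite /level; ring.
  by apply: pe_row; [exact: is_partition_parts|exact: r_full_parts ww'].
rewrite -minus_c_parts.
have -> : level a (b + 1) = level a b + n%:Z.
  by rewrite /level; ring.
by apply: pe_col; [exact: is_partition_parts|exact: c_full_parts ww].
Qed.

Lemma simples_rot x w a b : is_word n m (x :: w) ->
  simples (cfg (rcons w x) (a + (x : nat)%:Z) (b + (~~ x : nat)%:Z)) = simples (cfg (x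
    :: w) a b).
Proof.
move=> ww; rewrite -[RHS](simples_rotc n_gt0 m_gt0).
by apply/seteqP; split=> g [q qN ->]; exists q => //; [|symmetry];
  apply: (eq_beta n_gt0 m_gt0) => // q' qN'; rewrite rot_cfg.
Qed.

(** Any chosen letter can be brought to the front inside the class of a pair, with the affine simple
    roots unchanged. *)
Lemma pair_equiv_rotate w a b q : is_word n m w -> (q < N)%N ->
  exists w' a' b', [/\ is_word n m w',
    pair_equiv (borel_fin (parts w), level a b)
               (borel_fin (parts w'), level a' b'),
    simples (cfg w' a' b') = simples (cfg w a b) &
    cfg w' a' b' 0 = cfg w a b q].
Proof.
elim: q w a b => [|q IH] w a b ww qN; first by exists w, a, b; split=> //;
  exact: pe_refl.
case: w ww => [|x w] ww; first by have := size_word ww; rewrite /=; lia.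
have ww' := ww; rewrite -is_word_rcons in ww'.
have [w' [a' [b' [w'w e1 e2 e3]]]] := IH _ (a + (x : nat)%:Z) (b + (~~ x : nat)%:Z) ww'
  (ltnW qN).
exists w', a', b'; split=> //.
- exact: pe_trans (pair_equiv_rot a b ww) e1.
- by rewrite e2 simples_rot.
- by rewrite e3 (rot_cfg n_gt0 m_gt0) // ?(ltnW qN) // /rotc qN.
Qed.

Lemma simples_pair_equiv w a b w' a' b' : is_word n m w -> is_word n m w' ->
  simples (cfg w a b) = simples (cfg w' a' b') ->
  pair_equiv (borel_fin (parts w), level a b)
             (borel_fin (parts w'), level a' b').
Proof.
move=> ww ww' e; have N0 : (0 < N)%N by lia.
have [q qN cq] := cfg_surj a b (cfg w' a' b' 0).1 ww.
have [w1 [a1 [b1 [ww1 pe e1 c1]]]] := pair_equiv_rotate a b ww qN.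
apply: pe_trans pe _; rewrite {}e -{}c1 in e1 cq; clear w a b ww q qN.
(* After the rotation the first letters agree up to [imag]; renumbering by [k] periods makes them
   equal and keeps the level. *)
pose k := (cfg w' a' b' 0).2 - (cfg w1 a1 b1 0).2.
pose a2 := a1 + k * n%:Z; pose b2 := b1 + k * m%:Z.
have c2 q : (q < N)%N -> cfg w1 a2 b2 q = ((cfg w1 a1 b1 q).1, (cfg w1 a1 b1 q).2 + k).
  by move=> qN; rewrite cfg_shift.
have eq_cfg q : (q < N)%N -> cfg w1 a2 b2 q = cfg w' a' b' q.
  apply: (simples_letters n_gt0 m_gt0); try exact: good_cfg.
    rewrite -e1; apply/seteqP; split=> g [q' qN' ->]; exists q' => //; [|symmetry];
    exact: (beta_shift n_gt0 m_gt0 c2).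
  by rewrite c2 // cq /k addrC subrK; case: (cfg w' a' b' 0).
have eqw : w1 = w'.
  apply: (@eq_from_nth _ false); first by rewrite (size_word ww1) (size_word ww').
  move=> q qw; have qN : (q < N)%N by rewrite -(size_word ww1).
  have := eq_cfg q qN; rewrite !cfgE ?(size_word ww1) ?(size_word ww') //.
  by case/letter_inj.
(* Both kinds of letters occur, so the letters determine both counters. *)
have ex x : exists2 q, (q < N)%N & nth false w' q = x.
  have : x \in w'.
    case/andP: ww' => /eqP wn /eqP wm; apply: contraT => xw.
    case: x xw => xw; [move: n_gt0; rewrite -wn|move: m_gt0; rewrite -wm];
      by rewrite -has_count => /hasP[[]] // /(negP xw).
  by move=> xw; exists (index x w'); rewrite ?nth_index // -(size_word ww') index_mem.
have ea : a2 = a'.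
  have [q qN xq] := ex true; have := eq_cfg q qN.
  by rewrite eqw !cfgE ?(size_word ww') // xq => /letter_inj[_ /addIr].
have eb : b2 = b'.
  have [q qN xq] := ex false; have := eq_cfg q qN.
  by rewrite eqw !cfgE ?(size_word ww') // xq => /letter_inj[_ /addIr].
rewrite eqw -ea -eb; have -> : level a2 b2 = level a1 b1.
  by rewrite /level /a2 /b2; ring.
exact: pe_refl.
Qed.

Lemma borel_fin_parts w : is_word n m w -> borel_fin (parts w) = borelc (cfg w 0 0).
Proof. by move=> ww; rewrite /Defs.borel_fin (fin_simple_parts n_gt0 m_gt0). Qed.

Lemma borel_fin_inj l l' : is_partition n m l -> is_partition n m l' ->
  borel_fin l = borel_fin l' -> l = l'.
Proof.
move=> /partsP[w ww ->] /partsP[w' ww' ->]; rewrite !borel_fin_parts // => e.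
have gc := good_cfg n_gt0 m_gt0 ww 0 0; have gc' := good_cfg n_gt0 m_gt0 ww' 0 0.
have fc := flat_cfg n_gt0 m_gt0 ww; have fc' := flat_cfg n_gt0 m_gt0 ww'.
have := borelc_has_simple_roots (K := K) N_gt1 gc; rewrite e.
move/(borelc_simple_roots_unique charK N_gt1 gc' fc').
move/(simple_letters N_gt1 gc fc gc' fc') => ec; congr parts.
apply: (@eq_from_nth _ false); first by rewrite (size_word ww) (size_word ww').
move=> q qw; have qN : (q < N)%N by rewrite -(size_word ww).
have := ec q qN; rewrite !cfgE ?(size_word ww) ?(size_word ww') //.
exact: letter_type.
Qed.

Lemma extension_pair_equiv l k s l' k' s' : aff_simple l k s -> aff_simple l' k' s' ->
  extension (K := K) s = extension s' -> pair_equiv (borel_fin l, k) (borel_fin l', k').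
Proof.
move=> h h' e; have [lp [a [b [-> es]]]] := aff_simple_sound charK n_gt0 m_gt0 h.
have [lp' [a' [b' [-> es']]]] := aff_simple_sound charK n_gt0 m_gt0 h'.
have [ww el] := partition_word lp; have [ww' el'] := partition_word lp'.
rewrite -el -el'; apply: simples_pair_equiv => //.
apply: (extension_simples charK N_gt1); try exact: good_cfg.
by rewrite -es -es'.
Qed.

Lemma pair_class_eq (b b' : set (Lamb K n m)) k k' :
  pair_class b k = pair_class b' k' <-> pair_equiv (b, k) (b', k').
Proof.
split=> [e|e]; first by have : pair_class b k (b', k') by rewrite e; exact: pe_refl.
by apply/seteqP; split=> p; [apply: pe_trans; apply: pe_sym|apply: pe_trans].
Qed.

Lemma par_letter x z : par (letter x z).1 = ~~ x.
Proof. by case: x; rewrite /par /= ?leq_addr // leqNgt modz_lt. Qed.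

Lemma before_mono w p q : (p <= q)%N -> nth false w p = nth false w q ->
  (before w p <= before w q)%N.
Proof.
move=> pq e; rewrite /before e -(subnKC pq) takeD count_cat; exact: leq_addr.
Qed.

Lemma cfg_shuffle w q : is_word n m w -> (q < N)%N ->
  val (cfg w 0 0 q).1 = nth 0%N (@shuffle_of n 0 0 w) q.
Proof.
move=> ww qN; rewrite shuffle_ofE ?(size_word ww) // cfgE ?(size_word ww) //.
rewrite if_same !add0n add0r.
by have := before_lt ww qN; case: (nth false w q) => /= ?; rewrite modz_nat modn_small.
Qed.

Lemma Borels_fin_parts w : is_word n m w -> Borels_fin (borel_fin (parts w)).
Proof.
move=> ww; have gc := good_cfg n_gt0 m_gt0 ww 0 0.
have fc := flat_cfg n_gt0 m_gt0 ww; have ni := negpos_inj N_gt1 gc.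
rewrite borel_fin_parts // (borelc_functional charK N_gt1 gc fc).
split; first by exists (negpos (cfg w 0 0)).
apply/(even_part charK ni) => i j pij ij; rewrite /negpos ltrN2 ltz_nat ltnNge.
set c := cfg w 0 0; apply/negP => ji.
have pi := pos_lt N_gt1 gc i; have pj := pos_lt N_gt1 gc j.
move: pij ij; rewrite -(posK N_gt1 gc i) -(posK N_gt1 gc j) -/c !cfg_shuffle // -/(pos
  c i) -/(pos c j).
rewrite {1 3}/c !cfgE ?(size_word ww) // !par_letter => /(can_inj negbK) xe.
have := before_mono ji (esym xe); rewrite !shuffle_ofE ?(size_word ww) // xe.
by case: (nth _ _ _); lia.
Qed.

(** A sequence whose entries below [n] and whose other entries each run through consecutive numbers
    is recovered from the kinds of its entries alone. *)
Lemma shuffle_of_filter a b k1 k2 (t : seq nat) : all (fun i => i < n + m)%N t ->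
  filter (fun i => i < n)%N t = iota a k1 -> filter (fun i =>
    n <= i)%N t = iota (n + b) k2 ->
  @shuffle_of n a b (map (fun i => i < n)%N t) = t.
Proof.
elim: t a b k1 k2 => //= i t IH a b k1 k2 /andP[iN tN].
case: (ltnP i n) => ni /=.
  by case: k1 => // k1 [-> e1] e2; rewrite (IH _ _ _ _ tN e1 e2).
case: k2 => // k2 e1 [-> e2]; rewrite -addnS in e2.
by rewrite (IH _ _ _ _ tN e1 e2).
Qed.

(** The indices are sorted by decreasing [f]. By [even_part] each parity keeps its natural order, so
    the sorted list is a shuffle, and the kinds of its entries form the word. *)
Lemma Borels_finP b : Borels_fin b <-> exists2 w, is_word n m w & b = borel_fin (parts
  w).
Proof.
split=> [[[f fi ->]]|[w ww ->]]; last exact: Borels_fin_parts.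
move/(even_part charK fi) => mono.
pose r (i j : 'I_N) := f j <= f i.
have rtr : transitive r by move=> j i k ij jk; apply: le_trans jk ij.
have rto : total r by move=> i j; rewrite /r le_total.
have ras : antisymmetric r.
  by move=> i j /andP[h1 h2]; apply: fi; apply: le_anti; apply/andP; split.
pose t := sort r (enum 'I_N).
have tp : perm_eq t (enum 'I_N) by rewrite perm_sort.
have ts : sorted r t by apply: sort_sorted.
have es : sorted ltn (map val (enum 'I_N)) by rewrite val_enum_ord iota_ltn_sorted.
rewrite sorted_map in es.
(* Within one parity the sorted list and the natural enumeration are both sorted for [r], hence
   equal. *)
have filterE (P : pred 'I_N) : (forall i j : 'I_N,
  P i -> P j -> par i = par j) -> filter P t = filter P (enum 'I_N).
  move=> Pp; apply: (sorted_eq rtr ras).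
  - by apply: sorted_filter.
  - apply: (sub_in_sorted (P := P) (e := relpre val ltn)).
    + by move=> i j Pi Pj ij; apply/ltW/mono => //; exact: Pp.
    + exact: filter_all.
    + by apply: sorted_filter => // i j k; apply: ltn_trans.
  - exact: perm_filter.
pose tn := map val t; pose w := map (fun i => i < n)%N tn.
have f1 : filter (fun i => i < n)%N tn = iota 0 n.
  rewrite filter_map filterE => [|i j /= h1 h2]; last by rewrite /par (leqNgt n i)
    (leqNgt n j) h1 h2.
  rewrite -filter_map val_enum_ord iotaD filter_cat add0n.
  rewrite (@eq_in_filter _ _ predT) => [|i]; last by rewrite mem_iota => /andP[_ ->].
  rewrite filter_predT (@eq_in_filter _ _ pred0) ?filter_pred0 ?cats0 // => i.
  by rewrite mem_iota => /andP[]; rewrite leqNgt => /negPf->.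
have f2 : filter (fun i => n <= i)%N tn = iota n m.
  rewrite filter_map filterE => [|i j /= h1 h2]; last by rewrite /par h1 h2.
  rewrite -filter_map val_enum_ord iotaD filter_cat add0n.
  rewrite (@eq_in_filter _ _ pred0) => [|i]; last by rewrite mem_iota add0n (leqNgt n)
    => /andP[_ ->].
  rewrite filter_pred0 (@eq_in_filter _ _ predT) ?filter_predT // => i.
  by rewrite mem_iota => /andP[-> _].
have ww : is_word n m w.
  apply/andP; split.
    rewrite -[X in _ == X](size_iota 0 n) -f1 size_filter {1}/w count_map.
    by apply/eqP/eq_count.
  rewrite -[X in _ == X](size_iota n m) -f2 size_filter {1}/w count_map.
  by apply/eqP/eq_count => i; rewrite /= -leqNgt.
have sh : @shuffle_of n 0 0 w = tn.
  apply: (@shuffle_of_filter 0 0 n m) => //; last by rewrite addn0.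
  by apply/allP => i /mapP[j _ ->]; exact: ltn_ord.
exists w => //; set c := cfg w 0 0.
have gc := good_cfg n_gt0 m_gt0 ww 0 0; have fc := flat_cfg n_gt0 m_gt0 ww.
have st : size t = N by rewrite (perm_size tp) size_enum_ord.
have ut : uniq t by rewrite (perm_uniq tp) enum_uniq.
have pos_t i : pos c i = index i t.
  have it : i \in t by rewrite (perm_mem tp) mem_enum.
  have iN : (index i t < N)%N by rewrite -[X in (_ < X)%N]st index_mem.
  rewrite -(posE N_gt1 gc iN); congr pos; apply: val_inj.
  rewrite /c cfg_shuffle // sh (nth_map i) ?st // nth_index //.
have ni := negpos_inj N_gt1 gc.
rewrite borel_fin_parts // (borelc_functional charK N_gt1 gc fc).
(* Only the order induced by a functional matters: both subalgebras consist of the triangular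
   matrices for the same order. *)
have rE i j : (negpos c j <= negpos c i) = (f j <= f i).
  rewrite /negpos lerN2 lez_nat !pos_t; apply/idP/idP.
    apply: (sorted_leq_index rtr) => //; first by move=> k; rewrite /r lexx.
      by rewrite (perm_mem tp) mem_enum.
    by rewrite (perm_mem tp) mem_enum.
  rewrite -[(index _ _ <= _)%N]negbK -ltnNge => fji; apply/negP => ji.
  have : r j i.
    apply: (sorted_leq_index rtr _ ts); rewrite ?(perm_mem tp) ?mem_enum //.
      by move=> k; rewrite /r lexx.
    exact: ltnW.
  move=> fij; have e : i = j by apply: ras; apply/andP.
  by rewrite e ltnn in ji.
apply/seteqP; split=> x /(functional_Tri charK)[[A A0 ->] Ax];
  apply: Tri_functional => // i j Aij;
  have [] := Ax 0 i j; rewrite ?loop_fin ?eqxx // => _; by rewrite rE.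
Qed.

(** The effect of [twist i j] on the number of a row ([x = true]) or of a column. *)
Definition shiftz (i j : int) (x : bool) : int := if x then j else - i.

Definition idx (a : isoroot n m) (x : bool) : int := if x then (a.1.1 : nat)%:Z else
  (a.1.2 : nat)%:Z.

Lemma twistE i j (a : isoroot n m) : twist i j a =
  rt (letter a.2 (idx a a.2 + shiftz i j a.2)).1
     (letter (~~ a.2) (idx a (~~ a.2) + shiftz i j (~~ a.2))).1 0.
Proof.
have e1 z : eps (absz (modz z n)) = (delta_mx 0 (letter true z).1, 0) :> rootlat n m.
  by rewrite -basis_root_ord.
have e2 z : dlt (absz (modz z m)) = (delta_mx 0 (letter false z).1, 0) :> rootlat n m.
  by rewrite -basis_root_ord.
case: a => -[x y] [] /=; rewrite /twist /cyc e1 e2; apply: rootlat_eq => //=.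
by rewrite opprB.
Qed.

Lemma letter_eqmod x z z' : modz z (@period n m x) = modz z' (@period n m x) ->
  (letter x z).1 = (letter x z').1.
Proof.
by case: x => /= e; [congr lshift|congr rshift]; apply: val_inj; rewrite /= e.
Qed.

(** The local name [eta^i nu^j a] means that the simple root itself is congruent
    to [a] modulo [imag]. *)
Lemma beta_of_local_name w p i j a : is_word n m w -> (p.+1 < N)%N ->
  beta (cfg w 0 0) p = twist i j a ->
  [/\ nth false w p = a.2, nth false w p.+1 = ~~ a.2 &
     (beta (cfg w (- j) i) p).1 =
     (rt (letter a.2 (idx a a.2)).1 (letter (~~ a.2) (idx a (~~ a.2))).1 0).1].
Proof.
move=> ww pN; have gc := good_cfg n_gt0 m_gt0 ww 0 0.
rewrite simple_flat //; last exact: flat_cfg.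
rewrite twistE => /rt_inj[]; first by apply/eqP => /gc; lia.
have pN' := ltnW pN; rewrite !cfgE ?(size_word ww) // !if_same !add0r.
move=> e1 e2 _; have x1 := letter_type e1; have x2 := letter_type e2; split=> //.
rewrite /beta /nxt pN !cfgE ?(size_word ww) //= x1 x2 in e1 e2 *.
have un x q : (letter x (before w q)%:Z).1 = (letter x (idx a x + shiftz i j x)).1 ->
    (letter x ((if x then - j else i) + (before w q)%:Z)).1 = (letter x (idx a x)).1.
  move/letter_mod => e; apply: letter_eqmod.
  rewrite -modzDmr e modzDmr; congr modz.
  by rewrite /shiftz; case: x {e}; ring.
by rewrite un // un.
Qed.

Hypothesis coprime_nm : coprime n m.

(** Stated for arbitrary pairs, because the intermediate pairs of [pe_trans] do not come with a
    partition; this lets the induction on [pair_equiv] go through. *)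
Definition extends_pair (X : set (Lamb K n m)) (p : set (Lamb K n m) * int) : Prop :=
  exists l s, [/\ is_partition n m l, p.1 = borel_fin l,
    aff_simple l p.2 s & X = extension s].

Lemma extends_pair_move X l k l' k' : is_partition n m l -> is_partition n m l' ->
  (forall s, aff_simple l k s -> exists2 s', aff_simple l' k' s' & extension (K := K)
    s' = extension s) ->
  extends_pair X (borel_fin l, k) <-> extends_pair X (borel_fin l', k').
Proof.
move=> lp lp' H; split=> -[l1 [s1 [lp1 /= /borel_fin_inj e h1 ->]]]; move: h1;
  rewrite -{}e //.
  by move=> /H[s' h' <-]; exists l', s'.
move=> h1; have [s h] := aff_simple_exists (K := K) n_gt0 m_gt0 coprime_nm k lp.
have [s' h' e] := H s h; exists l, s; split=> //.
by rewrite -e (aff_simple_unique charK n_gt0 m_gt0 coprime_nm h1 h').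
Qed.

Lemma pair_equiv_extends p q : pair_equiv p q -> forall X,
  extends_pair X p <-> extends_pair X q.
Proof.
elim=> {p q}.
- move=> l k lp rf X; have [w ww el] := r_fullP n_gt0 lp rf.
  have ww' := ww; rewrite is_word_rcons in ww'.
  apply: extends_pair_move => // [|s h]; first by rewrite el minus_r_parts
    is_partition_parts.
  have h' := as_minus_r lp rf h; exists (belast (ext_root s) s) => //.
  have [_ [a [b [_ es]]]] := aff_simple_sound charK n_gt0 m_gt0 h.
  rewrite el (word_parts ww) in es.
  have := simple_rot n_gt0 m_gt0 (a - 1) b ww'; rewrite subrK addr0 -es => e1.
  rewrite e1 -(simple_of_rotc n_gt0 m_gt0) !extension_simple //.
  by rewrite simples_rotc.
- move=> l k lp rf X; have [w ww el] := c_fullP m_gt0 lp rf.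
  have ww' := ww; rewrite -is_word_rcons in ww'.
  apply: extends_pair_move => // [|s h]; first by rewrite el minus_c_parts
    is_partition_parts.
  have h' := as_minus_c lp rf h; exists (rcons (behead s) (ext_root s)) => //.
  have [_ [a [b [_ es]]]] := aff_simple_sound charK n_gt0 m_gt0 h.
  by rewrite es -(simple_rotc n_gt0 m_gt0) !extension_simple // (simples_rotc n_gt0
    m_gt0).
- by [].
- by move=> p q _ IH X; rewrite IH.
- by move=> p q r _ IH1 _ IH2 X; rewrite IH1.
Qed.

Lemma pair_equiv_extension l k s l' k' s' : is_partition n m l -> is_partition n m l' ->
  aff_simple l k s -> aff_simple l' k' s' ->
  pair_equiv (borel_fin l, k) (borel_fin l', k') -> extension (K := K) s = extension s'.
Proof.
move=> lp lp' h h' /pair_equiv_extends/(_ (extension s))[+ _].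
case; first by exists l, s.
move=> l1 [s1 [lp1 /= /borel_fin_inj e h1 ->]]; rewrite -e // in h1.
by rewrite (aff_simple_unique charK n_gt0 m_gt0 coprime_nm h1 h').
Qed.

End Pairs.

(** * The functors *)

Section IsoFunctor.
Context {n m : nat} {Y : Type}.
Variables (O : isoroot n m -> set Y) (r : isoroot n m -> Y -> Y).
Hypothesis r_in : forall a y, O a y -> O (negr a) (r a y).
Hypothesis rK : forall a y, O a y -> r (negr a) (r a y) = y.

Lemma negr_neq (a : isoroot n m) : (negr a == a) = false.
Proof. by case: a => a []; rewrite /negr xpair_eqE eqxx. Qed.

(** The endpoints alone select the map, never the proof of [Thom a b], so the functor laws reduce to
    [rK]. The maps [r a] are total on [Y] but meaningful only on [O a]. *)
Definition along (a b : isoroot n m) : Y -> Y := if b == a then id else r a.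

Lemma along_in a b y : Thom a b -> O a y -> O b (along a b y).
Proof.
by case/orP => /eqP->; rewrite /along ?eqxx ?negr_neq // => /r_in.
Qed.

Lemma along_comp a b c y : Thom a b -> Thom b c -> O a y ->
  along b c (along a b y) = along a c y.
Proof.
case/orP => /eqP->; first by rewrite {2}/along eqxx.
case/orP => /eqP->; first by rewrite {1}/along eqxx.
by rewrite /along negrK eqxx negr_neq eq_sym negr_neq => /rK.
Qed.

Definition along_sub a b (f : Thom a b) (y : O a) : O b :=
  exist _ (along a b (sval y)) (mem_set (along_in f (set_mem (svalP y)))).

Lemma along_subK a b (f : Thom a b) : cancel (along_sub f) (along_sub (Thom_inv f)).
Proof.
move=> y; apply: val_inj => /=; rewrite along_comp //; last exact: set_mem (svalP y).
  by rewrite /along eqxx.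
exact: Thom_inv.
Qed.

Lemma along_sub_bij a b (f : Thom a b) : bijective (along_sub f).
Proof.
exists (along_sub (Thom_inv f)); first exact: along_subK.
by rewrite {2}(Prop_irrelevance f (Thom_inv (Thom_inv f))); exact: along_subK.
Qed.

Program Definition iso_functor : gfunctor (Tiso n m) (Sym Y) :=
  @GFunctor (Tiso n m) (Sym Y) O
    (fun a b f => exist _ (along_sub f) (along_sub_bij f)) _ _.
Next Obligation. by apply: sbij_eq => y; apply: val_inj; rewrite /= /along eqxx. Qed.
Next Obligation.
apply: sbij_eq => y; apply: val_inj => /=; rewrite along_comp //.
exact: set_mem (svalP y).
Qed.

Lemma iso_functor_rho a (y : O a) :
  sval (sval (fhom iso_functor (rho (a : Tiso n m))) y) = r a (sval y).
Proof. by rewrite /= /along negr_neq. Qed.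

End IsoFunctor.

Lemma bijection_of_rel (Y Z : Type) (R : Y -> Z -> Prop) :
  (forall y, exists z, R y z) -> (forall z, exists y, R y z) ->
  (forall y z z', R y z -> R y z' -> z = z') ->
  (forall y y' z, R y z -> R y' z -> y = y') ->
  exists w : bijection Y Z, forall y, R y (w y).
Proof.
move=> tot sur fn inj; pose f y := sval (cid (tot y)); pose g z := sval (cid (sur z)).
have fP y : R y (f y) := svalP (cid (tot y)).
have gP z : R (g z) z := svalP (cid (sur z)).
have fK : cancel f g by move=> y; exact: inj (gP _) (fP _).
have gK : cancel g f by move=> z; exact: fn (fP _) (gP _).
by exists (Bijection fK gK).
Qed.

Lemma eq_set_map (T T' : eqType) (f : T -> T') (s s' : seq T) :
  ([set` s] = [set` s'] -> [set` map f s] = [set` map f s'])%classic.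
Proof.
move=> e; have ss x : (x \in s) = (x \in s').
  by have := congr1 (fun A : set T => A x) e => /= ex; apply/idP/idP; rewrite ex.
apply/seteqP; split=> y /= /mapP[x xs ->]; apply: map_f; [rewrite -ss|rewrite ss] => //.
Qed.

Lemma borel_map_simples (K : closedFieldType) n m (N_gt1 : (1 < n + m)%N)
    (H : set (Lamb K n m)) (f : rootlat n m -> rootlat n m) (c c' : nat -> 'I_(n + m) *
      int) :
  simples c = simples c' ->
  (borel H [set` map f (ext_root (simple c) :: simple c)] =
   borel H [set` map f (ext_root (simple c') :: simple c')])%classic.
Proof.
move=> e; have {}e := etrans (mem_simples N_gt1 c) (etrans e (esym (mem_simples N_gt1
  c'))).
exact (f_equal (borel H) (eq_set_map f e)).
Qed.

Section Main.
Context {K : closedFieldType} {n m : nat}.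
Local Notation N := (n + m)%N.
Hypothesis charK : [pchar K] =i pred0.
Hypotheses (n_gt0 : (0 < n)%N) (m_gt0 : (0 < m)%N) (coprime_nm : coprime n m).
Local Open Scope classical_set_scope.
Local Notation cfg := (cfg n_gt0 m_gt0).
Local Notation aff_simple := (aff_simple K n m).
Local Notation borel_fin := (@borel_fin K n m).
Local Notation Borels_aff := (Borels_aff K n m).
Local Notation pair_classes := (pair_classes K n m).
Local Notation level := (@level n m).
Implicit Types (a : isoroot n m) (b : Borels_aff) (c d : int).

Let N_gt1 : (1 < N)%N := addn_gt1 n_gt0 m_gt0.

(** The numbering that matches a twist: with rows counted from [- j] and columns from [i], the
    shifts made by [twist i j] cancel. *)
Lemma level_twist (i j : int) : level (- j) i = i * n%:Z + j * m%:Z.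
Proof. by rewrite /level; ring. Qed.

Lemma aff_simple_cfg w c d : is_word n m w ->
  aff_simple (parts w) (level c d) (simple (cfg w c d)).
Proof.
move=> ww; have [s h] := aff_simple_exists (K := K) n_gt0 m_gt0 coprime_nm
  (level c d) (is_partition_parts ww).
have := aff_simple_eq charK n_gt0 m_gt0 coprime_nm h erefl.
by rewrite (word_parts ww) => <-.
Qed.

Lemma Borels_aff_cfg w c d : is_word n m w -> Borels_aff (extension (simple (cfg w c
  d))).
Proof.
move=> ww; exists (parts w), (level c d), (simple (cfg w c d)); split=> //.
  exact: is_partition_parts.
exact: aff_simple_cfg.
Qed.

Definition mkBorel w c d (ww : is_word n m w) : Borels_aff :=
  exist (fun X => X \in Borels_aff) _ (mem_set (Borels_aff_cfg c d ww)).

Lemma ext_root_reflect u x y v c d : is_word n m (u ++ x :: y :: v) -> x != y ->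
  map (reflect_root (K := K) (beta (cfg (u ++ x :: y :: v) c d) (size u)))
     (ext_root (simple (cfg (u ++ x :: y :: v) c d)) :: simple (cfg (u ++ x :: y :: v)
       c d)) =
  ext_root (simple (cfg (u ++ y :: x :: v) c d)) :: simple (cfg (u ++ y :: x :: v) c d).
Proof.
move=> ww xy; rewrite [LHS]/= (map_reflect_simple charK) // !ext_root_simple //.
by rewrite (reflect_simple charK) //; lia.
Qed.

Lemma nth_fin_simple u x y v : is_word n m (u ++ x :: y :: v) ->
  nth 0 (fin_simple (parts (u ++ x :: y :: v))) (size u) =
  beta (cfg (u ++ x :: y :: v) 0 0) (size u) :> rootlat n m.
Proof.
move=> ww; rewrite (fin_simple_parts n_gt0 m_gt0 ww) nth_mkseq //.
by rewrite -(size_word ww) size_cat /=; lia.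
Qed.

(** The graph of the odd reflection, read on words: the two letters forming the local name are
    exchanged. The word and the integers [i], [j] are far from unique. *)
Definition reflects a b b' : Prop := exists u x y v i j,
  [/\ is_word n m (u ++ x :: y :: v), x != y,
      beta (cfg (u ++ x :: y :: v) 0 0) (size u) = twist i j a,
      sval b = extension (simple (cfg (u ++ x :: y :: v) (- j) i)) &
      sval b' = extension (simple (cfg (u ++ y :: x :: v) (- j) i))].

Lemma local_nameP a (X : set (Lamb K n m)) l k s p i j : local_name X l k s p (twist i
  j a) ->
  k = i * n%:Z + j * m%:Z ->
  exists u x y v, let w := u ++ x :: y :: v in
  [/\ is_word n m w, x != y, beta (cfg w 0 0) (size u) = twist i j a,
      p = size u & l = parts w /\ s = simple (cfg w (- j) i)].
Proof.
move=> [lp h _ pr tw] ek; have [ww el] := partition_word lp.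
set w := @word m l in ww el.
have pN : (p.+1 < N)%N by move: pr; rewrite /rk; lia.
have sw := size_word ww.
have pw : (p < size w)%N by rewrite sw; lia.
have ew : w = take p w ++ nth false w p :: nth false w p.+1 :: drop p.+2 w.
  by rewrite -!drop_nth ?cat_take_drop // sw.
have sp : size (take p w) = p by rewrite size_take pw.
rewrite -el (fin_simple_parts n_gt0 m_gt0 ww) nth_mkseq in tw; last by lia.
have [x1 x2 _] := beta_of_local_name ww pN tw.
exists (take p w), (nth false w p), (nth false w p.+1), (drop p.+2 w) => /=.
rewrite -ew sp; split=> //.
- by rewrite x1 x2; case: (a.2).
- split=> //; rewrite -level_twist in ek.
  exact: (aff_simple_eq charK n_gt0 m_gt0 coprime_nm h ek).
Qed.

Lemma reflects_local_name a b b' : reflects a b b' ->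
  exists l i j s p, local_name (sval b) l (i * n%:Z + j * m%:Z) s p (twist i j a).
Proof.
move=> [u [x [y [v [i [j [ww xy tw eb _]]]]]]].
exists (parts (u ++ x :: y :: v)), i, j, (simple (cfg (u ++ x :: y :: v) (- j) i)),
  (size u).
split=> //.
- exact: is_partition_parts.
- by rewrite -level_twist; exact: aff_simple_cfg.
- by have := size_word ww; rewrite /rk size_cat /=; lia.
- by rewrite nth_fin_simple.
Qed.

Lemma reflects_exists a b : B_obj a b -> exists b', reflects a b b'.
Proof.
case=> l [i [j [s [p ln]]]]; have [_ _ eb _ _] := ln.
have [u [x [y [v [ww xy tw _ [_ es]]]]]] := local_nameP ln erefl.
have ww' := ww; rewrite (is_word_perm _ _ (perm_swap_adjacent u x y v)) in ww'.
by exists (mkBorel (- j) i ww'), u, x, y, v, i, j; split=> //; rewrite eb es.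
Qed.

Lemma twist_negr i j a : twist i j (negr a) = - twist i j a.
Proof. by case: a => a []; rewrite /twist /= ?opprK. Qed.

Lemma reflects_sym a b b' : reflects a b b' -> reflects (negr a) b' b.
Proof.
move=> [u [x [y [v [i [j [ww xy tw eb eb']]]]]]].
have ww' := ww; rewrite (is_word_perm _ _ (perm_swap_adjacent u x y v)) in ww'.
exists u, y, x, v, i, j; split=> //; first by rewrite eq_sym.
rewrite -(reflect_simple charK n_gt0 m_gt0 0 0 ww xy); last by have := size_word ww;
  rewrite size_cat /=; lia.
by rewrite /reflect_root eqxx tw twist_negr.
Qed.

(** Two presentations of [b] have the same set of simple roots, and both reflecting roots are
    congruent to [a] modulo [imag]. By [beta_inj] they coincide, so one and the same map is applied
    to one and the same set. *)
Lemma reflects_unique a b b1 b2 : reflects a b b1 -> reflects a b b2 -> b1 = b2.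
Proof.
move=> [u [x [y [v [i [j [ww xy tw eb eb1]]]]]]].
move=> [u' [x' [y' [v' [i' [j' [ww' xy' tw' eb' eb2]]]]]]].
have ss : simples (cfg (u ++ x :: y :: v) (- j) i) = simples (cfg (u' ++ x' :: y' ::
  v') (- j') i').
  apply: (extension_simples charK N_gt1); try exact: good_cfg.
  by rewrite -eb -eb'.
have sz : ((size u).+1 < N)%N by have := size_word ww; rewrite size_cat /=; lia.
have sz' : ((size u').+1 < N)%N by have := size_word ww'; rewrite size_cat /=; lia.
have [_ _ n1] := beta_of_local_name ww sz tw.
have [_ _ n2] := beta_of_local_name ww' sz' tw'.
have bb : beta (cfg (u ++ x :: y :: v) (- j) i) (size u) = beta (cfg (u' ++ x' :: y' ::
  v') (- j') i') (size u').
  have : simples (cfg (u' ++ x' :: y' :: v') (- j') i') (beta (cfg (u ++ x :: y :: v)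
    (- j) i) (size u)).
    by rewrite -ss; exists (size u) => //; exact: ltnW.
  case=> q qN e; rewrite e; congr beta; move: n1; rewrite e -n2.
  by apply: (beta_inj N_gt1) => //; [exact: good_cfg|exact: ltnW].
apply: val_inj; rewrite /= eb1 eb2 /extension.
rewrite -(ext_root_reflect _ _ ww xy) -(ext_root_reflect _ _ ww' xy') -bb.
exact: (borel_map_simples N_gt1).
Qed.

Definition refl_map a b : Borels_aff :=
  if pselect (exists b', reflects a b b') is left h then sval (cid h) else b.

Lemma refl_mapP a b b' : reflects a b b' -> refl_map a b = b'.
Proof.
move=> h; rewrite /refl_map; case: pselect => [ex|[]]; last by exists b'.
exact: reflects_unique (svalP (cid ex)) h.
Qed.

Lemma refl_map_reflects a b : B_obj a b -> reflects a b (refl_map a b).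
Proof. by move/reflects_exists => [b' h]; rewrite (refl_mapP h). Qed.

Lemma refl_map_in a b : B_obj a b -> B_obj (negr a) (refl_map a b).
Proof. by move/refl_map_reflects/reflects_sym/reflects_local_name. Qed.

Lemma refl_mapK a b : B_obj a b -> refl_map (negr a) (refl_map a b) = b.
Proof. by move/refl_map_reflects/reflects_sym/refl_mapP. Qed.

Definition Bfun : gfunctor (Tiso n m) (Sym Borels_aff) :=
  iso_functor refl_map_in refl_mapK.

Lemma is_B_Bfun : is_B Bfun.
Proof.
split=> // a b l i j s p ln; rewrite iso_functor_rho.
have [_ _ eb _ _] := ln.
have [u [x [y [v [ww xy tw ep [_ es]]]]]] := local_nameP ln erefl.
have ww' := ww; rewrite (is_word_perm _ _ (perm_swap_adjacent u x y v)) in ww'.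
have rf : reflects a (sval b) (mkBorel (- j) i ww').
  by exists u, x, y, v, i, j; split=> //; rewrite eb es.
have gc := good_cfg n_gt0 m_gt0 ww (- j) i.
have uN : (size u < N.-1)%N by have := size_word ww; rewrite size_cat /=; lia.
rewrite (refl_mapP rf) eb es ep nth_mkseq //.
exists (ext_root (simple (cfg (u ++ x :: y :: v) (- j) i)) :: simple (cfg (u ++ x :: y
  :: v) (- j) i)).
split; first exact: extension_has_simple_roots.
  by rewrite inE; apply/orP; right; apply/mem_simple => //; exists (size u) => //; lia.
by rewrite (ext_root_reflect _ _ ww xy).
Qed.

Definition corresponds (b : Borels_aff) (C : pair_classes) : Prop :=
  exists l k s, [/\ is_partition n m l, aff_simple l k s, sval b = extension s &
    sval C = pair_class (borel_fin l) k].

Lemma borel_fin_Borels l : is_partition n m l -> Borels_fin (borel_fin l).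
Proof. by move=> /partsP[w ww ->]; apply: Borels_fin_parts. Qed.

(** Equal extensions come from equivalent pairs, which makes the correspondence a function;
    equivalent pairs have equal extensions, which makes it injective. *)
Lemma matches_exists : exists w : bijection Borels_aff pair_classes, matches w.
Proof.
have [||||w wP] := @bijection_of_rel Borels_aff pair_classes corresponds.
- move=> b; have [l [k [s [lp h e]]]] := set_mem (svalP b).
  have C : pair_class (borel_fin l) k \in pair_classes.
    by apply: mem_set; exists (borel_fin l), k; split=> //; exact: borel_fin_Borels.
  by exists (exist (fun C => C \in pair_classes) _ C), l, k, s; split.
- move=> C; have [b [k [/(Borels_finP charK n_gt0 m_gt0)[w ww ->] e]]] := set_mem
  (svalP C).
  have lp := is_partition_parts ww.
  have [s h] := aff_simple_exists (K := K) n_gt0 m_gt0 coprime_nm k lp.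
  have B : extension s \in Borels_aff by apply: mem_set; exists (parts w), k, s.
  by exists (exist (fun X => X \in Borels_aff) _ B), (parts w), k, s; split.
- move=> b C C' [l [k [s [lp h e eC]]]] [l' [k' [s' [lp' h' e' eC']]]].
  apply: val_inj; rewrite /= eC eC'; apply/pair_class_eq.
  by apply: (extension_pair_equiv charK n_gt0 m_gt0 h h'); rewrite -e -e'.
- move=> b b' C [l [k [s [lp h e eC]]]] [l' [k' [s' [lp' h' e' eC']]]].
  apply: val_inj; rewrite /= e e'.
  apply: (pair_equiv_extension charK n_gt0 m_gt0 coprime_nm lp lp' h h').
  by apply/pair_class_eq; rewrite -eC -eC'.
exists w => b l k s lp h e; have [l' [k' [s' [lp' h' e' ->]]]] := wP b.
apply/pair_class_eq.
by apply: (extension_pair_equiv charK n_gt0 m_gt0 h' h); rewrite -e -e'.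
Qed.

Section Comparison.
Context (w : bijection Borels_aff pair_classes).
Hypothesis wP : matches w.

Lemma class_mem (C : pair_classes) B k : sval C (B, k) -> sval C = pair_class B k.
Proof.
by have [b0 [k0 [_ ->]]] := set_mem (svalP C) => /pair_class_eq.
Qed.

(** A list of simple roots comes in no particular order, so lists are compared as sets, which is all
    that [borel] sees. *)
Lemma Borels_fin_at_nth (g : rootlat n m) B : Borels_fin_at g B ->
  exists v p, [/\ is_word n m v, B = borel_fin (parts v), (p < rk (n := n) (m := m))%N,
    beta (cfg v 0 0) p = g & forall s, has_simple_roots (@cartan_fin K n m) B s ->
      [set` s] = [set` simple (cfg v 0 0)]].
Proof.
move=> [/(Borels_finP charK n_gt0 m_gt0)[v vw ->] [s hs gs]].
have uniq_s s' : has_simple_roots (@cartan_fin K n m) (borel_fin (parts v)) s' ->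
    s' =i simple (cfg v 0 0).
  rewrite (borel_fin_parts n_gt0 m_gt0 vw); apply: borelc_simple_roots_unique => //.
    exact: good_cfg.
  exact: flat_cfg.
have := gs; rewrite uniq_s // => /(mem_simple N_gt1)[p pN ->].
exists v, p; split=> //; first by rewrite /rk; lia.
by move=> s' /uniq_s e; apply/seteqP; split=> h /=; rewrite e.
Qed.

Lemma class_local_name (C : pair_classes) a B i j : Borels_fin_at (twist i j a) B ->
  sval C (B, i * n%:Z + j * m%:Z) ->
  exists v p, [/\ is_word n m v, B = borel_fin (parts v),
    local_name (sval (binv w C)) (parts v) (i * n%:Z + j * m%:Z) (simple (cfg v (- j)
      i)) p (twist i j a),
    beta (cfg v 0 0) p = twist i j a &
    forall s, has_simple_roots (@cartan_fin K n m) B s -> [set` s] = [set` simple (cfg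
      v 0 0)]].
Proof.
move=> /Borels_fin_at_nth[v [p [vw eB pr bp us]]] /class_mem eC.
exists v, p; split=> //.
have h := aff_simple_cfg (- j) i vw; rewrite level_twist in h.
have wv : w (mkBorel (- j) i vw) = C.
  by apply: val_inj; rewrite /= (wP _ h) // ?eC ?eB //; exact: is_partition_parts.
split=> //; first exact: is_partition_parts.
  by rewrite -wv bfunK.
by rewrite (fin_simple_parts n_gt0 m_gt0 vw) nth_mkseq.
Qed.

Lemma is_BB_conj : is_BB (gfunctor_comp (Sym_conj w) Bfun).
Proof.
split=> [a|a C B B' i j at_B CB]; last first.
  case=> s0 [hs _ ->].
  have [v [p [vw eB ln bp us]]] := class_local_name at_B CB.
  rewrite -[sval (sval _)]/(sval (w (sval (sval (fhom Bfun (rho (a : Tiso n m)))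
    (exist _ (binv w (sval C)) (conj_out C)))))) iso_functor_rho /=.
  have [u [x [y [t [ww xy tw ep [el es]]]]]] := local_nameP ln erefl.
  have ww' := ww; rewrite (is_word_perm _ _ (perm_swap_adjacent u x y t)) in ww'.
  have ev : v = u ++ x :: y :: t.
    by rewrite -(word_parts vw) el (word_parts ww).
  rewrite {}ev in vw eB ln bp us es el *.
  have rf : reflects a (binv w (sval C)) (mkBorel (- j) i ww').
    by exists u, x, y, t, i, j; split=> //; have [_ _ -> _ _] := ln.
  rewrite (refl_mapP rf) -level_twist.
  rewrite (wP (is_partition_parts ww') (aff_simple_cfg (- j) i ww')) //.
  congr pair_class; rewrite /Defs.borel_fin (fin_simple_parts n_gt0 m_gt0 ww').
  (* The same exchange of letters, read with the numbering [(0, 0)] instead of [(- j, i)], is the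
     finite odd reflection. *)
  congr borel; rewrite -(map_reflect_simple charK n_gt0 m_gt0 0 0 ww xy) tw.
  exact: (eq_set_map _ (esym (us _ hs))).
apply/seteqP; split=> C.
  move=> [l [i [j [s [p ln]]]]]; have [lp h e pr nt] := ln.
  have eC : sval C = pair_class (borel_fin l) (i * n%:Z + j * m%:Z).
    by rewrite -(wP lp h e) binvK.
  exists (borel_fin l), i, j; split; last by rewrite eC; exact: pe_refl.
  split; first exact: borel_fin_Borels.
  exists (fin_simple l); last by rewrite -nt mem_nth // size_mkseq.
  have [v vw ->] := partsP lp.
  rewrite (fin_simple_parts n_gt0 m_gt0 vw) (borel_fin_parts n_gt0 m_gt0 vw).
  by apply: borelc_has_simple_roots => //; exact: good_cfg.
move=> [B [i [j [at_B CB]]]].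
have [v [p [vw eB ln bp us]]] := class_local_name at_B CB.
by exists (parts v), i, j, (simple (cfg v (- j) i)), p.
Qed.

End Comparison.
End Main.

Theorem theorem4p5 (K : closedFieldType) (charK : [pchar K] =i pred0)
    (n m : nat) (n_gt0 : (0 < n)%N) (m_gt0 : (0 < m)%N)
    (coprime_nm : coprime n m) :
  (forall (l : seq nat) (k : int), is_partition n m l ->
     exists! s : seq (rootlat n m), aff_simple K n m l k s) /\
  exists (B : gfunctor (Tiso n m) (Sym (Borels_aff K n m)))
         (BB : gfunctor (Tiso n m) (Sym (pair_classes K n m)))
         (w : bijection (Borels_aff K n m) (pair_classes K n m)),
    [/\ is_B B, is_BB BB, matches w & gfunctor_comp (Sym_conj w) B = BB].
Proof.
split=> [l k lp|].
  have [s h] := aff_simple_exists (K := K) n_gt0 m_gt0 coprime_nm k lp.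
  by exists s; split=> // s'; apply: aff_simple_unique h.
have [w wP] := matches_exists charK n_gt0 m_gt0 coprime_nm.
pose B := Bfun charK n_gt0 m_gt0 coprime_nm.
(* The diagram commutes by construction; its content is that the transported functor satisfies
   [is_BB]. *)
exists B, (gfunctor_comp (Sym_conj w) B), w.
by split=> //; [exact: is_B_Bfun|exact: is_BB_conj].
Qed.
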